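(* Let $k\in(0,1)$, and for $m,n\in\mathbb{N}_0$ let $$H^{(f)}_{m,n}=\binom{2n}{n}\binom{2m}{m}\left(\frac k4\right)^{m+n}\frac{\sqrt{(2n+1)(2m+1)}}{m+n+1},\qquad H^{(g)}_{m,n}=\binom{2n+1}{n}\binom{2m+1}{m}\left(\frac k4\right)^{m+n}\frac{\sqrt{(m+1)(n+1)}}{m+n+2}.$$ The matrices $H^{(f)}$ and $H^{(g)}$ both represent positive trace class operators on $\ell^2(\mathbb{N}_0)$ with simple eigenvalues. Moreover: (i) The eigenvalues of $H^{(f)}$ enumerated in descending order are $$\nu_m^{(f)}=\frac4k\,\frac{q^{m+1/2}}{1+q^{2m+1}},\quad m\ge0.$$ An eigenvector $\Psi_m^{(f)}$ corresponding to $\nu_m^{(f)}$ can be chosen with the entries $$(\Psi_m^{(f)})_n=\frac{1}{k^n(2n)!\sqrt{2n+1}}\,f_n\!\left(-\frac{\pi^2(2m+1)^2}{4K^2}\right),\quad n\ge0,$$ and its $\ell^2$-norm satisfies $$\|\Psi_m^{(f)}\|^2=\frac{kK^2}{\pi^2}\,\frac{1-q^{2m+1}}{(2m+1)q^{m+1/2}}.$$ (ii) The eigenvalues of $H^{(g)}$ enumerated in descending order are $$\nu_m^{(g)}=\frac{8}{k^2}\,\frac{q^m}{1+q^{2m}},\quad m\ge1.$$ An eigenvector $\Psi_m^{(g)}$ corresponding to $\nu_m^{(g)}$ can be chosen with the entries $$(\Psi_m^{(g)})_n=\frac{1}{k^n(2n+1)!\sqrt{n+1}}\,g_n\!\left(-\frac{\pi^2m^2}{K^2}\right),\quad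 n\ge0,$$ and its $\ell^2$-norm satisfies $$\|\Psi_m^{(g)}\|^2=\frac{k^2K^4}{\pi^4}\,\frac{1-q^{2m}}{m^3q^m}.$$
   Context: $\mathbb{N}_0=\{0,1,2,\dots\}$. For $k\in(0,1)$: $K=K(k)=\int_0^{\pi/2}\frac{d\theta}{\sqrt{1-k^2\sin^2\theta}}$, $K'(k)=K(\sqrt{1-k^2})$, and $q=\exp(-\pi K'(k)/K(k))\in(0,1)$ is the elliptic nome. The monic Stieltjes-Carlitz polynomials $f_n,g_n$ (depending on $k$) are defined for $n\ge0$ by $$f_{n+1}(x)=\big(x+(k^2+1)(2n+1)^2\big)f_n(x)-k^2(2n-1)(2n)^2(2n+1)f_{n-1}(x),$$ $$g_{n+1}(x)=\big(x+(k^2+1)(2n+2)^2\big)g_n(x)-k^2(2n)(2n+1)^2(2n+2)g_{n-1}(x),$$ with $f_{-1}=g_{-1}=0$ and $f_0=g_0=1$. The enumerated eigenvalues are all the eigenvalues of the respective operator; ''simple'' means multiplicity one. *)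

(* Defs.v *)
(* Stdlib reals with Coquelicot. *)
From Stdlib Require Import Reals Factorial.
From Coquelicot Require Import Coquelicot.
Open Scope R_scope.

(** * The complex Hilbert space l^2(N_0)

    Vectors are functions [nat -> C] satisfying [l2]; operators are functions
    on [nat -> C] whose values matter only on [l2]. *)

Definition l2 (u : nat -> C) : Prop := ex_series (fun n => Cmod (u n) ^ 2).

Definition l2norm (u : nat -> C) : R := sqrt (Series (fun n => Cmod (u n) ^ 2)).

Definition CSeries (a : nat -> C) : C :=
  (Series (fun n => Re (a n)), Series (fun n => Im (a n))).

(* Linear in the first argument; the series converges absolutely on [l2]. *)
Definition inner (u v : nat -> C) : C := CSeries (fun n => (u n * Cconj (v n))%C).

Definition basis_vec (n : nat) : nat -> C :=
  fun i => if Nat.eqb i n then RtoC 1 else RtoC 0.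

Definition bounded_operator (T : (nat -> C) -> (nat -> C)) : Prop :=
  (forall u, l2 u -> l2 (T u)) /\
  (forall (a b : C) (u v : nat -> C), l2 u -> l2 v ->
     forall n, T (fun i => (a * u i + b * v i)%C) n = (a * T u n + b * T v n)%C) /\
  (exists M : R, forall u, l2 u -> l2norm (T u) <= M * l2norm u).

Definition represents (H : nat -> nat -> R) (T : (nat -> C) -> (nat -> C)) : Prop :=
  forall m n : nat, inner (T (basis_vec n)) (basis_vec m) = RtoC (H m n).

Definition is_adjoint (T S : (nat -> C) -> (nat -> C)) : Prop :=
  forall u v, l2 u -> l2 v -> inner (T u) v = inner u (S v).

Definition positive_operator (T : (nat -> C) -> (nat -> C)) : Prop :=
  forall u, l2 u -> Im (inner (T u) u) = 0 /\ 0 <= Re (inner (T u) u).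

(* [P] is the absolute value of [T], i.e. the positive square root of T^* T. *)
Definition is_absolute_value (T P : (nat -> C) -> (nat -> C)) : Prop :=
  bounded_operator P /\ positive_operator P /\
  exists S, bounded_operator S /\ is_adjoint T S /\
    forall u, l2 u -> forall n, P (P u) n = S (T u) n.

(* The trace of |T| >= 0 does not depend on the orthonormal basis; it is taken
   here in the canonical one. *)
Definition trace_class (T : (nat -> C) -> (nat -> C)) : Prop :=
  bounded_operator T /\
  exists P, is_absolute_value T P /\
    ex_series (fun n => Re (inner (P (basis_vec n)) (basis_vec n))).

Definition is_eigenvector (T : (nat -> C) -> (nat -> C)) (lambda : C)
    (u : nat -> C) : Prop :=
  l2 u /\ (exists n, u n <> RtoC 0) /\ forall n, T u n = (lambda * u n)%C.

Definition is_eigenvalue (T : (nat -> C) -> (nat -> C)) (lambda : C) : Prop :=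
  exists u, is_eigenvector T lambda u.

Definition simple_eigenvalues (T : (nat -> C) -> (nat -> C)) : Prop :=
  forall (lambda : C) (u v : nat -> C),
    is_eigenvector T lambda u -> is_eigenvector T lambda v ->
    exists c : C, forall n, v n = (c * u n)%C.

(* Since the eigenvalues are simple, a descending enumeration is strict. *)
Definition eigenvalues_in_descending_order (T : (nat -> C) -> (nat -> C))
    (nu : nat -> R) : Prop :=
  (forall m, nu (S m) < nu m) /\
  (forall lambda : C, is_eigenvalue T lambda <-> exists m, lambda = RtoC (nu m)).

(** * Elliptic integral and nome *)

Definition ellipticK (k : R) : R :=
  RInt (fun t => / sqrt (1 - k ^ 2 * sin t ^ 2)) 0 (PI / 2).

Definition nome (k : R) : R :=
  exp (- PI * ellipticK (sqrt (1 - k ^ 2)) / ellipticK k).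

(** * Stieltjes-Carlitz polynomials (the inner [0] branch is the index -1) *)

Fixpoint SC_f (k : R) (n : nat) (x : R) {struct n} : R :=
  match n with
  | 0%nat => 1
  | S p =>
      (x + (k ^ 2 + 1) * (2 * INR p + 1) ^ 2) * SC_f k p x
      - k ^ 2 * (2 * INR p - 1) * (2 * INR p) ^ 2 * (2 * INR p + 1)
        * match p with 0%nat => 0 | S r => SC_f k r x end
  end.

Fixpoint SC_g (k : R) (n : nat) (x : R) {struct n} : R :=
  match n with
  | 0%nat => 1
  | S p =>
      (x + (k ^ 2 + 1) * (2 * INR p + 2) ^ 2) * SC_g k p x
      - k ^ 2 * (2 * INR p) * (2 * INR p + 1) ^ 2 * (2 * INR p + 2)
        * match p with 0%nat => 0 | S r => SC_g k r x end
  end.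

(** * The two matrices, their eigenvalues and eigenvectors

    [Binomial.C] is the real-valued binomial coefficient; the bare [C] is the
    type of complex numbers. *)

Definition Hf (k : R) (m n : nat) : R :=
  Binomial.C (2 * n) n * Binomial.C (2 * m) m * (k / 4) ^ (m + n)
  * (sqrt ((2 * INR n + 1) * (2 * INR m + 1)) / (INR m + INR n + 1)).

Definition Hg (k : R) (m n : nat) : R :=
  Binomial.C (2 * n + 1) n * Binomial.C (2 * m + 1) m * (k / 4) ^ (m + n)
  * (sqrt ((INR m + 1) * (INR n + 1)) / (INR m + INR n + 2)).

Definition nu_f (k : R) (m : nat) : R :=
  4 / k * (Rpower (nome k) (INR m + 1 / 2) / (1 + nome k ^ (2 * m + 1))).

Definition nu_g (k : R) (m : nat) : R :=
  8 / k ^ 2 * (nome k ^ m / (1 + nome k ^ (2 * m))).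

Definition Psi_f (k : R) (m : nat) : nat -> C := fun n =>
  RtoC (1 / (k ^ n * INR (fact (2 * n)) * sqrt (2 * INR n + 1))
        * SC_f k n (- (PI ^ 2 * (2 * INR m + 1) ^ 2 / (4 * ellipticK k ^ 2)))).

Definition Psi_g (k : R) (m : nat) : nat -> C := fun n =>
  RtoC (1 / (k ^ n * INR (fact (2 * n + 1)) * sqrt (INR n + 1))
        * SC_g k n (- (PI ^ 2 * INR m ^ 2 / ellipticK k ^ 2))).

(* Main.v *)
(* Only real variables are used. With s = sn v, the generating function of the polynomials at
   x = - xi^2 solves u'' = - xi^2 u up to a constant, so f_n and g_n are, up to explicit factors,
   the coefficients D_n of the kernel 1 / (1 - k^2 z sn^2) paired with c(xi v) over a quarter
   period K. The boundary conditions hold exactly when xi is an odd (for f, p = 0) or even (for g,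
   p = 1) multiple of PI / (2 K). Everything is written in the amplitude phi, with sn = sin phi and
   v = ellF k phi, so that ellF is never inverted.

   The pairing with the kernel satisfies a second order equation in z. For z = sin^2 it gives the
   generating function in closed form, hence the norms. For z = - tan^2, that is along the imaginary
   axis, its solutions are hyperbolic functions of xi (ellF k' psi), and at psi = PI / 2 the kernel
   becomes half of a Poisson kernel; comparing the two values yields the Fourier coefficients of sn,
   sn^2, cn and dn.

   The matrix maps (D_n) to another solution of the same three-term recurrence, hence to a multiple
   of (D_n); the factor is read off at n = 0 with Wallis' integrals, as a Fourier coefficient of cn
   or dn. A vector orthogonal to all eigenvectors gives a power series A in sn^2 whose integrals
   against all cos^(2 N) (PI v / (2 K)) vanish; concentration of these weights at 0 forces A = 0. *)
Require Import Defs.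
From Stdlib Require Import Reals Lra Lia Psatz Factorial Classical Wf_nat FunctionalExtensionality.
From Coquelicot Require Import Coquelicot.
Open Scope R_scope.

(** * Elliptic integrals and the kernel of the addition formulas *)

(** The classical route goes through elliptic functions of a complex variable and residues. Here one
    integral takes their place: as a function of [z], the pairing with the kernel obeys a linear
    equation whose boundary terms vanish at the chosen frequencies, and the same equation is used
    for [z >= 0] and for [z <= 0]. As [z] tends to minus infinity the kernel concentrates at
    [phi = 0], so that the limit only sees the value of the weight there; this is what makes a
    Fourier coefficient computable. The matrix preserves the recurrence because consecutive central
    binomials have ratios given by quadratic polynomials whose differences are divisible by the
    shifted Cauchy denominators; the commutator then telescopes. No spectral theorem is involved: an
    eigenvector for any other value would be orthogonal to a complete family, and simplicity follows
    in the same way. The rate [sqrt k] recurs because entries of order [sqrt (2 n + 1) * k ^ n] are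
    not bounded by a multiple of [k ^ n]; half of the decay is spent on powers of [n]. The cases
    [p = 0] (f) and [p = 1] (g) share one text wherever their boundary values at 0 allow it. *)

Definition QInt (f : R -> R) : R := RInt f 0 (PI / 2).

Lemma ex_RInt_cont (f : R -> R) (a b : R) :
  (forall x, continuous f x) -> ex_RInt f a b.
Proof. intros Hf; apply (ex_RInt_continuous f); auto. Qed.

Lemma QInt_ext (f g : R -> R) : (forall x, f x = g x) -> QInt f = QInt g.
Proof. intros H; apply RInt_ext; auto. Qed.

Lemma QInt_lin (a b : R) (f g : R -> R) :
  (forall x, continuous f x) -> (forall x, continuous g x) ->
  QInt (fun x => a * f x + b * g x) = a * QInt f + b * QInt g.
Proof.
intros Hf Hg; unfold QInt.
assert (If := ex_RInt_cont f 0 (PI / 2) Hf).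
assert (Ig := ex_RInt_cont g 0 (PI / 2) Hg).
apply is_RInt_unique, (is_RInt_plus (fun x => a * f x) (fun x => b * g x)).
- apply (is_RInt_scal f), (RInt_correct f), If.
- apply (is_RInt_scal g), (RInt_correct g), Ig.
Qed.

Lemma QInt_combination (a b : R) (f g h : R -> R) :
  (forall x, continuous f x) -> (forall x, continuous g x) ->
  (forall x, h x = a * f x + b * g x) -> QInt h = a * QInt f + b * QInt g.
Proof. intros Hf Hg Hh; rewrite <- QInt_lin by assumption; apply QInt_ext, Hh. Qed.

Lemma QInt_scal (a : R) (f : R -> R) :
  (forall x, continuous f x) -> QInt (fun x => a * f x) = a * QInt f.
Proof. intros Hf; apply (RInt_scal f); apply ex_RInt_cont; assumption. Qed.

Lemma continuous_lin (a b : R) (f g : R -> R) :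
  (forall x, continuous f x) -> (forall x, continuous g x) ->
  forall x, continuous (fun x => a * f x + b * g x) x.
Proof.
intros Hf Hg x.
apply (continuous_plus (fun x => a * f x) (fun x => b * g x));
  [apply (continuous_scal_r a f) | apply (continuous_scal_r b g)]; auto.
Qed.

Lemma QInt_derive (G g : R -> R) :
  (forall x, is_derive G x (g x)) -> (forall x, continuous g x) ->
  QInt g = G (PI / 2) - G 0.
Proof.
intros HG Hg; apply is_RInt_unique.
apply (is_RInt_derive G g); auto.
Qed.

Section Modulus.

Variable k : R.
Hypothesis hk : 0 < k < 1.

Definition delta (phi : R) : R := sqrt (1 - k ^ 2 * sin phi ^ 2).

Lemma sin2_range (phi : R) : 0 <= sin phi ^ 2 <= 1.
Proof. generalize (SIN_bound phi); nra. Qed.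

Lemma cos_sqr (phi : R) : cos phi ^ 2 = 1 - sin phi ^ 2.
Proof. generalize (sin2_cos2 phi); unfold Rsqr; intros; nra. Qed.

Lemma k2_range : 0 < k ^ 2 < 1.
Proof. nra. Qed.

Lemma delta_arg_pos (phi : R) : 0 < 1 - k ^ 2 * sin phi ^ 2.
Proof. generalize k2_range (sin2_range phi); nra. Qed.

Lemma delta_pos (phi : R) : 0 < delta phi.
Proof. apply sqrt_lt_R0, delta_arg_pos. Qed.

Lemma delta_sqr (phi : R) : delta phi ^ 2 = 1 - k ^ 2 * sin phi ^ 2.
Proof. apply pow2_sqrt; generalize (delta_arg_pos phi); lra. Qed.

Lemma is_derive_delta (phi : R) :
  is_derive delta phi (- (k ^ 2 * sin phi * cos phi / delta phi)).
Proof.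
unfold delta; auto_derive.
- generalize (delta_arg_pos phi); simpl; lra.
- replace (1 + - (k * (k * 1) * (sin phi * (sin phi * 1)))) with (1 - k ^ 2 * sin phi ^ 2) by ring.
  field; apply Rgt_not_eq, (delta_pos phi).
Qed.

Lemma ex_derive_delta (phi : R) : ex_derive delta phi.
Proof. eexists; apply is_derive_delta. Qed.

Lemma Derive_delta (phi : R) :
  Derive (fun x => delta x) phi = - (k ^ 2 * sin phi * cos phi / delta phi).
Proof. apply is_derive_unique, is_derive_delta. Qed.

Lemma delta_lower (phi : R) : sqrt (1 - k ^ 2) <= delta phi.
Proof. apply sqrt_le_1_alt; generalize k2_range (sin2_range phi); nra. Qed.

Definition ellF (phi : R) : R := RInt (fun t => / delta t) 0 phi.

Lemma continuous_inv_delta (x : R) : continuous (fun t => / delta t) x.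
Proof.
apply (ex_derive_continuous (fun t => / delta t)); auto_derive.
split; [apply ex_derive_delta | split; [apply Rgt_not_eq, delta_pos | trivial]].
Qed.

Lemma is_derive_ellF (phi : R) : is_derive ellF phi (/ delta phi).
Proof.
apply (is_derive_RInt (fun t => / delta t) ellF 0).
- apply filter_forall; intros y; apply (RInt_correct (fun t => / delta t)), ex_RInt_cont, continuous_inv_delta.
- apply continuous_inv_delta.
Qed.

Lemma ellF_0 : ellF 0 = 0.
Proof. apply (RInt_point 0 (fun t => / delta t)). Qed.

Lemma ellF_PI2 : ellF (PI / 2) = ellipticK k.
Proof. reflexivity. Qed.

(* [z] is the square of [sn] at a second argument: in [0, 1] if that is real, negative if imaginary. *)
Definition kappa (z phi : R) : R := / (1 - k ^ 2 * z * sin phi ^ 2).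

Lemma kappa_den_pos (z phi : R) : k ^ 2 * z < 1 -> 0 < 1 - k ^ 2 * z * sin phi ^ 2.
Proof.
intros Hz; generalize (sin2_range phi); intros Hs.
destruct (Rle_dec (k ^ 2 * z) 0); nra.
Qed.

Lemma kappa_pos (z phi : R) : k ^ 2 * z < 1 -> 0 < kappa z phi.
Proof. intros; apply Rinv_0_lt_compat, kappa_den_pos; auto. Qed.

Lemma is_derive_kappa_phi (z phi : R) : k ^ 2 * z < 1 ->
  is_derive (kappa z) phi (2 * k ^ 2 * z * sin phi * cos phi * kappa z phi ^ 2).
Proof.
intros Hz; generalize (kappa_den_pos z phi Hz); intros Hd.
unfold kappa; auto_derive.
- simpl in Hd |- *; lra.
- field; simpl in Hd |- *; lra.
Qed.

Lemma is_derive_kappa_z (z phi : R) : k ^ 2 * z < 1 ->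
  is_derive (fun z => kappa z phi) z (k ^ 2 * sin phi ^ 2 * kappa z phi ^ 2).
Proof.
intros Hz; generalize (kappa_den_pos z phi Hz); intros Hd.
unfold kappa; auto_derive.
- simpl in Hd |- *; lra.
- field; simpl in Hd |- *; lra.
Qed.

Lemma continuous_kappa (z phi : R) : k ^ 2 * z < 1 -> continuous (kappa z) phi.
Proof.
intros Hz; apply (ex_derive_continuous (kappa z)); eexists; apply is_derive_kappa_phi, Hz.
Qed.

Lemma continuous_Rmult (f g : R -> R) (x : R) :
  continuous f x -> continuous g x -> continuous (fun y => f y * g y) x.
Proof. apply (continuous_mult f g). Qed.

Lemma continuous_sin (x : R) : continuous sin x.
Proof. apply (ex_derive_continuous sin); auto_derive; trivial. Qed.

Lemma continuous_cos (x : R) : continuous cos x.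
Proof. apply (ex_derive_continuous cos); auto_derive; trivial. Qed.

Lemma continuous_Rpow (f : R -> R) (n : nat) (x : R) :
  continuous f x -> continuous (fun y => f y ^ n) x.
Proof.
intros Hf; induction n as [|n IH].
- apply continuous_const.
- apply (continuous_Rmult f (fun y => f y ^ n)); assumption.
Qed.

Definition kint (h : R -> R) (z : R) : R := QInt (fun phi => h phi * kappa z phi).

Definition kint' (h : R -> R) (z : R) : R :=
  QInt (fun phi => h phi * (k ^ 2 * sin phi ^ 2 * kappa z phi ^ 2)).

Lemma continuous_kint (h : R -> R) (z : R) : k ^ 2 * z < 1 ->
  (forall x, continuous h x) -> forall x, continuous (fun phi => h phi * kappa z phi) x.
Proof. intros Hz Hh x; apply continuous_Rmult; [auto | apply continuous_kappa, Hz]. Qed.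

Lemma continuous_kint' (h : R -> R) (z : R) : k ^ 2 * z < 1 ->
  (forall x, continuous h x) ->
  forall x, continuous (fun phi => h phi * (k ^ 2 * sin phi ^ 2 * kappa z phi ^ 2)) x.
Proof.
intros Hz Hh x; apply continuous_Rmult; [auto |].
apply (continuous_Rmult (fun phi => k ^ 2 * sin phi ^ 2)).
- apply (continuous_Rmult (fun _ => k ^ 2));
    [apply continuous_const | apply continuous_Rpow, continuous_sin].
- apply continuous_Rpow, continuous_kappa, Hz.
Qed.

Lemma locally_subcritical (z : R) : k ^ 2 * z < 1 -> locally z (fun y => k ^ 2 * y < 1).
Proof.
intros Hz.
apply (continuous_Rmult (fun _ => k ^ 2) (fun y => y) z (continuous_const _ _) (continuous_id _)
  (fun y => y < 1)).
apply (open_lt 1); exact Hz.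
Qed.

Lemma is_derive_kint (h : R -> R) (z : R) : k ^ 2 * z < 1 ->
  (forall x, continuous h x) -> is_derive (kint h) z (kint' h z).
Proof.
intros Hz Hh.
assert (HD : forall y t, k ^ 2 * y < 1 ->
  is_derive (fun u => h t * kappa u t) y (h t * (k ^ 2 * sin t ^ 2 * kappa y t ^ 2))).
{ intros y t Hy; apply is_derive_scal, is_derive_kappa_z, Hy. }
replace (kint' h z) with
  (RInt (fun t => Derive (fun u => h t * kappa u t) z) 0 (PI / 2)).
- apply (is_derive_RInt_param (fun u t => h t * kappa u t)).
  + generalize (locally_subcritical z Hz); apply filter_imp; intros y Hy t _.
    eexists; apply HD, Hy.
  + intros t _.
    apply (continuity_2d_pt_ext_loc
      (fun u v => h v * (k ^ 2 * sin v ^ 2 * kappa u v ^ 2))).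
    * destruct (locally_subcritical z Hz) as [e He].
      exists e; intros u v Hu _; symmetry; apply is_derive_unique, HD, He, Hu.
    * assert (Hs : continuity_2d_pt (fun _ v => sin v) z t).
      { apply (continuity_1d_2d_pt_comp sin (fun _ v => v)).
        - apply continuity_sin.
        - apply continuity_2d_pt_id2. }
      assert (Hs2 : continuity_2d_pt (fun _ v => sin v ^ 2) z t).
      { simpl; repeat apply continuity_2d_pt_mult; try assumption.
        apply continuity_2d_pt_const. }
      assert (Hkap : continuity_2d_pt (fun u v => kappa u v) z t).
      { unfold kappa; apply continuity_2d_pt_inv.
        - apply continuity_2d_pt_minus; [apply continuity_2d_pt_const |].
          apply continuity_2d_pt_mult; [| assumption].
          apply continuity_2d_pt_mult;
            [apply continuity_2d_pt_const | apply continuity_2d_pt_id1].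
        - apply Rgt_not_eq, kappa_den_pos, Hz. }
      apply continuity_2d_pt_mult.
      { apply (continuity_1d_2d_pt_comp h (fun _ v => v)).
        - apply continuity_pt_filterlim, Hh.
        - apply continuity_2d_pt_id2. }
      apply continuity_2d_pt_mult.
      { apply continuity_2d_pt_mult; [apply continuity_2d_pt_const | assumption]. }
      simpl; repeat apply continuity_2d_pt_mult; try assumption.
      apply continuity_2d_pt_const.
  + generalize (locally_subcritical z Hz); apply filter_imp; intros y Hy.
    apply ex_RInt_cont, continuous_kint; assumption.
- apply RInt_ext; intros t _; apply is_derive_unique, HD, Hz.
Qed.

(** A common frame for the differential equations below: the derivative of the primitive [G] is
    split into a value and a [z]-derivative of the kernel against [h1], a kernel term against [h2],
    and a term [h3] from which the kernel has cancelled. *)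
Lemma kint_by_parts (z a b e f : R) (h1 h2 h3 G : R -> R) :
  k ^ 2 * z < 1 ->
  (forall x, continuous h1 x) -> (forall x, continuous h2 x) -> (forall x, continuous h3 x) ->
  (forall x, is_derive G x
     (a * (h1 x * kappa z x) + b * (h1 x * (k ^ 2 * sin x ^ 2 * kappa z x ^ 2))
      + (e * (h2 x * kappa z x) + f * h3 x))) ->
  a * kint h1 z + b * kint' h1 z + (e * kint h2 z + f * QInt h3) = G (PI / 2) - G 0.
Proof.
intros Hz H1 H2 H3 HG.
unfold kint, kint'.
assert (C1 := continuous_kint h1 z Hz H1).
assert (C1' := continuous_kint' h1 z Hz H1).
assert (C2 := continuous_kint h2 z Hz H2).
assert (L1 := continuous_lin a b _ _ C1 C1').
assert (L2 := continuous_lin e f _ _ C2 H3).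
transitivity (QInt (fun x =>
  a * (h1 x * kappa z x) + b * (h1 x * (k ^ 2 * sin x ^ 2 * kappa z x ^ 2))
  + (e * (h2 x * kappa z x) + f * h3 x))).
- generalize (QInt_lin a b _ _ C1 C1'), (QInt_lin e f _ _ C2 H3), (QInt_lin 1 1 _ _ L1 L2).
  simpl; intros E1 E2 E3; rewrite <- E1, <- E2, <- (Rmult_1_l (QInt _)).
  rewrite <- (Rmult_1_l (QInt (fun x => e * _ + _))).
  rewrite <- E3; apply QInt_ext; intros x; ring.
- apply (QInt_derive G _ HG); intros x.
  apply (continuous_plus _ _ _ (L1 x) (L2 x)).
Qed.

End Modulus.

(** * Differential equations for the kernel integrals *)

Ltac Derive_eq H :=
  let T := type of H in
  match T with is_derive ?f ?x _ => change (Derive (fun y => f y) x) with (Derive f x) end;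
  rewrite (is_derive_unique _ _ _ H).

Section Oscillation.

Variables (k xi : R) (c s : R -> R).
Hypothesis hk : 0 < k < 1.
Hypothesis xi_pos : 0 < xi.
Hypothesis c_derive : forall x, is_derive c x (- xi * s x / delta k x).
Hypothesis s_derive : forall x, is_derive s x (xi * c x / delta k x).
Hypothesis c_PI2 : c (PI / 2) = 0.
Hypothesis cs_1 : forall x, c x ^ 2 + s x ^ 2 = 1.

Lemma continuous_c (x : R) : continuous c x.
Proof. apply (ex_derive_continuous c); eexists; apply c_derive. Qed.

Lemma continuous_s (x : R) : continuous s x.
Proof. apply (ex_derive_continuous s); eexists; apply s_derive. Qed.

Lemma delta_neq0 (x : R) : delta k x <> 0.
Proof. apply Rgt_not_eq, delta_pos, hk. Qed.

(** In the variable v = [ellF k phi], where dphi = dn v dv, [hN p] is the weight c sn^p cn dn, that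
    is, c times the derivative of sn^(p+1) up to a factor, and [hM p] is what integration by parts
    makes of it. Likewise [hNc] is c cn and [hNd] is - s dn. *)
Definition hN (p : nat) (x : R) : R := c x * (sin x ^ p * cos x).
Definition hM (p : nat) (x : R) : R := xi * s x / delta k x * sin x ^ (S p).

Definition hNc (x : R) : R := c x * cos x / delta k x.
Definition hMc (x : R) : R := s x * sin x.
Definition hNd (x : R) : R := - s x.
Definition hMd (x : R) : R := c x * (sin x * cos x) / delta k x.

Lemma continuous_hN (p : nat) (x : R) : continuous (hN p) x.
Proof.
apply continuous_Rmult; [apply continuous_c |].
apply (continuous_Rmult (fun x => sin x ^ p));
  [apply continuous_Rpow, continuous_sin | apply continuous_cos].
Qed.

Lemma continuous_hM (p : nat) (x : R) : continuous (hM p) x.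
Proof.
apply (continuous_Rmult (fun x => xi * s x / delta k x)).
- apply (continuous_Rmult (fun x => xi * s x)).
  + apply (continuous_Rmult (fun _ => xi)); [apply continuous_const | apply continuous_s].
  + apply continuous_inv_delta, hk.
- apply continuous_Rpow, continuous_sin.
Qed.

Ltac side :=
  repeat match goal with
  | |- _ /\ _ => split
  | |- True => exact I
  | |- ex_derive (fun x => c x) ?y => exists (- xi * s y / delta k y); apply c_derive
  | |- ex_derive (fun x => s x) ?y => exists (xi * c y / delta k y); apply s_derive
  | |- ex_derive (fun x => delta k x) _ => apply ex_derive_delta, hk
  | H : k ^ 2 * ?z < 1 |- ex_derive (fun x => kappa k ?z x) ?y =>
      eexists; apply (is_derive_kappa_phi k hk z y H)
  | |- delta k _ <> 0 => apply delta_neq0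
  end.

Ltac rwD :=
  repeat match goal with
  | |- context [Derive (fun x => c x) ?y] => Derive_eq (c_derive y)
  | |- context [Derive (fun x => s x) ?y] => Derive_eq (s_derive y)
  | |- context [Derive (fun x => delta k x) ?y] => rewrite (Derive_delta k hk y)
  | H : k ^ 2 * ?z < 1 |- context [Derive (fun x => kappa k ?z x) ?y] =>
      Derive_eq (is_derive_kappa_phi k hk z y H)
  end.

(* Turns an identity between [sin], [cos], [delta], [kappa] into polynomial arithmetic. *)
Ltac trig_field :=
  match goal with |- context [kappa k ?z ?x] =>
    let Hd := fresh "Hd" in let Hc := fresh "Hc" in let Hk := fresh "Hk" in
    let H := fresh "H" in
    assert (Hd := delta_sqr k hk x); assert (H := delta_neq0 x);
    assert (Hc := cos_sqr x);
    assert (Hk : 1 - k ^ 2 * z * sin x ^ 2 <> 0)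
      by (apply Rgt_not_eq, kappa_den_pos; assumption);
    unfold kappa; field_simplify_eq; [ring [Hd Hc] | repeat split; assumption]
  end.

Ltac by_parts H :=
  match type of H with ?A -> ?B => cut B; [lra | apply H; clear H; intros x] end;
  auto_derive; [side |]; rwD; unfold hN, hM, hNc, hMc, hNd, hMd; trig_field.

(** The primitive is [c * sin ^ (p + 1) * kappa], which vanishes at 0 through the sine and at
    [PI / 2] through [c]. For [z = sin x ^ 2] the equation says that [sin ^ (p + 1) * kint (hN p)]
    has derivative [sin ^ p * cos * kint (hM p)]. *)
Lemma ode1 (p : nat) (z : R) : k ^ 2 * z < 1 ->
  INR (S p) * kint k (hN p) z + 2 * z * kint' k (hN p) z = kint k (hM p) z.
Proof.
intros Hz.
generalize (kint_by_parts k hk z (INR (S p)) (2 * z) (-1) 0 (hN p) (hM p) (fun _ => 0)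
  (fun x => c x * (sin x ^ (S p) * kappa k z x)) Hz (continuous_hN p) (continuous_hM p)
  (fun x => continuous_const 0 x)).
rewrite c_PI2, sin_0, pow_i by lia; intros H.
cut (INR (S p) * kint k (hN p) z + 2 * z * kint' k (hN p) z +
  (-1 * kint k (hM p) z + 0 * QInt (fun _ => 0)) = 0 * (sin (PI / 2) ^ S p * kappa k z (PI / 2)) -
    c 0 * (0 * kappa k z 0)); [lra |].
apply H; clear H; intros x.
auto_derive; [side |].
rwD; unfold hN, hM, Rdiv; simpl pred; rewrite <- !tech_pow_Rmult.
change (match p with 0%nat => 1 | S _ => INR p + 1 end) with (INR (S p)).
field; apply delta_neq0.
Qed.

(** With [ode1] this closes a first order system for [hN 0] and [hM 0]. The primitive vanishes at
    [PI / 2] through the cosine, but at 0 only through [s 0 = 0], so that the odd case needs another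
    one. *)
Lemma ode2_even (z : R) : k ^ 2 * z < 1 -> s 0 = 0 ->
  (2 * k ^ 2 * z - 1 - k ^ 2) * kint k (hM 0) z
  + 2 * ((1 - z) * (1 - k ^ 2 * z)) * kint' k (hM 0) z = - xi ^ 2 * kint k (hN 0) z.
Proof.
intros Hz s0.
generalize (kint_by_parts k hk z (2 * k ^ 2 * z - 1 - k ^ 2)
  (2 * ((1 - z) * (1 - k ^ 2 * z))) (xi ^ 2) 0 (hM 0) (hN 0) (fun _ => 0)
  (fun x => xi * s x * (cos x * delta k x * kappa k z x)) Hz (continuous_hM 0) (continuous_hN 0)
  (fun x => continuous_const 0 x)).
rewrite cos_PI2, s0; intros H.
by_parts H.
Qed.

Ltac solve_cont :=
  intros; match goal with |- continuous ?f ?x =>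
    apply (ex_derive_continuous f); unfold hNc, hMc, hNd, hMd; auto_derive; side end.

Lemma continuous_hNc : forall x, continuous hNc x.
Proof. solve_cont. Qed.
Lemma continuous_hMc : forall x, continuous hMc x.
Proof. solve_cont. Qed.
Lemma continuous_hNd : forall x, continuous hNd x.
Proof. solve_cont. Qed.
Lemma continuous_hMd : forall x, continuous hMd x.
Proof. solve_cont. Qed.

Lemma QInt_zero : QInt (fun _ => 0) = 0.
Proof. rewrite (QInt_derive (fun _ => 0) (fun _ => 0)); [ring | | ];
  intros; [apply (is_derive_const 0) | apply continuous_const]. Qed.

(** Here [s 0] is not 0, so the primitive carries an extra sine. Adding [c] to it makes the part of
    the derivative that contains [s] divisible by [sin x ^ 2], hence expressible through [hM 1]; the
    term left without kernel is the constant [QInt (hM 1)]. *)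
Lemma ode2_odd (z : R) : k ^ 2 * z < 1 -> c 0 = 0 ->
  ((1 - z) * (1 - k ^ 2 * z) + z * (2 * k ^ 2 * z - 1 - k ^ 2)) * kint k (hM 1) z
  + 2 * z * ((1 - z) * (1 - k ^ 2 * z)) * kint' k (hM 1) z
  = - xi ^ 2 * z * kint k (hN 1) z + QInt (hM 1).
Proof.
intros Hz c0.
generalize (kint_by_parts k hk z
  ((1 - z) * (1 - k ^ 2 * z) + z * (2 * k ^ 2 * z - 1 - k ^ 2))
  (2 * z * ((1 - z) * (1 - k ^ 2 * z))) (xi ^ 2 * z) (-1) (hM 1) (hN 1) (hM 1)
  (fun x => z * (xi * s x * (cos x * delta k x * sin x * kappa k z x) + c x)) Hz
  (continuous_hM 1) (continuous_hN 1) (continuous_hM 1)).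
rewrite cos_PI2, c_PI2, sin_0, c0; intros H.
by_parts H.
Qed.

(** For cn the two primitives carry cn and its derivative - sn dn, for dn they carry dn and sn cn,
    just as the even case above carries sn and its derivative cn dn. Each pair closes on two
    weights. *)
Lemma ode_cn1 (z : R) : k ^ 2 * z < 1 ->
  kint k hNc z - 2 * (1 - z) * kint' k hNc z = xi * kint k hMc z.
Proof.
intros Hz.
generalize (kint_by_parts k hk z 1 (- (2 * (1 - z))) (- xi) 0 hNc hMc (fun _ => 0)
  (fun x => c x * (delta k x * sin x * kappa k z x)) Hz
  continuous_hNc continuous_hMc (fun x => continuous_const 0 x)).
rewrite c_PI2, sin_0; intros H.
by_parts H.
Qed.

Lemma ode_cn2 (z : R) : k ^ 2 * z < 1 -> s 0 = 0 ->
  (1 - 2 * k ^ 2 * z) * kint k hMc z + 2 * z * (1 - k ^ 2 * z) * kint' k hMc z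
  = xi * kint k hNc z.
Proof.
intros Hz s0.
generalize (kint_by_parts k hk z (1 - 2 * k ^ 2 * z) (2 * z * (1 - k ^ 2 * z)) (- xi) 0
  hMc hNc (fun _ => 0) (fun x => - (s x * (cos x * kappa k z x))) Hz
  continuous_hMc continuous_hNc (fun x => continuous_const 0 x)).
rewrite cos_PI2, s0; intros H.
by_parts H.
Qed.

Lemma ode_dn1 (z : R) : k ^ 2 * z < 1 ->
  k ^ 2 * kint k hNd z - 2 * (1 - k ^ 2 * z) * kint' k hNd z = xi * k ^ 2 * kint k hMd z.
Proof.
intros Hz.
generalize (kint_by_parts k hk z (k ^ 2) (- (2 * (1 - k ^ 2 * z))) (- (xi * k ^ 2)) 0
  hNd hMd (fun _ => 0) (fun x => - (k ^ 2 * s x * (sin x * cos x * kappa k z x))) Hz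
  continuous_hNd continuous_hMd (fun x => continuous_const 0 x)).
rewrite cos_PI2, sin_0; intros H.
by_parts H.
Qed.

Lemma ode_dn2 (z : R) : k ^ 2 * z < 1 -> c 0 = 0 ->
  k ^ 2 * ((1 - 2 * z) * kint k hMd z + 2 * z * (1 - z) * kint' k hMd z)
  = xi * kint k hNd z.
Proof.
intros Hz c0.
generalize (kint_by_parts k hk z (k ^ 2 * (1 - 2 * z)) (k ^ 2 * (2 * z * (1 - z))) (- xi) 0
  hMd hNd (fun _ => 0) (fun x => - (c x * (delta k x * kappa k z x))) Hz
  continuous_hMd continuous_hNd (fun x => continuous_const 0 x)).
rewrite c_PI2, c0; intros H.
by_parts H.
Qed.

Lemma is_derive_kint_comp (h u : R -> R) (x du : R) :
  (forall y, continuous h y) -> k ^ 2 * u x < 1 -> is_derive u x du ->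
  is_derive (fun y => kint k h (u y)) x (du * kint' k h (u x)).
Proof.
intros Hh Hz Hu.
apply (is_derive_comp (kint k h) u); [apply is_derive_kint; assumption | assumption].
Qed.

Lemma kint_0 (h : R -> R) : kint k h 0 = QInt h.
Proof.
apply QInt_ext; intros x; unfold kappa; rewrite Rmult_0_r, Rmult_0_l, Rminus_0_r, Rinv_1; ring.
Qed.

Lemma kint_hM_0 (p : nat) : QInt (hM p) = INR (S p) * kint k (hN p) 0.
Proof.
rewrite <- kint_0, <- ode1; [ring | rewrite Rmult_0_r; lra].
Qed.

(* The first integrals of [u'' = - xi^2 u] in the variable [ellF]. *)
Lemma rotation_solution (X Y : R -> R) :
  (forall x, is_derive X x (Y x / delta k x)) ->
  (forall x, is_derive Y x (- xi ^ 2 * X x / delta k x)) ->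
  forall x, xi * X x = (Y 0 * c 0 + xi * X 0 * s 0) * s x - (Y 0 * s 0 - xi * X 0 * c 0) * c x.
Proof.
intros HX HY.
assert (Hconst : forall f : R -> R, (forall x, is_derive f x 0) -> forall x, f x = f 0).
{ intros f Hf x; destruct (Rtotal_order x 0) as [Hx | [-> | Hx]]; trivial.
  - apply (eq_is_derive f x 0); auto.
  - symmetry; apply (eq_is_derive f 0 x); auto. }
assert (HA : forall x, Y x * c x + xi * X x * s x = Y 0 * c 0 + xi * X 0 * s 0).
{ intros x; refine (Hconst (fun x => Y x * c x + xi * X x * s x) _ x); clear x; intros x.
  auto_derive.
  - repeat split; eexists; [apply HY | apply c_derive | apply HX | apply s_derive].
  - Derive_eq (HX x); Derive_eq (HY x); rwD.
    field; apply delta_neq0. }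
assert (HB : forall x, Y x * s x - xi * X x * c x = Y 0 * s 0 - xi * X 0 * c 0).
{ intros x; refine (Hconst (fun x => Y x * s x - xi * X x * c x) _ x); clear x; intros x.
  auto_derive.
  - repeat split; eexists; [apply HY | apply s_derive | apply HX | apply c_derive].
  - Derive_eq (HX x); Derive_eq (HY x); rwD.
    field; apply delta_neq0. }
intros x; rewrite <- (HA x), <- (HB x).
generalize (cs_1 x); intros E.
transitivity (xi * X x * (c x ^ 2 + s x ^ 2)); [rewrite E; ring | ring].
Qed.

(** * Real argument: the generating functions in closed form *)

Lemma sin2_subcritical (x : R) : k ^ 2 * sin x ^ 2 < 1.
Proof. generalize (delta_arg_pos k hk x); lra. Qed.

Lemma is_derive_sin2 (x : R) : is_derive (fun y => sin y ^ 2) x (2 * sin x * cos x).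
Proof. auto_derive; [trivial | ring]. Qed.

Lemma is_derive_X (p : nat) (x : R) :
  is_derive (fun y => sin y ^ (S p) * kint k (hN p) (sin y ^ 2)) x
    (sin x ^ p * cos x * kint k (hM p) (sin x ^ 2)).
Proof.
assert (Hn := is_derive_kint_comp (hN p) (fun y => sin y ^ 2) x _
  (continuous_hN p) (sin2_subcritical x) (is_derive_sin2 x)).
rewrite <- (ode1 p _ (sin2_subcritical x)).
set (n := fun y => kint k (hN p) (sin y ^ 2)) in *.
  match type of Hn with is_derive _ ?a ?d => change (is_derive n a d) in Hn end.
change (fun y => sin y ^ (S p) * kint k (hN p) (sin y ^ 2)) with (fun y => sin y ^ (S p) * n y).
change (kint k (hN p) (sin x ^ 2)) with (n x).
auto_derive; [eexists; exact Hn |].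
Derive_eq Hn.
change (match p with 0%nat => 1 | S _ => INR p + 1 end) with (INR (S p)).
simpl pred; rewrite <- !tech_pow_Rmult; ring.
Qed.

Ltac dcs x :=
  assert (Hd := delta_sqr k hk x); assert (Hdx := delta_neq0 x);
  assert (Hc := cos_sqr x).

(** By [ode1] and [ode2_even], [sin * kint (hN 0)] and [cos * delta * kint (hM 0)] solve the
    rotation system. The first vanishes at 0, so only the multiple of [s] survives, and the value of
    the second at 0 is [kint (hN 0) 0]. *)
Lemma generating_even : s 0 = 0 -> c 0 = 1 -> forall x,
  xi * (sin x * kint k (hN 0) (sin x ^ 2)) = kint k (hN 0) 0 * s x.
Proof.
intros s0 c0 x.
rewrite (rotation_solution (fun y => sin y * kint k (hN 0) (sin y ^ 2))
  (fun y => cos y * delta k y * kint k (hM 0) (sin y ^ 2))).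
- rewrite sin_0, cos_0, s0, c0, pow_i by lia.
  rewrite kint_0, kint_hM_0; unfold delta; rewrite sin_0, pow_i by lia.
  rewrite Rmult_0_r, Rminus_0_r, sqrt_1; simpl; ring.
- clear x; intros x; evar_last.
  + apply (is_derive_ext (fun y => sin y ^ 1 * kint k (hN 0) (sin y ^ 2)));
      [intros t; rewrite pow_1; reflexivity | apply (is_derive_X 0)].
  + simpl; field; apply delta_neq0.
- clear x; intros x.
  assert (Hn := is_derive_kint_comp (hM 0) (fun y => sin y ^ 2) x _
    (continuous_hM 0) (sin2_subcritical x) (is_derive_sin2 x)).
  assert (E := ode2_even _ (sin2_subcritical x) s0).
  replace (- xi ^ 2 * (sin x * kint k (hN 0) (sin x ^ 2)) / delta k x) with
    (sin x / delta k x * (- xi ^ 2 * kint k (hN 0) (sin x ^ 2))) by (field; apply delta_neq0).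
  rewrite <- E; clear E.
  set (n := fun y => kint k (hM 0) (sin y ^ 2)) in *.
  match type of Hn with is_derive _ ?a ?d => change (is_derive n a d) in Hn end.
  change (fun y => cos y * delta k y * kint k (hM 0) (sin y ^ 2))
    with (fun y => cos y * delta k y * n y).
  change (kint k (hM 0) (sin x ^ 2)) with (n x).
  auto_derive; [side; eexists; exact Hn |].
  Derive_eq Hn; rwD.
  dcs x; field_simplify_eq; [ring [Hd Hc] | assumption].
Qed.

(** The constant in [ode2_odd] makes the system inhomogeneous; shifting by [e / xi ^ 2] removes it.
    At 0 the shifted function is [- e / xi ^ 2] while [s 0 = - 1], so it is a multiple of [s], and
    [e] is [2 * kint (hN 1) 0]. *)
Lemma generating_odd : s 0 = - (1) -> c 0 = 0 -> forall x,
  xi ^ 2 * (sin x ^ 2 * kint k (hN 1) (sin x ^ 2)) = 2 * kint k (hN 1) 0 * (1 + s x).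
Proof.
intros s0 c0 x.
assert (Hxi : xi <> 0) by lra.
set (e := QInt (hM 1)).
assert (H := rotation_solution
  (fun y => sin y ^ 2 * kint k (hN 1) (sin y ^ 2) - e / xi ^ 2)
  (fun y => sin y * cos y * delta k y * kint k (hM 1) (sin y ^ 2))).
cut (xi * (sin x ^ 2 * kint k (hN 1) (sin x ^ 2) - e / xi ^ 2) = e / xi * s x).
{ intros E.
  replace (2 * kint k (hN 1) 0) with e
    by (unfold e; rewrite kint_hM_0; simpl; ring).
  transitivity (xi * (xi * (sin x ^ 2 * kint k (hN 1) (sin x ^ 2) - e / xi ^ 2)) + e);
    [field; assumption | rewrite E; field; assumption]. }
rewrite H; clear H.
- rewrite sin_0, cos_0, s0, c0, pow_i by lia. field; assumption.
- clear x; intros x; evar_last.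
  + apply (is_derive_plus (fun y => sin y ^ 2 * kint k (hN 1) (sin y ^ 2)) (fun _ => - (e / xi ^ 2)));
      [apply (is_derive_X 1) | apply (is_derive_const (- (e / xi ^ 2)))].
  + unfold plus, zero; simpl; field; apply delta_neq0.
- clear x; intros x.
  assert (Hn := is_derive_kint_comp (hM 1) (fun y => sin y ^ 2) x _
    (continuous_hM 1) (sin2_subcritical x) (is_derive_sin2 x)).
  assert (E := ode2_odd _ (sin2_subcritical x) c0).
  replace (- xi ^ 2 * (sin x ^ 2 * kint k (hN 1) (sin x ^ 2) - e / xi ^ 2) / delta k x) with
    (/ delta k x * (- xi ^ 2 * sin x ^ 2 * kint k (hN 1) (sin x ^ 2) + e))
    by (field; split; [assumption | apply delta_neq0]).
  unfold e; rewrite <- E; clear E.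
  set (n := fun y => kint k (hM 1) (sin y ^ 2)) in *.
  match type of Hn with is_derive _ ?a ?d => change (is_derive n a d) in Hn end.
  change (fun y => sin y * cos y * delta k y * kint k (hM 1) (sin y ^ 2))
    with (fun y => sin y * cos y * delta k y * n y).
  change (kint k (hM 1) (sin x ^ 2)) with (n x).
  auto_derive; [side; eexists; exact Hn |].
  Derive_eq Hn; rwD.
  dcs x; field_simplify_eq; [ring [Hd Hc] | assumption].
Qed.


(** * Imaginary argument: Jacobi's transformation to the complementary modulus *)

Definition kc : R := sqrt (1 - k ^ 2).

Lemma kc_sqr : kc ^ 2 = 1 - k ^ 2.
Proof. apply pow2_sqrt; nra. Qed.

Lemma kc_range : 0 < kc < 1.
Proof.
assert (H : 0 < kc) by (apply sqrt_lt_R0; nra).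
generalize kc_sqr; nra.
Qed.

(** This is [u'' = xi ^ 2 u] in the variable [ellF kc], solved by its two exponential first
    integrals. The range stops short of [PI / 2], where the argument [1 - / cos x ^ 2] runs off to
    minus infinity. *)
Lemma hyperbolic_solution (X Y : R -> R) :
  (forall x, 0 <= x < PI / 2 -> is_derive X x (Y x / delta kc x)) ->
  (forall x, 0 <= x < PI / 2 -> is_derive Y x (xi ^ 2 * X x / delta kc x)) ->
  forall x, 0 <= x < PI / 2 ->
  Y x + xi * X x = (Y 0 + xi * X 0) * exp (xi * ellF kc x) /\
  Y x - xi * X x = (Y 0 - xi * X 0) * exp (- (xi * ellF kc x)).
Proof.
intros HX HY.
assert (Hd : forall x, delta kc x <> 0)
  by (intros; apply Rgt_not_eq, delta_pos, kc_range).
assert (Hb := is_derive_ellF kc kc_range).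
assert (Hconst : forall f : R -> R, (forall x, 0 <= x < PI / 2 -> is_derive f x 0) ->
  forall x, 0 <= x < PI / 2 -> f x = f 0).
{ intros f Hf x Hx; destruct (Req_dec x 0) as [-> | Hx0]; trivial.
  symmetry; apply (eq_is_derive f 0 x); [| lra].
  intros t Ht; apply Hf; lra. }
assert (HA : forall x, 0 <= x < PI / 2 ->
  (Y x + xi * X x) * exp (- (xi * ellF kc x)) = Y 0 + xi * X 0).
{ intros x Hx.
  replace (Y 0 + xi * X 0) with ((Y 0 + xi * X 0) * exp (- (xi * ellF kc 0)))
    by (rewrite ellF_0, Rmult_0_r, Ropp_0, exp_0; ring).
  refine (Hconst (fun x => (Y x + xi * X x) * exp (- (xi * ellF kc x))) _ x Hx).
  clear x Hx; intros x Hx; auto_derive.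
  - repeat split; eexists; [apply HY | apply HX | apply Hb]; exact Hx.
  - Derive_eq (HX x Hx); Derive_eq (HY x Hx); Derive_eq (Hb x).
    field; apply Hd. }
assert (HB : forall x, 0 <= x < PI / 2 ->
  (Y x - xi * X x) * exp (xi * ellF kc x) = Y 0 - xi * X 0).
{ intros x Hx.
  replace (Y 0 - xi * X 0) with ((Y 0 - xi * X 0) * exp (xi * ellF kc 0))
    by (rewrite ellF_0, Rmult_0_r, exp_0; ring).
  refine (Hconst (fun x => (Y x - xi * X x) * exp (xi * ellF kc x)) _ x Hx).
  clear x Hx; intros x Hx; auto_derive.
  - repeat split; eexists; [apply HY | apply HX | apply Hb]; exact Hx.
  - Derive_eq (HX x Hx); Derive_eq (HY x Hx); Derive_eq (Hb x).
    field; apply Hd. }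
intros x Hx; rewrite <- (HA x Hx), <- (HB x Hx), !Rmult_assoc, <- !exp_plus.
rewrite Rplus_opp_l, Rplus_opp_r, exp_0; lra.
Qed.

Lemma cos_pos (x : R) : 0 <= x < PI / 2 -> 0 < cos x.
Proof. intros Hx; apply cos_gt_0; generalize PI_RGT_0; lra. Qed.

Lemma imaginary_subcritical (x : R) : 0 <= x < PI / 2 -> k ^ 2 * (1 - / cos x ^ 2) < 1.
Proof.
intros Hx; assert (Hc := cos_pos x Hx).
assert (0 < / cos x ^ 2) by (apply Rinv_0_lt_compat; nra).
nra.
Qed.

Lemma is_derive_zi (x : R) : 0 <= x < PI / 2 ->
  is_derive (fun y => 1 - / cos y ^ 2) x (- 2 * sin x / cos x ^ 3).
Proof.
intros Hx; assert (Hc := cos_pos x Hx).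
auto_derive; [| field]; simpl; nra.
Qed.

Ltac use_kint n h x Hx Ch pre :=
  let Hn := fresh "Hn" in
  assert (Hn := is_derive_kint_comp h (fun y => 1 - / cos y ^ 2) x _
    Ch (imaginary_subcritical x Hx) (is_derive_zi x Hx));
  set (n := fun y => kint k h (1 - / cos y ^ 2)) in *;
  match type of Hn with is_derive _ ?a ?d => change (is_derive n a d) in Hn end;
  change (kint k h (1 - / cos x ^ 2)) with (n x);
  match goal with |- is_derive _ _ ?d => change (is_derive (fun y => pre y * n y) x d) end;
  cbv beta.

Ltac side_im n x Hn Hc0 :=
  repeat match goal with
  | |- _ /\ _ => split
  | |- True => exact I
  | |- ex_derive (fun x => n x) _ => eexists; exact Hn
  | |- ex_derive (fun x => delta kc x) _ => apply ex_derive_delta, kc_range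
  | |- _ <> 0 => exact Hc0
  | |- _ <> 0 => repeat apply Rmult_integral_contrapositive_currified; first [exact Hc0 | lra]
  end.

Ltac finish_im n x Hn Hc0 :=
  auto_derive; [side_im n x Hn Hc0 |]; Derive_eq Hn;
  rewrite ?(Derive_delta kc kc_range x), ?kc_sqr;
  let Hd := fresh "Hd" in let Hdx := fresh "Hdx" in let Hs := fresh "Hs" in
  assert (Hd := delta_sqr kc kc_range x); rewrite kc_sqr in Hd;
  assert (Hdx : delta kc x <> 0) by (apply Rgt_not_eq, delta_pos, kc_range);
  assert (Hs : sin x ^ 2 = 1 - cos x ^ 2) by (rewrite cos_sqr; ring);
  simpl INR; field_simplify_eq; [ring [Hd Hs] | repeat split; assumption].

(** At an imaginary argument sn, cn, dn turn into i tan, 1 / cos, delta / cos of the amplitude for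
    the modulus [kc], which explains [z = 1 - / cos x ^ 2 = - tan x ^ 2] and the prefactors of [X]
    and [Y]. Since [X] vanishes at 0, it is a hyperbolic sine. *)
Lemma imaginary_even (s0 : s 0 = 0) (x : R) (Hx : 0 <= x < PI / 2) :
  2 * xi * (sin x / cos x * kint k (hN 0) (1 - / cos x ^ 2))
  = kint k (hN 0) 0 * (exp (xi * ellF kc x) - exp (- (xi * ellF kc x))).
Proof.
destruct (hyperbolic_solution
  (fun x => sin x / cos x * kint k (hN 0) (1 - / cos x ^ 2))
  (fun x => delta kc x / cos x ^ 2 * kint k (hM 0) (1 - / cos x ^ 2))) with x as [E1 E2].
- clear x Hx; intros x Hx.
  assert (Hc0 : cos x <> 0) by (apply Rgt_not_eq, cos_pos, Hx).
  generalize (ode1 0 _ (imaginary_subcritical x Hx)); intros E.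
  rewrite <- E; clear E.
  use_kint n (hN 0) x Hx (continuous_hN 0) (fun y => sin y / cos y).
  finish_im n x Hn Hc0.
- clear x Hx; intros x Hx.
  assert (Hc0 : cos x <> 0) by (apply Rgt_not_eq, cos_pos, Hx).
  generalize (ode2_even _ (imaginary_subcritical x Hx) s0); intros E.
  assert (E' : xi ^ 2 * kint k (hN 0) (1 - / cos x ^ 2) =
    - ((2 * k ^ 2 * (1 - / cos x ^ 2) - 1 - k ^ 2) * kint k (hM 0) (1 - / cos x ^ 2) +
    2 * ((1 - (1 - / cos x ^ 2)) * (1 - k ^ 2 * (1 - / cos x ^ 2))) *
    kint' k (hM 0) (1 - / cos x ^ 2))) by lra.
  clear E.
  replace (xi ^ 2 * (sin x / cos x * kint k (hN 0) (1 - / cos x ^ 2)) / delta kc x) with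
    (sin x / cos x / delta kc x * (xi ^ 2 * kint k (hN 0) (1 - / cos x ^ 2)))
    by (unfold Rdiv; ring).
  rewrite E'; clear E'.
  use_kint n (hM 0) x Hx (continuous_hM 0) (fun y => delta kc y / cos y ^ 2).
  finish_im n x Hn Hc0.
- exact Hx.
- revert E1 E2; rewrite sin_0, cos_0, !pow1, Rinv_1, Rminus_diag, !kint_0, kint_hM_0, kint_0.
  unfold delta; rewrite sin_0, pow_i, Rmult_0_r, Rminus_0_r, sqrt_1 by lia.
  simpl INR; intros; lra.
Qed.

(** The quantity evaluated is [Y], not [X]: [Y] vanishes at 0 and is a pure hyperbolic sine, whereas
    [X] starts from the constant [e / xi ^ 2]. *)
Lemma imaginary_odd (c0 : c 0 = 0) (x : R) (Hx : 0 <= x < PI / 2) :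
  xi * (delta kc x * sin x / cos x ^ 3 * kint k (hM 1) (1 - / cos x ^ 2))
  = kint k (hN 1) 0 * (exp (xi * ellF kc x) - exp (- (xi * ellF kc x))).
Proof.
set (e := QInt (hM 1)).
assert (He : e = 2 * kint k (hN 1) 0) by (unfold e; rewrite kint_hM_0; simpl; ring).
assert (Hxi : xi <> 0) by lra.
destruct (hyperbolic_solution
  (fun x => sin x ^ 2 / cos x ^ 2 * kint k (hN 1) (1 - / cos x ^ 2) + e / xi ^ 2)
  (fun x => delta kc x * sin x / cos x ^ 3 * kint k (hM 1) (1 - / cos x ^ 2)))
  with x as [E1 E2].
- clear x Hx; intros x Hx.
  assert (Hc0 : cos x <> 0) by (apply Rgt_not_eq, cos_pos, Hx).
  generalize (ode1 1 _ (imaginary_subcritical x Hx)); intros E.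
  rewrite <- E; clear E.
  evar_last.
  { apply (is_derive_plus (fun y => sin y ^ 2 / cos y ^ 2 * kint k (hN 1) (1 - / cos y ^ 2))
      (fun _ => e / xi ^ 2)); [| apply (is_derive_const (e / xi ^ 2))].
    instantiate (1 := sin x / cos x ^ 3 *
      (INR 2 * kint k (hN 1) (1 - / cos x ^ 2) +
       2 * (1 - / cos x ^ 2) * kint' k (hN 1) (1 - / cos x ^ 2))).
    use_kint n (hN 1) x Hx (continuous_hN 1) (fun y => sin y ^ 2 / cos y ^ 2).
    finish_im n x Hn Hc0. }
  unfold plus, zero; simpl; field; split; [assumption |].
  apply Rgt_not_eq, delta_pos, kc_range.
- clear x Hx; intros x Hx.
  assert (Hc0 : cos x <> 0) by (apply Rgt_not_eq, cos_pos, Hx).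
  generalize (ode2_odd _ (imaginary_subcritical x Hx) c0); fold e; intros E.
  assert (Hz : 1 - / cos x ^ 2 = - (sin x ^ 2 / cos x ^ 2)).
  { generalize (sin2_cos2 x); unfold Rsqr; intros E'; field_simplify_eq; trivial; nra. }
  assert (E' : xi ^ 2 * (sin x ^ 2 / cos x ^ 2 * kint k (hN 1) (1 - / cos x ^ 2) + e / xi ^ 2)
    = - (xi ^ 2) * (1 - / cos x ^ 2) * kint k (hN 1) (1 - / cos x ^ 2) + e).
  { rewrite Hz at 2; field; split; assumption. }
  rewrite E', <- E; clear E E' Hz.
  use_kint n (hM 1) x Hx (continuous_hM 1) (fun y => delta kc y * sin y / cos y ^ 3).
  finish_im n x Hn Hc0.
- exact Hx.
- revert E1 E2; rewrite sin_0, pow_i by lia.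
  replace (delta kc 0 * 0 / cos 0 ^ 3 * kint k (hM 1) (1 - / cos 0 ^ 2)) with 0
    by (unfold Rdiv; ring).
  replace (xi * (0 / cos 0 ^ 2 * kint k (hN 1) (1 - / cos 0 ^ 2) + e / xi ^ 2))
    with (e / xi) by (rewrite cos_0; field; assumption).
  replace (kint k (hN 1) 0) with (e / 2) by lra.
  set (Y := delta kc x * _ / _ * _); set (X := sin x ^ 2 / _ * _ + _); intros E1 E2.
  transitivity (xi / 2 * ((Y + xi * X) + (Y - xi * X))); [field |].
  rewrite E1, E2; field; assumption.
Qed.

(** Here the wanted weight sits in [Y], and its partner [X] vanishes at 0 through the sine; hence a
    hyperbolic cosine. The same holds for dn below. *)
Lemma imaginary_cn (s0 : s 0 = 0) (x : R) (Hx : 0 <= x < PI / 2) :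
  2 * (/ cos x * kint k hNc (1 - / cos x ^ 2))
  = kint k hNc 0 * (exp (xi * ellF kc x) + exp (- (xi * ellF kc x))).
Proof.
assert (Hxi : xi <> 0) by lra.
destruct (hyperbolic_solution
  (fun x => / xi * (sin x * delta kc x / cos x ^ 2 * kint k hMc (1 - / cos x ^ 2)))
  (fun x => / cos x * kint k hNc (1 - / cos x ^ 2)))
  with x as [E1 E2].
- clear x Hx; intros x Hx.
  assert (Hc0 : cos x <> 0) by (apply Rgt_not_eq, cos_pos, Hx).
  generalize (ode_cn2 _ (imaginary_subcritical x Hx) s0); intros E.
  replace (/ cos x * kint k hNc (1 - / cos x ^ 2) / delta kc x) with
    (/ xi * (/ cos x / delta kc x * (xi * kint k hNc (1 - / cos x ^ 2))))
    by (field; repeat split; trivial; apply Rgt_not_eq, delta_pos, kc_range).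
  rewrite <- E; clear E.
  apply is_derive_scal.
  use_kint n hMc x Hx continuous_hMc (fun y => sin y * delta kc y / cos y ^ 2).
  finish_im n x Hn Hc0.
- clear x Hx; intros x Hx.
  assert (Hc0 : cos x <> 0) by (apply Rgt_not_eq, cos_pos, Hx).
  generalize (ode_cn1 _ (imaginary_subcritical x Hx)); intros E.
  assert (Hdx : delta kc x <> 0) by (apply Rgt_not_eq, delta_pos, kc_range).
  replace (xi ^ 2 * (/ xi * (sin x * delta kc x / cos x ^ 2 * kint k hMc (1 - / cos x ^ 2)))
      / delta kc x)
    with (sin x / cos x ^ 2 * (xi * kint k hMc (1 - / cos x ^ 2)))
    by (field; repeat split; trivial).
  rewrite <- E; clear E.
  use_kint n hNc x Hx continuous_hNc (fun y => / cos y).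
  finish_im n x Hn Hc0.
- exact Hx.
- revert E1 E2; rewrite sin_0, cos_0, pow1, Rinv_1, Rminus_diag.
  set (Y := / cos x * _); set (X := / xi * (sin x * _ / _ * _)).
  replace (xi * (/ xi * (0 * delta kc 0 / 1 * kint k hMc 0))) with 0 by (field; assumption).
  intros; lra.
Qed.

Lemma imaginary_dn (c0 : c 0 = 0) (x : R) (Hx : 0 <= x < PI / 2) :
  2 * (delta kc x / cos x * kint k hNd (1 - / cos x ^ 2))
  = kint k hNd 0 * (exp (xi * ellF kc x) + exp (- (xi * ellF kc x))).
Proof.
assert (Hxi : xi <> 0) by lra.
destruct (hyperbolic_solution
  (fun x => / xi * (k ^ 2 * sin x / cos x ^ 2 * kint k hMd (1 - / cos x ^ 2)))
  (fun x => delta kc x / cos x * kint k hNd (1 - / cos x ^ 2)))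
  with x as [E1 E2].
- clear x Hx; intros x Hx.
  assert (Hc0 : cos x <> 0) by (apply Rgt_not_eq, cos_pos, Hx).
  assert (Hdx : delta kc x <> 0) by (apply Rgt_not_eq, delta_pos, kc_range).
  generalize (ode_dn2 _ (imaginary_subcritical x Hx) c0); intros E.
  replace (delta kc x / cos x * kint k hNd (1 - / cos x ^ 2) / delta kc x) with
    (/ xi * (/ cos x * (xi * kint k hNd (1 - / cos x ^ 2))))
    by (field; repeat split; trivial).
  rewrite <- E; clear E.
  apply is_derive_scal.
  use_kint n hMd x Hx continuous_hMd (fun y => k ^ 2 * sin y / cos y ^ 2).
  finish_im n x Hn Hc0.
- clear x Hx; intros x Hx.
  assert (Hc0 : cos x <> 0) by (apply Rgt_not_eq, cos_pos, Hx).
  generalize (ode_dn1 _ (imaginary_subcritical x Hx)); intros E.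
  assert (Hdx : delta kc x <> 0) by (apply Rgt_not_eq, delta_pos, kc_range).
  replace (xi ^ 2 * (/ xi * (k ^ 2 * sin x / cos x ^ 2 * kint k hMd (1 - / cos x ^ 2)))
      / delta kc x)
    with (sin x / cos x ^ 2 / delta kc x * (xi * k ^ 2 * kint k hMd (1 - / cos x ^ 2)))
    by (field; repeat split; trivial).
  rewrite <- E; clear E.
  use_kint n hNd x Hx continuous_hNd (fun y => delta kc y / cos y).
  finish_im n x Hn Hc0.
- exact Hx.
- revert E1 E2; rewrite sin_0, cos_0, pow1, Rinv_1, Rminus_diag.
  set (Y := delta kc x / cos x * _); set (X := / xi * (k ^ 2 * sin x / _ * _)).
  replace (xi * (/ xi * (k ^ 2 * 0 / 1 * kint k hMd 0))) with 0 by (field; assumption).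
  unfold delta; rewrite sin_0, pow_i, Rmult_0_r, Rminus_0_r, sqrt_1 by lia.
  intros; lra.
Qed.

End Oscillation.

(** * The Poisson limit at the end of the imaginary quarter period *)

(** The identities along the imaginary axis hold only left of [PI / 2]. This carries them to the end
    point, with the error rate that [poisson_limit] provides. *)
Lemma left_limit_unique (f g : R -> R) (C : R) :
  continuous f (PI / 2) -> continuous g (PI / 2) ->
  (forall x, PI / 4 <= x < PI / 2 -> Rabs (f x - g x) <= C * cos x) ->
  f (PI / 2) = g (PI / 2).
Proof.
intros Hf Hg Hfg.
destruct (Req_dec (f (PI / 2)) (g (PI / 2))) as [E | E]; trivial; exfalso.
assert (Hpi := PI_RGT_0).
set (H := fun x => Rabs (f x - g x) - C * cos x).
assert (HH : continuous H (PI / 2)).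
{ apply (continuous_minus (fun x => Rabs (f x - g x)) (fun x => C * cos x)).
  - apply (continuous_comp (fun x => f x - g x) Rabs).
    + apply (continuous_minus f g); assumption.
    + apply continuous_Rabs.
  - apply (continuous_Rmult (fun _ => C)); [apply continuous_const | apply continuous_cos]. }
assert (Hpos : 0 < H (PI / 2)).
{ unfold H; rewrite cos_PI2, Rmult_0_r, Rminus_0_r; apply Rabs_pos_lt; lra. }
destruct (HH (fun y => 0 < y) (open_gt 0 _ Hpos)) as [e He].
assert (He0 := cond_pos e).
set (x := Rmax (PI / 4) (PI / 2 - e / 2)).
assert (Hx : PI / 4 <= x < PI / 2) by (unfold x, Rmax; destruct Rle_dec; lra).
assert (Hx' : PI / 2 - e / 2 <= x) by (unfold x; apply Rmax_r).
assert (0 < H x).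
{ apply He; apply Rabs_lt_between'; simpl; lra. }
generalize (Hfg x Hx); unfold H in *; lra.
Qed.

Section Poisson.

Variable k : R.
Hypothesis hk : 0 < k < 1.

Lemma atan_le (x : R) : 0 < x -> atan x <= x.
Proof.
intros Hx.
destruct (MVT_cor2 atan (fun y => / (1 + y ^ 2)) 0 x Hx) as [y [E _]].
- intros y _; apply is_derive_Reals; evar_last; [apply is_derive_Reals, derivable_pt_lim_atan |].
  unfold Rsqr; simpl; field; nra.
- rewrite atan_0 in E.
  assert (/ (1 + y ^ 2) <= 1) by (rewrite <- Rinv_1; apply Rinv_le_contravar; nra).
  nra.
Qed.

Lemma kint_cos (t : R) : 0 < t -> kint k cos (- t ^ 2) = atan (k * t) / (k * t).
Proof.
intros Ht.
assert (Hkt : 0 < k * t) by nra.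
assert (Hz : k ^ 2 * - t ^ 2 < 1) by nra.
unfold kint.
rewrite (QInt_derive (fun x => atan (k * t * sin x) / (k * t))).
- rewrite sin_PI2, sin_0, Rmult_1_r, Rmult_0_r, atan_0; field; split; lra.
- intros x; auto_derive; [trivial |].
  unfold kappa; generalize (kappa_den_pos k hk (- t ^ 2) x Hz); intros H.
  field; simpl in *; repeat split; nra.
- apply continuous_kint; [assumption | assumption | apply continuous_cos].
Qed.

(** With [t = tan x] large, [/ cos x * kappa] has mass of order one, concentrated at distance about
    1 / (k t) from 0. So [h] may be replaced by [h0 * cos], whose integral is the arctangent of
    [kint_cos] and tends to half a Poisson kernel. The replacement is cheap because
    [sin ^ 2 * kappa <= / (k * t) ^ 2]. *)
Lemma poisson_limit (h : R -> R) (h0 C : R) :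
  (forall x, continuous h x) ->
  (forall x, 0 <= x <= PI / 2 -> Rabs (h x - h0 * cos x) <= C * sin x ^ 2) ->
  exists C', forall x, PI / 4 <= x < PI / 2 ->
    Rabs (/ cos x * kint k h (1 - / cos x ^ 2) - h0 * PI / (2 * k * sin x)) <= C' * cos x.
Proof.
intros Hc Hb.
assert (Hpi := PI_RGT_0).
assert (HC : 0 <= C).
{ generalize (Hb (PI / 2)); rewrite sin_PI2; intros H.
  generalize (Rabs_pos (h (PI / 2) - h0 * cos (PI / 2))); lra. }
(* The first summand bounds the integral of [h - h0 * cos], the second the gap
   [PI / 2 - atan (k * t)]; both use [/ 2 <= sin x ^ 2], valid from [PI / 4] on. *)
exists (PI * C / k ^ 2 + 2 * Rabs h0 / k ^ 2); intros x Hx.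
assert (Hcos : 0 < cos x) by (apply cos_gt_0; lra).
assert (Hsin : / 2 <= sin x ^ 2).
{ assert (E := sin2 x); assert (E2 := cos_2a x).
  assert (cos (2 * x) <= 0) by (apply cos_le_0; lra).
  generalize (sin2_cos2 x); unfold Rsqr in *; nra. }
assert (Hs0 : 0 < sin x) by (apply sin_gt_0; lra).
assert (Hs1 : sin x <= 1) by (apply SIN_bound).
set (t := sin x / cos x).
assert (Ht : 0 < t) by (apply Rdiv_lt_0_compat; assumption).
assert (Hz : 1 - / cos x ^ 2 = - t ^ 2).
{ unfold t; generalize (sin2_cos2 x); unfold Rsqr; intros; field_simplify_eq; nra. }
rewrite Hz.
assert (Hsub : k ^ 2 * - t ^ 2 < 1) by nra.
assert (Hsplit : kint k h (- t ^ 2) = kint k (fun y => h y - h0 * cos y) (- t ^ 2)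
  + h0 * kint k cos (- t ^ 2)).
{ assert (C1 : forall y, continuous (fun y => h y - h0 * cos y) y).
  { intros y; apply (continuous_minus h (fun y => h0 * cos y)); [apply Hc |].
    apply (continuous_Rmult (fun _ => h0)); [apply continuous_const | apply continuous_cos]. }
  rewrite <- (Rmult_1_l (kint k (fun y => h y - h0 * cos y) _)).
  apply (QInt_combination 1 h0); [| | intros y; ring].
  - apply continuous_kint; assumption.
  - apply continuous_kint; trivial; apply continuous_cos. }
assert (Hrem : Rabs (kint k (fun y => h y - h0 * cos y) (- t ^ 2)) <=
  (PI / 2 - 0) * (C / (k ^ 2 * t ^ 2))).
{ apply abs_RInt_le_const; [lra | |].
  - apply ex_RInt_cont, continuous_kint; trivial.
    intros y; apply (continuous_minus h (fun y => h0 * cos y)); [apply Hc |].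
    apply (continuous_Rmult (fun _ => h0)); [apply continuous_const | apply continuous_cos].
  - intros y Hy.
    assert (Hd := kappa_den_pos k hk _ y Hsub).
    rewrite Rabs_mult, (Rabs_pos_eq (kappa k _ y)) by (left; apply kappa_pos; assumption).
    apply Rle_trans with (C * sin y ^ 2 * kappa k (- t ^ 2) y).
    + apply Rmult_le_compat_r; [left; apply kappa_pos; assumption | apply Hb, Hy].
    + unfold kappa, Rdiv; rewrite Rmult_assoc; apply Rmult_le_compat_l; [assumption |].
      assert (Hkt : 0 < k ^ 2 * t ^ 2) by (apply Rmult_lt_0_compat; apply pow_lt; lra).
      apply (Rmult_le_reg_r (k ^ 2 * t ^ 2)); [assumption |].
      rewrite Rinv_l by lra.
      apply (Rmult_le_reg_r (1 - k ^ 2 * - t ^ 2 * sin y ^ 2)); [assumption |].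
      set (d := 1 - k ^ 2 * - t ^ 2 * sin y ^ 2) in *.
      replace (sin y ^ 2 * / d * (k ^ 2 * t ^ 2) * d) with (sin y ^ 2 * (k ^ 2 * t ^ 2))
        by (field; lra).
      unfold d; lra. }
rewrite kint_cos in Hsplit by assumption.
set (r := kint k (fun y => h y - h0 * cos y) (- t ^ 2)) in *.
assert (Hkt : 0 < k * t) by nra.
assert (Hat : 0 <= PI / 2 - atan (k * t) <= / (k * t)).
{ rewrite <- atan_inv by assumption.
  assert (0 < / (k * t)) by (apply Rinv_0_lt_compat; assumption).
  split; [| apply atan_le; assumption].
  rewrite <- atan_0; left; apply atan_increasing; assumption. }
rewrite Hsplit.
replace (/ cos x * (r + h0 * (atan (k * t) / (k * t))) - h0 * PI / (2 * k * sin x))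
  with (/ cos x * r + - (h0 * (PI / 2 - atan (k * t)) / (k * sin x)))
  by (unfold t; field; repeat split; lra).
eapply Rle_trans; [apply Rabs_triang |].
rewrite Rabs_Ropp, Rabs_mult, (Rabs_pos_eq (/ cos x)) by (left; apply Rinv_0_lt_compat; lra).
assert (Habs : Rabs (h0 * (PI / 2 - atan (k * t)) / (k * sin x)) =
  Rabs h0 * (PI / 2 - atan (k * t)) * / (k * sin x)).
{ unfold Rdiv at 1; rewrite Rabs_mult, Rabs_mult, (Rabs_pos_eq (PI / 2 - _)) by lra.
  rewrite (Rabs_pos_eq (/ (k * sin x))) by (left; apply Rinv_0_lt_compat; nra); ring. }
rewrite Habs.
rewrite Rmult_plus_distr_r; apply Rplus_le_compat.
- apply (Rmult_le_reg_l (cos x)); [assumption |].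
  rewrite <- Rmult_assoc, Rinv_r, Rmult_1_l by lra.
  eapply Rle_trans; [exact Hrem |].
  replace ((PI / 2 - 0) * (C / (k ^ 2 * t ^ 2))) with
    (PI * C / k ^ 2 * cos x ^ 2 * (/ (2 * sin x ^ 2))) by (unfold t; field; repeat split; lra).
  replace (cos x * (PI * C / k ^ 2 * cos x)) with (PI * C / k ^ 2 * cos x ^ 2 * 1) by ring.
  apply Rmult_le_compat_l.
  + apply Rmult_le_pos; [| nra]. apply Rmult_le_pos; [nra |].
    left; apply Rinv_0_lt_compat; nra.
  + rewrite <- Rinv_1; apply Rinv_le_contravar; lra.
- assert (Hh0 := Rabs_pos h0).
  apply Rle_trans with (Rabs h0 * / (k * t) * / (k * sin x)).
  { apply Rmult_le_compat_r; [left; apply Rinv_0_lt_compat; nra |].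
    apply Rmult_le_compat_l; lra. }
  replace (Rabs h0 * / (k * t) * / (k * sin x)) with
    (Rabs h0 / k ^ 2 * cos x * / (sin x ^ 2)) by (unfold t; field; repeat split; lra).
  replace (2 * Rabs h0 / k ^ 2 * cos x) with (Rabs h0 / k ^ 2 * cos x * 2) by (unfold Rdiv; ring).
  apply Rmult_le_compat_l.
  + apply Rmult_le_pos; [| lra]. apply Rmult_le_pos; [lra |].
    left; apply Rinv_0_lt_compat; nra.
  + rewrite <- (Rinv_inv 2); apply Rinv_le_contravar; lra.
Qed.

End Poisson.

(** * Fourier coefficients of sn, cn, dn and sn^2 *)

(** From sin x >= x - x^3 / 6 with x <= 2, since 1 - 4 / 6 = 1 / 3. *)
Lemma sin_linear_lower (x : R) : 0 <= x <= PI / 2 -> x <= 3 * sin x.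
Proof.
intros Hx.
assert (H4 := PI_4).
destruct (pre_sin_bound x 0) as [H _]; [lra | lra |].
unfold sin_approx, sin_term in H; simpl in H; nra.
Qed.

Lemma one_minus_cos_le (y : R) : 0 <= 1 - cos y <= y ^ 2 / 2.
Proof.
assert (E := cos_2a_sin (y / 2)); replace (2 * (y / 2)) with y in E by field.
assert (Hs : Rabs (sin (y / 2)) <= Rabs (y / 2)).
{ destruct (MVT_abs sin cos 0 (y / 2)) as [z [Hz _]];
    [intros; apply derivable_pt_lim_sin |].
  rewrite sin_0, !Rminus_0_r in Hz; rewrite Hz.
  rewrite <- (Rmult_1_l (Rabs (y / 2))) at 2.
  apply Rmult_le_compat_r; [apply Rabs_pos | apply Rabs_le, COS_bound]. }
apply Rsqr_le_abs_1 in Hs; unfold Rsqr in Hs; split; [generalize (COS_bound y); lra | nra].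
Qed.

Section Frequency.

Variables (k : R) (p m : nat).
Hypothesis hk : 0 < k < 1.

Lemma ellipticK_pos : 0 < ellipticK k.
Proof.
apply (RInt_gt_0 (fun t => / delta k t)); [generalize PI_RGT_0; lra | |].
- intros; apply Rinv_0_lt_compat, delta_pos, hk.
- intros; apply continuous_inv_delta, hk.
Qed.

Definition freq : R := INR (2 * m + 1 + p) * PI / (2 * ellipticK k).
(** The phase [p * PI / 2] makes the condition at the quarter period the same in both cases: for
    [p = 1], [wc] is sin(xi v) and [ws] is - cos(xi v). *)
Definition wc (x : R) : R := cos (freq * ellF k x - INR p * (PI / 2)).
Definition ws (x : R) : R := sin (freq * ellF k x - INR p * (PI / 2)).

Lemma freq_pos : 0 < freq.
Proof.
apply Rdiv_lt_0_compat.
- apply Rmult_lt_0_compat; [apply lt_0_INR; lia | apply PI_RGT_0].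
- generalize ellipticK_pos; lra.
Qed.

Lemma wc_derive (x : R) : is_derive wc x (- freq * ws x / delta k x).
Proof.
unfold wc; auto_derive; [eexists; apply (is_derive_ellF k hk) |].
Derive_eq (is_derive_ellF k hk x).
unfold ws, Rminus, Rdiv; ring.
Qed.

Lemma ws_derive (x : R) : is_derive ws x (freq * wc x / delta k x).
Proof.
unfold ws; auto_derive; [eexists; apply (is_derive_ellF k hk) |].
Derive_eq (is_derive_ellF k hk x).
unfold wc, Rminus, Rdiv; ring.
Qed.

Lemma wc_PI2 : wc (PI / 2) = 0.
Proof.
unfold wc; rewrite ellF_PI2.
replace (freq * ellipticK k - INR p * (PI / 2)) with (INR m * PI + PI / 2).
- rewrite cos_plus, cos_PI2, (sin_eq_0_1 (INR m * PI)); [ring |].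
  exists (Z.of_nat m); rewrite <- INR_IZR_INZ; trivial.
- unfold freq; rewrite !plus_INR, mult_INR; simpl; field.
  apply Rgt_not_eq, ellipticK_pos.
Qed.

Lemma wcs_1 (x : R) : wc x ^ 2 + ws x ^ 2 = 1.
Proof. unfold wc, ws; rewrite <- !Rsqr_pow2, Rplus_comm; apply sin2_cos2. Qed.

Lemma wc_0_even : p = 0%nat -> wc 0 = 1.
Proof. intros Hp; unfold wc; rewrite ellF_0, Hp; simpl; replace (freq * 0 - 0 * (PI / 2)) with 0 by ring; apply cos_0. Qed.
Lemma ws_0_even : p = 0%nat -> ws 0 = 0.
Proof. intros Hp; unfold ws; rewrite ellF_0, Hp; simpl; replace (freq * 0 - 0 * (PI / 2)) with 0 by ring; apply sin_0. Qed.
Lemma wc_0_odd : p = 1%nat -> wc 0 = 0.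
Proof.
intros Hp; unfold wc; rewrite ellF_0, Hp; simpl.
replace (freq * 0 - 1 * (PI / 2)) with (- (PI / 2)) by ring; rewrite cos_neg; apply cos_PI2.
Qed.
Lemma ws_0_odd : p = 1%nat -> ws 0 = - (1).
Proof.
intros Hp; unfold ws; rewrite ellF_0, Hp; simpl.
replace (freq * 0 - 1 * (PI / 2)) with (- (PI / 2)) by ring; rewrite sin_neg, sin_PI2; ring.
Qed.
Lemma wc_even : p = 0%nat -> forall x, wc x = cos (freq * ellF k x).
Proof. intros Hp x; unfold wc; rewrite Hp; simpl; f_equal; ring. Qed.
Lemma ws_odd : p = 1%nat -> forall x, - ws x = cos (freq * ellF k x).
Proof.
intros Hp x; unfold ws; rewrite Hp, <- sin_shift, <- sin_neg; simpl; f_equal; ring.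
Qed.

Lemma ellF_bound (x : R) : 0 <= x -> 0 <= ellF k x <= x / kc k.
Proof.
intros Hx; split.
- destruct (Req_dec x 0) as [-> | Hx0]; [rewrite ellF_0; lra |].
  left; apply (RInt_gt_0 (fun t => / delta k t)); [lra | |].
  + intros; apply Rinv_0_lt_compat, delta_pos, hk.
  + intros; apply continuous_inv_delta, hk.
- apply Rle_trans with (Rabs (ellF k x)); [apply Rle_abs |].
  replace (x / kc k) with ((x - 0) * / kc k) by (unfold Rdiv; ring).
  apply abs_RInt_le_const; [assumption | apply ex_RInt_cont, continuous_inv_delta, hk |].
  intros t _; rewrite Rabs_pos_eq by (left; apply Rinv_0_lt_compat, delta_pos, hk).
  apply Rinv_le_contravar; [apply kc_range, hk | apply delta_lower, hk].
Qed.

Lemma cos_freq_bound : exists C, forall x, 0 <= x <= PI / 2 ->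
  Rabs (cos (freq * ellF k x) - 1) <= C * sin x ^ 2.
Proof.
exists ((freq * 3 / kc k) ^ 2 / 2); intros x Hx.
rewrite Rabs_minus_sym, Rabs_pos_eq by apply one_minus_cos_le.
eapply Rle_trans; [apply one_minus_cos_le |].
assert (H1 := ellF_bound x (proj1 Hx)); assert (H2 := sin_linear_lower x Hx).
assert (H3 := kc_range k hk); assert (H4 := freq_pos).
assert (H5 : ellF k x <= 3 * sin x / kc k).
{ eapply Rle_trans; [apply H1 |]. apply Rmult_le_compat_r; [left; apply Rinv_0_lt_compat; lra | lra]. }
replace ((freq * 3 / kc k) ^ 2 / 2 * sin x ^ 2) with ((freq * (3 * sin x / kc k)) ^ 2 / 2)
  by (field; lra).
apply Rmult_le_compat_r; [lra |].
apply pow_incr; split; [nra | apply Rmult_le_compat_l; lra].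
Qed.

(** Produces the hypothesis of [poisson_limit] with [h0 = 1]: the oscillating factor [u] is 1 and
    the elliptic factor [g] is [cos], both up to second order at 0. The bound [/ kc k] on [g]
    reflects [delta >= kc]. *)
Lemma weight_bound (u g : R -> R) (C : R) :
  (forall x, 0 <= x <= PI / 2 -> Rabs (u x - 1) <= C * sin x ^ 2) ->
  (forall x, 0 <= x <= PI / 2 -> Rabs (g x) <= / kc k) ->
  (forall x, 0 <= x <= PI / 2 -> Rabs (g x - cos x) <= (/ kc k + 1) * sin x ^ 2) ->
  forall x, 0 <= x <= PI / 2 ->
    Rabs (u x * g x - 1 * cos x) <= (C * / kc k + (/ kc k + 1)) * sin x ^ 2.
Proof.
intros Hu Hg Hg' x Hx.
replace (u x * g x - 1 * cos x) with ((u x - 1) * g x + (g x - cos x)) by ring.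
eapply Rle_trans; [apply Rabs_triang |].
rewrite Rabs_mult, Rmult_plus_distr_r; apply Rplus_le_compat; [| auto].
replace (C * / kc k * sin x ^ 2) with (C * sin x ^ 2 * / kc k) by ring.
apply Rmult_le_compat; auto using Rabs_pos.
Qed.


Lemma inv_delta_bound (x : R) : Rabs (/ delta k x) <= / kc k.
Proof.
rewrite Rabs_pos_eq by (left; apply Rinv_0_lt_compat, delta_pos, hk).
apply Rinv_le_contravar; [apply kc_range, hk | apply delta_lower, hk].
Qed.

Lemma inv_kc_gt_1 : 1 < / kc k.
Proof. rewrite <- Rinv_1; apply Rinv_lt_contravar; generalize (kc_range k hk); lra. Qed.

Lemma inv_delta_minus_1 (x : R) : 0 <= / delta k x - 1 <= / kc k * sin x ^ 2.
Proof.
assert (Hd := delta_pos k hk x); assert (E := delta_sqr k hk x).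
assert (Hi := inv_delta_bound x).
assert (Hs := sin2_range x); assert (Hk2 := k2_range k hk).
rewrite Rabs_pos_eq in Hi by (left; apply Rinv_0_lt_compat, Hd).
assert (Hd1 : delta k x <= 1) by nra.
assert (Hi0 : 0 < / delta k x) by (apply Rinv_0_lt_compat, Hd).
replace (/ delta k x - 1) with ((1 - delta k x) * / delta k x) by (field; lra).
split; [apply Rmult_le_pos; lra |].
rewrite (Rmult_comm (/ kc k)); apply Rmult_le_compat; nra.
Qed.

Lemma one_minus_cos_sin2 (x : R) : 0 <= x <= PI / 2 -> 0 <= cos x <= 1 /\ 0 <= 1 - cos x <= sin x ^ 2.
Proof.
intros Hx; assert (Hpi := PI_RGT_0).
assert (0 <= cos x) by (apply cos_ge_0; lra).
generalize (COS_bound x) (sin2_cos2 x); unfold Rsqr; intros; nra.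
Qed.

Ltac weight := intros x Hx; generalize (one_minus_cos_sin2 x Hx) (inv_delta_minus_1 x) inv_kc_gt_1
  (sin2_range x); intros; split_Rabs; nra.

Definition Kc : R := ellipticK (sqrt (1 - k ^ 2)).

Lemma continuous_ellF_c (x : R) : continuous (ellF (kc k)) x.
Proof.
apply (ex_derive_continuous (ellF (kc k))); eexists; apply is_derive_ellF, kc_range, hk.
Qed.

Lemma continuous_exp_freq (a : R) (x : R) : continuous (fun y => exp (a * ellF (kc k) y)) x.
Proof.
apply (continuous_comp (fun y => a * ellF (kc k) y) exp).
- apply (continuous_Rmult (fun _ => a)); [apply continuous_const | apply continuous_ellF_c].
- apply (ex_derive_continuous exp); auto_derive; trivial.
Qed.

Lemma continuous_exp_pm (a e : R) (x : R) : continuous (fun y => a *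
  (exp (freq * ellF (kc k) y) + e * exp (- (freq * ellF (kc k) y)))) x.
Proof.
apply (continuous_Rmult (fun _ => a)); [apply continuous_const |].
apply (continuous_plus (fun y => exp (freq * ellF (kc k) y))); [apply continuous_exp_freq |].
apply (continuous_Rmult (fun _ => e)); [apply continuous_const |].
apply (continuous_ext (fun y => exp (- freq * ellF (kc k) y))).
- intros y; f_equal; ring.
- apply continuous_exp_freq.
Qed.

(** Comparison of the two values at the end of the imaginary quarter period, where [ellF (kc k)]
    equals [Kc]. The sign [e] distinguishes hyperbolic cosine from sine, and [mult] collects what
    separates the hyperbolic identity from [/ cos x * kint]. *)
Lemma poisson_evaluation (a e : R) (mult h : R -> R) (B C : R) :
  (forall x, continuous h x) -> continuous mult (PI / 2) ->
  (forall x, PI / 4 <= x < PI / 2 -> Rabs (mult x) <= B) ->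
  (forall x, 0 <= x <= PI / 2 -> Rabs (h x - 1 * cos x) <= C * sin x ^ 2) ->
  (forall x, PI / 4 <= x < PI / 2 ->
     a * (exp (freq * ellF (kc k) x) + e * exp (- (freq * ellF (kc k) x)))
     = mult x * (/ cos x * kint k h (1 - / cos x ^ 2))) ->
  a * (exp (freq * Kc) + e * exp (- (freq * Kc))) = mult (PI / 2) * (PI / (2 * k)).
Proof.
intros Hh Hmult HB HC HLx.
destruct (poisson_limit k hk h 1 C Hh HC) as [C' HC'].
assert (Hpi := PI_RGT_0).
transitivity (mult (PI / 2) * (1 * PI / (2 * k * sin (PI / 2))));
  [| rewrite sin_PI2; f_equal; field; lra].
apply (left_limit_unique (fun x => a * (exp (freq * ellF (kc k) x)
  + e * exp (- (freq * ellF (kc k) x)))) (fun x => mult x * (1 * PI / (2 * k * sin x))) (B * C')).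
- apply continuous_exp_pm.
- apply continuous_Rmult; [assumption |].
  apply (ex_derive_continuous (fun x => 1 * PI / (2 * k * sin x))).
  auto_derive; rewrite sin_PI2; lra.
- intros x Hx; rewrite HLx, <- Rmult_minus_distr_l, Rabs_mult, (Rmult_assoc B) by assumption.
  apply Rmult_le_compat; auto using Rabs_pos.
Qed.

(** By parts, [kint k (hN wc 0) 0] is [freq] times the integral of sin(xi v) sn v over a quarter
    period. *)
Lemma fourier_sn : p = 0%nat ->
  kint k (hN wc 0) 0 * (exp (freq * Kc) - exp (- (freq * Kc))) = freq * PI / k.
Proof.
intros Hp; unfold Rminus; rewrite <- (Rmult_1_l (exp (- _))), Ropp_mult_distr_l.
destruct cos_freq_bound as [C HC].
transitivity (2 * freq * sin (PI / 2) * (PI / (2 * k)));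
  [| rewrite sin_PI2; field; lra].
apply (poisson_evaluation _ (- (1)) (fun x => 2 * freq * sin x) (hN wc 0) (2 * freq) (C * / kc k + (/ kc k + 1))).
- intros; eapply continuous_hN; first [exact hk | exact wc_derive | exact ws_derive].
- apply (continuous_Rmult (fun _ => 2 * freq)); [apply continuous_const | apply continuous_sin].
- intros x _; generalize (SIN_bound x) freq_pos; intros; rewrite Rabs_mult.
  rewrite (Rabs_pos_eq (2 * freq)) by lra.
  rewrite <- (Rmult_1_r (2 * freq)) at 2; apply Rmult_le_compat_l; [lra | apply Rabs_le; lra].
- intros x Hx; unfold hN; rewrite wc_even by assumption.
  replace (cos (freq * ellF k x) * (sin x ^ 0 * cos x)) with (cos (freq * ellF k x) * cos x)
    by (simpl; ring).
  revert x Hx; apply (weight_bound _ cos); [exact HC | weight | weight].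
- intros x Hx; generalize (imaginary_even k freq wc ws hk wc_derive ws_derive wc_PI2
    (ws_0_even Hp) x); intros E.
  transitivity (kint k (hN wc 0) 0 *
    (exp (freq * ellF (kc k) x) - exp (- (freq * ellF (kc k) x)))); [ring |].
  rewrite <- E by (generalize PI_RGT_0; lra).
  unfold Rdiv; ring.
Qed.

Lemma fourier_cn : p = 0%nat ->
  kint k (hNc k wc) 0 * (exp (freq * Kc) + exp (- (freq * Kc))) = PI / k.
Proof.
intros Hp.
destruct cos_freq_bound as [C HC].
transitivity (2 * (PI / (2 * k))); [| field; lra].
rewrite <- (Rmult_1_l (exp (- _))).
apply (poisson_evaluation _ 1 (fun x => 2) (hNc k wc) 2 (C * / kc k + (/ kc k + 1))).
- intros; eapply continuous_hNc; first [exact hk | exact wc_derive | exact ws_derive].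
- apply continuous_const.
- intros x _; rewrite Rabs_pos_eq; lra.
- intros x Hx; unfold hNc; rewrite wc_even by assumption.
  unfold Rdiv; rewrite Rmult_assoc.
  revert x Hx; apply (weight_bound _ (fun x => cos x * / delta k x)); [exact HC | |].
  + intros x Hx; rewrite Rabs_mult, <- (Rmult_1_l (/ kc k)).
    apply Rmult_le_compat; auto using Rabs_pos, inv_delta_bound.
    apply Rabs_le, COS_bound.
  + intros x Hx; generalize (one_minus_cos_sin2 x Hx) (inv_delta_minus_1 x) (sin2_range x).
    intros; replace (cos x * / delta k x - cos x) with (cos x * (/ delta k x - 1)) by ring.
    rewrite Rabs_pos_eq; nra.
- intros x Hx; generalize (imaginary_cn k freq wc ws hk freq_pos wc_derive ws_derive wc_PI2
    (ws_0_even Hp) x); intros E.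
  rewrite Rmult_1_l, <- E by (generalize PI_RGT_0; lra); ring.
Qed.

Lemma fourier_dn : p = 1%nat ->
  kint k (hNd ws) 0 * (exp (freq * Kc) + exp (- (freq * Kc))) = PI.
Proof.
intros Hp.
destruct cos_freq_bound as [C HC].
transitivity (2 * delta (kc k) (PI / 2) * (PI / (2 * k))).
2: { unfold delta; rewrite sin_PI2, kc_sqr by assumption.
     replace (1 - (1 - k ^ 2) * 1 ^ 2) with (k ^ 2) by ring.
     rewrite sqrt_pow2; [field |]; lra. }
rewrite <- (Rmult_1_l (exp (- _))).
apply (poisson_evaluation _ 1 (fun x => 2 * delta (kc k) x) (hNd ws) 2 (C * / kc k + (/ kc k + 1))).
- intros; eapply continuous_hNd; first [exact hk | exact wc_derive | exact ws_derive].
- apply (continuous_Rmult (fun _ => 2)); [apply continuous_const |].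
  apply (ex_derive_continuous (delta (kc k))), ex_derive_delta, kc_range, hk.
- intros x _; generalize (delta_pos (kc k) (kc_range k hk) x) (delta_sqr (kc k) (kc_range k hk) x)
    (sin2_range x) (k2_range (kc k) (kc_range k hk)); intros.
  rewrite Rabs_pos_eq; nra.
- intros x Hx; unfold hNd; rewrite ws_odd by assumption.
  rewrite <- (Rmult_1_r (cos (freq * _))).
  revert x Hx; apply (weight_bound _ (fun x => 1)); [exact HC | weight | weight].
- intros x Hx; generalize (imaginary_dn k freq wc ws hk freq_pos wc_derive ws_derive wc_PI2
    (wc_0_odd Hp) x); intros E.
  rewrite Rmult_1_l, <- E by (generalize PI_RGT_0; lra); unfold Rdiv; ring.
Qed.

(** By parts, [kint k (hN wc 1) 0] is [- freq / 2] times the integral of cos(xi v) sn(v)^2. The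
    weight [hM 1] vanishes at 0 and cannot enter the Poisson limit as it is; it is first reduced to
    [- ws / delta], which is 1 there. *)
Lemma fourier_sn2 : p = 1%nat ->
  kint k (hN wc 1) 0 * (exp (freq * Kc) - exp (- (freq * Kc))) = freq ^ 2 * PI / (2 * k ^ 2).
Proof.
intros Hp; unfold Rminus; rewrite <- (Rmult_1_l (exp (- _))), Ropp_mult_distr_l.
destruct cos_freq_bound as [C HC].
transitivity (freq ^ 2 * delta (kc k) (PI / 2) / (k ^ 2 * sin (PI / 2)) * (PI / (2 * k))).
2: { unfold delta; rewrite sin_PI2, kc_sqr by assumption.
     replace (1 - (1 - k ^ 2) * 1 ^ 2) with (k ^ 2) by ring.
     rewrite sqrt_pow2; [field |]; lra. }
assert (Hu : forall x, continuous (fun x => - ws x * / delta k x) x).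
{ intros x; apply (continuous_Rmult (fun x => - ws x)); [| apply continuous_inv_delta, hk].
  eapply (continuous_hNd k freq wc ws ws_derive). }
assert (HI : QInt (fun x => ws x * / delta k x) = 0).
{ rewrite (QInt_derive (fun x => - / freq * wc x)).
  - rewrite wc_PI2, (wc_0_odd Hp); ring.
  - intros x; evar_last; [apply is_derive_scal, wc_derive |].
    field; split; [apply Rgt_not_eq, delta_pos, hk | apply Rgt_not_eq, freq_pos].
  - intros x; apply (continuous_Rmult ws); [| apply continuous_inv_delta, hk].
    apply (ex_derive_continuous ws); eexists; apply ws_derive. }
apply (poisson_evaluation _ (- (1)) (fun x => freq ^ 2 * delta (kc k) x / (k ^ 2 * sin x)) (fun x => - ws x * / delta k x)
  (2 * freq ^ 2 / k ^ 2) (C * / kc k + (/ kc k + 1))).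
- exact Hu.
- apply (ex_derive_continuous (fun x => freq ^ 2 * delta (kc k) x / (k ^ 2 * sin x))).
  auto_derive; rewrite sin_PI2; split; [apply ex_derive_delta, kc_range, hk | split; [nra | trivial]].
- intros x Hx; generalize (delta_pos (kc k) (kc_range k hk) x) (delta_sqr (kc k) (kc_range k hk) x)
    (sin2_range x) (k2_range (kc k) (kc_range k hk)) freq_pos; intros.
  assert (Hpi := PI_RGT_0).
  assert (Hs0 : 0 < sin x) by (apply sin_gt_0; lra).
  assert (Hs : / 2 <= sin x).
  { assert (cos (2 * x) <= 0) by (apply cos_le_0; lra).
    assert (E2 := cos_2a_sin x); nra. }
  assert (Hd1 : delta (kc k) x <= 1) by nra.
  assert (Hi : / sin x <= 2) by (rewrite <- (Rinv_inv 2); apply Rinv_le_contravar; lra).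
  assert (Hi0 : 0 < / sin x) by (apply Rinv_0_lt_compat; lra).
  replace (freq ^ 2 * delta (kc k) x / (k ^ 2 * sin x)) with
    (freq ^ 2 / k ^ 2 * (delta (kc k) x * / sin x)) by (field; lra).
  replace (2 * freq ^ 2 / k ^ 2) with (freq ^ 2 / k ^ 2 * 2) by (field; lra).
  assert (0 < freq ^ 2 / k ^ 2) by (apply Rdiv_lt_0_compat; apply pow_lt; lra).
  rewrite Rabs_pos_eq by (apply Rmult_le_pos; [lra |]; left; apply Rmult_lt_0_compat; lra).
  apply Rmult_le_compat_l; [lra | nra].
- intros x Hx; rewrite ws_odd by assumption.
  revert x Hx; apply (weight_bound _ (fun x => / delta k x)); [exact HC | |].
  + intros x _; apply inv_delta_bound.
  + intros x Hx; generalize (one_minus_cos_sin2 x Hx) (inv_delta_minus_1 x) (sin2_range x).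
    intros; rewrite Rabs_pos_eq; lra.
- intros x Hx; assert (Hpi := PI_RGT_0).
  generalize (imaginary_odd k freq wc ws hk freq_pos wc_derive ws_derive wc_PI2
    (wc_0_odd Hp) x); intros E.
  transitivity (kint k (hN wc 1) 0 *
    (exp (freq * ellF (kc k) x) - exp (- (freq * ellF (kc k) x)))); [ring |].
  rewrite <- E by lra.
  assert (Hs0 : 0 < sin x) by (apply sin_gt_0; lra).
  assert (Hc0 : 0 < cos x) by (apply cos_gt_0; lra).
  assert (Hz : k ^ 2 * (1 - / cos x ^ 2) < 1) by (apply imaginary_subcritical; lra).
  assert (Hz' : 1 - / cos x ^ 2 = - (sin x ^ 2 / cos x ^ 2)).
  { generalize (sin2_cos2 x); unfold Rsqr; intros E'; field_simplify_eq; nra. }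
  (* From [k ^ 2 * z * sin ^ 2 * kappa = kappa - 1] with [z = - tan x ^ 2]. The half without kernel
     integrates to 0 by [HI]. *)
  assert (Hsplit : kint k (hM k freq ws 1) (1 - / cos x ^ 2) =
    freq * cos x ^ 2 / (k ^ 2 * sin x ^ 2) * QInt (fun x => ws x * / delta k x)
    + freq * cos x ^ 2 / (k ^ 2 * sin x ^ 2)
      * kint k (fun x => - ws x * / delta k x) (1 - / cos x ^ 2)).
  { apply QInt_combination.
    - intros y; apply (continuous_Rmult ws); [| apply continuous_inv_delta, hk].
      apply (ex_derive_continuous ws); eexists; apply ws_derive.
    - apply continuous_kint; assumption.
    - intros y; assert (Hd := kappa_den_pos k hk _ y Hz).
      unfold hM, kappa; rewrite Hz' in Hd |- *.
      assert (delta k y <> 0) by (apply Rgt_not_eq, delta_pos, hk).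
      assert (cos x ^ 2 + k ^ 2 * sin x ^ 2 * sin y ^ 2 <> 0).
      { apply Rgt_not_eq, Rplus_lt_le_0_compat; [apply pow_lt; assumption |].
        apply Rmult_le_pos; [apply Rmult_le_pos |]; apply pow2_ge_0. }
      field; repeat split; lra. }
  rewrite Hsplit, HI; field; repeat split; lra.
Qed.

End Frequency.

(** * Moments and Stieltjes-Carlitz polynomials *)

Lemma is_series_ext_R (a b : nat -> R) (l : R) :
  (forall n, a n = b n) -> is_series a l -> is_series b l.
Proof. apply (is_series_ext a b l). Qed.

Lemma is_series_geom_rate (a : nat -> R) (l M r : R) :
  0 <= r < 1 -> (forall N, Rabs (sum_n a N - l) <= M * r ^ N) -> is_series a l.
Proof.
intros Hr H.
assert (Hlim : is_lim_seq (fun N => sum_n a N - l) 0).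
{ apply is_lim_seq_abs_0.
  apply (is_lim_seq_le_le (fun _ => 0) _ (fun N => M * r ^ N)).
  - intros N; split; [apply Rabs_pos | apply H].
  - apply is_lim_seq_const.
  - replace (Finite 0) with (Rbar_mult M 0) by (simpl; f_equal; ring).
    apply is_lim_seq_scal_l, is_lim_seq_geom; rewrite Rabs_pos_eq; lra. }
change (is_lim_seq (sum_n a) l).
apply (is_lim_seq_ext (fun N => (sum_n a N - l) + l)); [intros N; ring |].
generalize (is_lim_seq_plus' _ _ 0 l Hlim (is_lim_seq_const l)); rewrite Rplus_0_l; trivial.
Qed.

Lemma ex_series_geom_bound (a : nat -> R) (C r : R) :
  0 <= r < 1 -> (forall n, Rabs (a n) <= C * r ^ n) -> ex_series a.
Proof.
intros Hr H; apply (ex_series_le a (fun n => C * r ^ n)); [exact H |].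
apply (ex_series_scal_l C (fun n => r ^ n)), ex_series_geom; rewrite Rabs_pos_eq; lra.
Qed.

Lemma Series_geom_bound (a : nat -> R) (C r : R) :
  0 <= r < 1 -> (forall n, Rabs (a n) <= C * r ^ n) -> Rabs (Series a) <= C / (1 - r).
Proof.
intros Hr H.
assert (Hg : ex_series (fun n => C * r ^ n)).
{ apply (ex_series_scal_l C (fun n => r ^ n)), ex_series_geom; rewrite Rabs_pos_eq; lra. }
eapply Rle_trans; [apply Series_Rabs |].
- apply (ex_series_le (fun n => Rabs (a n)) (fun n => C * r ^ n)); [| exact Hg].
  intros n; unfold norm; simpl; unfold abs; simpl; rewrite Rabs_Rabsolu; apply H.
- eapply Rle_trans; [apply (Series_le _ (fun n => C * r ^ n)); [| exact Hg] |].
  + intros n; split; [apply Rabs_pos | apply H].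
  + rewrite Series_scal_l, Series_geom by (rewrite Rabs_pos_eq; lra).
    unfold Rdiv; lra.
Qed.

Lemma Series_geom_tail (a : nat -> R) (C r : R) (N : nat) :
  0 <= r < 1 -> (forall n, Rabs (a n) <= C * r ^ n) ->
  Rabs (sum_n a N - Series a) <= C * r / (1 - r) * r ^ N.
Proof.
intros Hr H.
rewrite (Series_incr_n a (S N)); [| lia | apply (ex_series_geom_bound a C r); assumption].
simpl pred; rewrite <- sum_n_Reals.
replace (sum_n a N - (sum_n a N + Series (fun k => a (S N + k)%nat)))
  with (- Series (fun k => a (S N + k)%nat)) by ring.
rewrite Rabs_Ropp.
replace (C * r / (1 - r) * r ^ N) with (C * r ^ (S N) / (1 - r)) by (simpl; field; lra).
apply Series_geom_bound; [assumption |].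
intros n; eapply Rle_trans; [apply H |].
rewrite pow_add; right; ring.
Qed.

(** The radius of convergence is at least [/ r > 1], so the end point [sin x ^ 2 = 1] is
    included. *)
Lemma PSeries_continuous_unit (b : nat -> R) (C r y : R) :
  0 < r < 1 -> (forall n, Rabs (b n) <= C * r ^ n) -> 0 <= y <= 1 ->
  continuous (PSeries b) y.
Proof.
intros Hr Hb Hy.
apply continuity_pt_filterlim, PSeries_continuity.
apply Rbar_lt_le_trans with (Finite (/ r)).
- simpl; rewrite Rabs_pos_eq by lra; apply Rle_lt_trans with 1; [lra |].
  rewrite <- Rinv_1; apply Rinv_lt_contravar; lra.
- apply (proj1 (CV_radius_bounded b)); exists C; intros n.
  rewrite Rabs_mult.
  rewrite pow_inv, (Rabs_pos_eq (/ r ^ n)) by (left; apply Rinv_0_lt_compat, pow_lt; lra).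
  apply (Rmult_le_reg_r (r ^ n)); [apply pow_lt; lra |].
  rewrite Rmult_assoc, Rinv_l, Rmult_1_r by (apply pow_nonzero; lra).
  apply Hb.
Qed.

Lemma QInt_bound (f : R -> R) (M : R) : (forall x, continuous f x) ->
  (forall x, Rabs (f x) <= M) -> Rabs (QInt f) <= PI / 2 * M.
Proof.
intros Hf HM; assert (Hpi := PI_RGT_0).
replace (PI / 2 * M) with ((PI / 2 - 0) * M) by ring.
apply abs_RInt_le_const; [lra | apply ex_RInt_cont, Hf | auto].
Qed.

(** Since [sin x ^ 2 <= 1], the partial sums converge at the rate [r ^ N] uniformly in [x], which
    lets sum and integral be exchanged. *)
Lemma series_QInt (b : nat -> R) (h : R -> R) (C M r : R) :
  0 < r < 1 -> (forall n, Rabs (b n) <= C * r ^ n) ->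
  (forall x, continuous h x) -> (forall x, Rabs (h x) <= M) ->
  is_series (fun n => b n * QInt (fun x => h x * sin x ^ (2 * n)))
    (QInt (fun x => h x * PSeries b (sin x ^ 2))).
Proof.
intros Hr Hb Hh HM.
assert (Hpi := PI_RGT_0).
assert (Hcs : forall n x, continuous (fun x => h x * sin x ^ (2 * n)) x).
{ intros n x; apply continuous_Rmult; [apply Hh | apply continuous_Rpow, continuous_sin]. }
assert (HcP : forall x, continuous (fun x => h x * PSeries b (sin x ^ 2)) x).
{ intros x; apply continuous_Rmult; [apply Hh |].
  apply (continuous_comp (fun x => sin x ^ 2) (PSeries b)).
  - apply continuous_Rpow, continuous_sin.
  - apply (PSeries_continuous_unit b C r); [assumption | assumption | apply sin2_range]. }
set (a := fun n => b n * QInt (fun x => h x * sin x ^ (2 * n))).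
assert (Hsum : forall N, (forall x, continuous (fun x => h x * sum_n (fun n => b n * (sin x ^ 2) ^ n) N) x)
  /\ sum_n a N = QInt (fun x => h x * sum_n (fun n => b n * (sin x ^ 2) ^ n) N)).
{ induction N as [|N [IHc IH]].
  - split.
    + intros x; apply (continuous_ext (fun x => b 0%nat * (h x * sin x ^ (2 * 0)))).
      * intros y; rewrite sum_O; simpl; ring.
      * apply (continuous_Rmult (fun _ => b 0%nat)); [apply continuous_const | apply Hcs].
    + rewrite sum_O; unfold a; rewrite <- QInt_scal by apply Hcs.
      apply QInt_ext; intros x; rewrite sum_O; simpl; ring.
  - split.
    + intros x; apply (continuous_ext (fun x => h x * sum_n (fun n => b n * (sin x ^ 2) ^ n) N +
        b (S N) * (h x * sin x ^ (2 * S N)))).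
      * intros y; rewrite sum_Sn; unfold plus; simpl plus; rewrite <- pow_mult; simpl; ring.
      * apply (continuous_plus (fun x => h x * sum_n (fun n => b n * (sin x ^ 2) ^ n) N)); [apply IHc |].
        apply (continuous_Rmult (fun _ => b (S N))); [apply continuous_const | apply Hcs].
    + rewrite sum_Sn, IH; unfold plus; simpl plus; unfold a.
      rewrite <- (Rmult_1_l (QInt (fun x => h x * sum_n _ N))); symmetry.
      apply QInt_combination; [apply IHc | apply Hcs |].
      intros x; rewrite sum_Sn; unfold plus; simpl plus; rewrite <- pow_mult; simpl; ring. }
apply (is_series_geom_rate _ _ (PI / 2 * (M * (C * r / (1 - r)))) r); [lra |].
intros N; destruct (Hsum N) as [HcN ->].
replace (QInt (fun x => h x * sum_n (fun n => b n * (sin x ^ 2) ^ n) N)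
   - QInt (fun x => h x * PSeries b (sin x ^ 2)))
  with (1 * QInt (fun x => h x * sum_n (fun n => b n * (sin x ^ 2) ^ n) N)
   + (-1) * QInt (fun x => h x * PSeries b (sin x ^ 2))) by ring.
rewrite <- QInt_lin by assumption.
rewrite Rmult_assoc; apply QInt_bound.
- apply continuous_lin; assumption.
- intros x.
  replace (1 * (h x * sum_n (fun n => b n * (sin x ^ 2) ^ n) N) + -1 * (h x * PSeries b (sin x ^ 2)))
    with (h x * (sum_n (fun n => b n * (sin x ^ 2) ^ n) N - PSeries b (sin x ^ 2))) by ring.
  rewrite Rabs_mult, Rmult_assoc; apply Rmult_le_compat; auto using Rabs_pos.
  unfold PSeries; apply Series_geom_tail; [lra |].
  intros n; rewrite Rabs_mult; assert (Hs := sin2_range x).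
  rewrite <- (Rmult_1_r (C * r ^ n)); apply Rmult_le_compat; auto using Rabs_pos.
  rewrite Rabs_pos_eq by (apply pow_le; lra).
  rewrite <- (pow1 n); apply pow_incr; lra.
Qed.

(** * Moments at an eigenfrequency and their three-term recurrence *)

Section Coefficients.

Variables (k : R) (p m : nat).
Hypothesis hk : 0 < k < 1.
Hypothesis hp : p = 0%nat \/ p = 1%nat.

Let xi := freq k p m.
Let c := wc k p m.
Let s := ws k p m.

Let c_derive : forall x, is_derive c x (- xi * s x / delta k x) := wc_derive k p m hk.
Let s_derive : forall x, is_derive s x (xi * c x / delta k x) := ws_derive k p m hk.
Let c_PI2 : c (PI / 2) = 0 := wc_PI2 k p m hk.
Let cs_1 : forall x, c x ^ 2 + s x ^ 2 = 1 := wcs_1 k p m.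

(* [moment n] is [int c(xi v) sn^(2n+p) v cn v dn v dv] over a quarter period, with [dn v dv = dphi]. *)
Definition moment (n : nat) : R := QInt (hN c (2 * n + p)).

Lemma xi_pos : 0 < xi.
Proof. apply freq_pos, hk. Qed.

Lemma cont_s (x : R) : continuous s x.
Proof. apply (ex_derive_continuous s); eexists; apply s_derive. Qed.

Lemma cont_s_delta (x : R) : continuous (fun x => s x / delta k x) x.
Proof. apply (continuous_Rmult s); [apply cont_s | apply continuous_inv_delta, hk]. Qed.

Lemma cont_hN (j : nat) (x : R) : continuous (hN c j) x.
Proof. eapply continuous_hN; first [exact hk | exact c_derive]. Qed.

Lemma cont_hM (j : nat) (x : R) : continuous (hM k xi s j) x.
Proof. eapply continuous_hM; first [exact hk | exact s_derive]. Qed.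

Lemma hM_moment (j : nat) : QInt (hM k xi s j) = INR (S j) * QInt (hN c j).
Proof.
rewrite (kint_hM_0 k xi c s hk c_derive s_derive c_PI2 j), kint_0; reflexivity.
Qed.

Lemma s_delta_odd : p = 1%nat -> QInt (fun x => s x / delta k x) = 0.
Proof.
intros Hp; assert (Hxi := xi_pos).
rewrite (QInt_derive (fun x => - / xi * c x)).
- rewrite c_PI2; unfold c; rewrite (wc_0_odd k p m Hp); ring.
- intros x; evar_last; [apply is_derive_scal, c_derive |].
  field; split; [apply Rgt_not_eq, delta_pos, hk | lra].
- apply cont_s_delta.
Qed.

(** Integrates the derivative of [s * sin ^ j * cos * delta]. At 0 the boundary term can be nonzero
    only for [j = 0], which is the case the hypothesis covers; there [pred j] is harmless because of
    its coefficient [INR j]. *)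
Lemma sin_ladder (j : nat) : (j = 0%nat -> s 0 = 0) ->
  xi * QInt (hN c j) + INR j * QInt (fun x => s x / delta k x * sin x ^ pred j)
  - (1 + k ^ 2) * INR (S j) * QInt (fun x => s x / delta k x * sin x ^ (j + 1))
  + k ^ 2 * INR (S (S j)) * QInt (fun x => s x / delta k x * sin x ^ (j + 3)) = 0.
Proof.
intros Hs0.
assert (Hc : forall i x, continuous (fun x => s x / delta k x * sin x ^ i) x).
{ intros i x; apply (continuous_Rmult (fun x => s x / delta k x));
    [apply cont_s_delta | apply continuous_Rpow, continuous_sin]. }
assert (HG : forall x, is_derive (fun x => s x * (sin x ^ j * (cos x * delta k x))) x
  (1 * (xi * hN c j x + INR j * (s x / delta k x * sin x ^ pred j)) +
   1 * (- ((1 + k ^ 2) * INR (S j)) * (s x / delta k x * sin x ^ (j + 1))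
     + k ^ 2 * INR (S (S j)) * (s x / delta k x * sin x ^ (j + 3))))).
{ intros x; auto_derive.
  - repeat split; [eexists; apply s_derive | apply ex_derive_delta, hk].
  - Derive_eq (s_derive x); rewrite (Derive_delta k hk x).
    assert (Hd := delta_sqr k hk x).
    assert (Hdx : delta k x <> 0) by (apply Rgt_not_eq, delta_pos, hk).
    assert (Hcs := cos_sqr x).
    unfold hN; rewrite !pow_add, !S_INR.
    destruct j as [|j]; simpl pred.
    + simpl INR; simpl pow in *; field_simplify_eq; [ring [Hd Hcs] | assumption].
    + rewrite S_INR, <- !tech_pow_Rmult.
      field_simplify_eq; [ring [Hd Hcs] | assumption]. }
generalize (QInt_derive _ _ HG); rewrite cos_PI2, sin_0.
assert (HL1 := continuous_lin xi (INR j) _ _ (cont_hN j) (Hc (pred j))).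
assert (HL2 := continuous_lin (- ((1 + k ^ 2) * INR (S j))) (k ^ 2 * INR (S (S j))) _ _
  (Hc (j + 1)%nat) (Hc (j + 3)%nat)).
rewrite QInt_lin by assumption.
rewrite QInt_lin by (apply cont_hN || apply Hc).
rewrite QInt_lin by apply Hc.
intros E.
replace (s 0 * (0 ^ j * (cos 0 * delta k 0))) with 0 in E.
- assert (HL := E (fun x => continuous_lin 1 1 _ _ HL1 HL2 x)); lra.
- destruct j; [rewrite Hs0 by trivial; ring | simpl; ring].
Qed.

Lemma hM_split (j : nat) :
  QInt (hM k xi s j) = xi * QInt (fun x => s x / delta k x * sin x ^ S j).
Proof.
rewrite <- QInt_scal.
- apply QInt_ext; intros x; unfold hM, Rdiv; ring.
- intros x; apply (continuous_Rmult (fun x => s x / delta k x));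
    [apply cont_s_delta | apply continuous_Rpow, continuous_sin].
Qed.

(** [sin_ladder] times [xi]: each integral of [s / delta] against a power of the sine becomes a
    moment through [hM_split] and [hM_moment], and three consecutive moments remain. *)
Lemma moment_recurrence (n : nat) :
  k ^ 2 * (INR (2 * n + p) + 2) * (INR (2 * n + p) + 3) * moment (S n)
  = ((1 + k ^ 2) * (INR (2 * n + p) + 1) ^ 2 - xi ^ 2) * moment n
    - INR (2 * n + p) * (INR (2 * n + p) - 1)
      * match n with 0%nat => 0 | S r => moment r end.
Proof.
assert (Hxi := xi_pos).
assert (E := sin_ladder (2 * n + p)).
assert (E1 := hM_split (2 * n + p)); rewrite hM_moment in E1.
assert (E3 := hM_split (2 * n + p + 2)); rewrite hM_moment in E3.
replace (S (2 * n + p)) with (2 * n + p + 1)%nat in E1 by lia.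
replace (S (2 * n + p + 2)) with (2 * n + p + 3)%nat in E3 by lia.
unfold moment; replace (2 * S n + p)%nat with (2 * n + p + 2)%nat by lia.
assert (Hs : (2 * n + p = 0)%nat -> s 0 = 0).
{ intros H; apply ws_0_even; lia. }
specialize (E Hs).
(* For [n = 0] both sides are 0: for [p = 0] through the factor [INR p], for [p = 1] because
   [s / delta] has integral 0 and [INR p - 1 = 0]. *)
assert (E0 : xi * (INR (2 * n + p) * QInt (fun x => s x / delta k x * sin x ^ pred (2 * n + p)))
  = INR (2 * n + p) * (INR (2 * n + p) - 1)
    * match n with 0%nat => 0 | S r => QInt (hN c (2 * r + p)) end).
{ destruct n as [|n].
  - destruct hp as [Hp | Hp]; rewrite Hp; simpl; [ring |].
    rewrite (QInt_ext _ (fun x => s x / delta k x)) by (intros; ring).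
    rewrite s_delta_odd by assumption; ring.
  - replace (pred (2 * S n + p)) with (S (2 * n + p)) by lia.
    rewrite <- Rmult_assoc, (Rmult_comm xi), Rmult_assoc, <- hM_split, hM_moment.
    replace (2 * S n + p)%nat with (S (S (2 * n + p))) by lia; rewrite !S_INR; ring. }
rewrite <- E0.
rewrite !plus_INR, ?S_INR in *.
replace (INR 1) with 1 in * by trivial; replace (INR 3) with 3 in * by (simpl; ring).
replace (INR 2) with 2 in * by (simpl; ring).
set (I0 := QInt (hN c (2 * n + p))) in *.
set (I2 := QInt (hN c (2 * n + p + 2))) in *.
set (S0 := QInt (fun x => s x / delta k x * sin x ^ pred (2 * n + p))) in *.
set (S1 := QInt (fun x => s x / delta k x * sin x ^ (2 * n + p + 1))) in *.
set (S3 := QInt (fun x => s x / delta k x * sin x ^ (2 * n + p + 3))) in *.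
set (j := INR (2 * n) + INR p) in *.
rewrite plus_INR in E; fold j in E; simpl INR in E1, E3.
assert (A3 : (j + 3) * I2 = xi * S3) by (rewrite <- E3; ring).
assert (A1 : (j + 1) * I0 = xi * S1) by (rewrite <- E1; ring).
assert (A : k ^ 2 * (j + 2) * S3 = (1 + k ^ 2) * (j + 1) * S1 - xi * I0 - j * S0) by lra.
transitivity (k ^ 2 * (j + 2) * ((j + 3) * I2)); [ring |].
rewrite A3; transitivity (xi * (k ^ 2 * (j + 2) * S3)); [ring |].
rewrite A; transitivity ((1 + k ^ 2) * (j + 1) * (xi * S1) - xi ^ 2 * I0 - xi * (j * S0)); [ring |].
rewrite <- A1; ring.
Qed.

Lemma sin_pow_bound (x : R) (n : nat) : Rabs (sin x ^ n) <= 1.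
Proof.
rewrite <- RPow_abs, <- (pow1 n); apply pow_incr; split; [apply Rabs_pos |].
apply Rabs_le, SIN_bound.
Qed.

Lemma c_bound (x : R) : Rabs (c x) <= 1.
Proof. apply Rabs_le, COS_bound. Qed.
Lemma s_bound (x : R) : Rabs (s x) <= 1.
Proof. apply Rabs_le, SIN_bound. Qed.

Lemma hN_bound (j : nat) (x : R) : Rabs (hN c j x) <= 1.
Proof.
unfold hN; rewrite !Rabs_mult.
assert (H1 := c_bound x); assert (H2 := sin_pow_bound x j).
assert (H3 : Rabs (cos x) <= 1) by apply Rabs_le, COS_bound.
assert (P1 := Rabs_pos (c x)); assert (P2 := Rabs_pos (sin x ^ j)); assert (P3 := Rabs_pos (cos x)).
rewrite <- (Rmult_1_l 1); apply Rmult_le_compat; trivial; [nra |].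
rewrite <- (Rmult_1_l 1); apply Rmult_le_compat; trivial.
Qed.

Lemma moment_bound (n : nat) : Rabs (moment n) <= PI / 2.
Proof. rewrite <- (Rmult_1_r (PI / 2)); apply QInt_bound; [apply cont_hN | apply hN_bound]. Qed.

Lemma moment_0 : moment 0 = kint k (hN c p) 0.
Proof. rewrite kint_0; reflexivity. Qed.

Let Kc := Kc k.

Lemma exp_diff_pos : 0 < exp (xi * Kc) - exp (- (xi * Kc)).
Proof.
assert (Hxi := xi_pos).
assert (HK : 0 < Kc) by (apply (ellipticK_pos (kc k)), kc_range, hk).
assert (exp (- (xi * Kc)) < exp (xi * Kc)) by (apply exp_increasing; nra).
lra.
Qed.

(** The integrand oscillates, so the sign is not visible in the definition; it is read off the
    Fourier coefficients of sn and sn^2. All later normalisations divide by this number. *)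
Lemma moment_0_pos : 0 < moment 0.
Proof.
assert (He := exp_diff_pos); assert (Hxi := xi_pos); assert (Hpi := PI_RGT_0).
rewrite moment_0.
apply (Rmult_lt_reg_r (exp (xi * Kc) - exp (- (xi * Kc)))); [assumption |].
rewrite Rmult_0_l.
destruct hp as [Hp | Hp].
- rewrite Hp at 1. 
  generalize (fourier_sn k p m hk Hp); fold xi c Kc; intros ->.
  apply Rdiv_lt_0_compat; nra.
- rewrite Hp at 1.
  generalize (fourier_sn2 k p m hk Hp); fold xi c Kc; intros ->.
  apply Rdiv_lt_0_compat; [apply Rmult_lt_0_compat; nra | nra].
Qed.

(** * Power series in sn^2: norms and eigenvalue sums *)

Definition psi (n : nat) : R := sqrt (INR (2 * n + 1 + p)) * k ^ n * (moment n / moment 0).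

Definition kmom (n : nat) : R := (k ^ 2) ^ n * moment n.

Lemma kmom_bound (n : nat) : Rabs (kmom n) <= PI / 2 * (k ^ 2) ^ n.
Proof.
unfold kmom; rewrite Rabs_mult, Rmult_comm, (Rabs_pos_eq ((k ^ 2) ^ n)) by (apply pow_le; nra).
apply Rmult_le_compat_r; [apply pow_le; nra | apply moment_bound].
Qed.

(** Geometric expansion of [kappa]: the numbers [kmom] are the Taylor coefficients, in sn^2, of the
    generating function found above in closed form. *)
Lemma kmom_PSeries (x : R) : PSeries kmom (sin x ^ 2) = kint k (hN c p) (sin x ^ 2).
Proof.
assert (Hk2 := k2_range k hk); assert (Hs := sin2_range x).
assert (H := series_QInt (fun n => (k ^ 2 * sin x ^ 2) ^ n) (hN c p) 1 1 (k ^ 2) Hk2).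
transitivity (Series (fun n => (k ^ 2 * sin x ^ 2) ^ n * QInt (fun y => hN c p y * sin y ^ (2 * n)))).
- apply Series_ext; intros n; unfold kmom, moment.
  rewrite Rpow_mult_distr, (QInt_ext (fun y => hN c p y * sin y ^ (2 * n)) (hN c (2 * n + p))).
  + ring.
  + intros y; unfold hN; rewrite pow_add; ring.
- transitivity (QInt (fun y => hN c p y * PSeries (fun n => (k ^ 2 * sin x ^ 2) ^ n) (sin y ^ 2))).
  + apply is_series_unique, H.
    * intros n; rewrite Rmult_1_l, Rabs_pos_eq by (apply pow_le; nra); apply pow_incr; nra.
    * apply cont_hN.
    * apply hN_bound.
  + apply QInt_ext; intros y; f_equal; unfold kappa, PSeries.
    assert (Hsy := sin2_range y).
    rewrite <- (Series_geom (k ^ 2 * sin x ^ 2 * sin y ^ 2)).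
    * apply Series_ext; intros n; rewrite !Rpow_mult_distr; reflexivity.
    * rewrite Rabs_pos_eq; [| apply Rmult_le_pos; nra].
      apply Rle_lt_trans with (k ^ 2 * sin x ^ 2); nra.
Qed.

Lemma s_delta_bound (x : R) : Rabs (xi * s x / delta k x) <= xi * / kc k.
Proof.
assert (Hxi := xi_pos); unfold Rdiv; rewrite !Rabs_mult, (Rabs_pos_eq xi) by lra.
rewrite Rmult_assoc; apply Rmult_le_compat_l; [lra |].
rewrite <- (Rmult_1_l (/ kc k)); apply Rmult_le_compat; auto using Rabs_pos, s_bound.
apply inv_delta_bound, hk.
Qed.

Lemma hM_bound (j : nat) (x : R) : Rabs (hM k xi s j x) <= xi * / kc k.
Proof.
unfold hM; rewrite Rabs_mult, <- (Rmult_1_r (xi * / kc k)).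
apply Rmult_le_compat; auto using Rabs_pos, s_delta_bound, sin_pow_bound.
Qed.

Lemma s2_delta : QInt (fun x => s x ^ 2 / delta k x) = ellipticK k / 2.
Proof.
assert (Hxi := xi_pos).
rewrite (QInt_derive (fun x => ellF k x / 2 - s x * c x / (2 * xi))).
- rewrite ellF_PI2, ellF_0, c_PI2.
  destruct hp as [Hp | Hp].
  + unfold s; rewrite (ws_0_even k p m Hp); field; lra.
  + unfold c; rewrite (wc_0_odd k p m Hp); field; lra.
- intros x; auto_derive.
  + repeat split; eexists; [apply (is_derive_ellF k hk) | apply s_derive | apply c_derive].
  + Derive_eq (s_derive x); Derive_eq (c_derive x); Derive_eq (is_derive_ellF k hk x).
    assert (Hdx : delta k x <> 0) by (apply Rgt_not_eq, delta_pos, hk).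
    assert (Hcs := cs_1 x); assert (Hc2 : c x ^ 2 = 1 - s x ^ 2) by lra.
    field_simplify_eq; [ring [Hc2] | split; lra].
- intros x; apply (continuous_Rmult (fun x => s x ^ 2)); [| apply continuous_inv_delta, hk].
  apply continuous_Rpow, cont_s.
Qed.

(** Only one factor of [moment n ^ 2] is kept as a coefficient. The other, times [2 n + 1 + p], is
    by [hM_moment] the integral of [hM p] against [sin ^ (2 n)], so the sum is an integral of the
    generating function. *)
Lemma weighted_norm :
  is_series (fun n => INR (2 * n + 1 + p) * (k ^ 2) ^ n * moment n ^ 2)
    (QInt (fun x => hM k xi s p x * kint k (hN c p) (sin x ^ 2))).
Proof.
assert (Hk2 := k2_range k hk).
assert (H := series_QInt kmom (hM k xi s p) (PI / 2) (xi * / kc k) (k ^ 2) Hk2 kmom_bound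
  (cont_hM p) (hM_bound p)).
rewrite (QInt_ext (fun x => hM k xi s p x * kint k (hN c p) (sin x ^ 2))
    (fun x => hM k xi s p x * PSeries kmom (sin x ^ 2)))
  by (intros x; rewrite kmom_PSeries; trivial).
revert H; apply is_series_ext_R; intros n.
rewrite (QInt_ext (fun x => hM k xi s p x * sin x ^ (2 * n)) (hM k xi s (2 * n + p))).
- rewrite hM_moment; unfold kmom, moment.
  replace (S (2 * n + p)) with (2 * n + 1 + p)%nat by lia; ring.
- intros x; unfold hM; replace (S (2 * n + p)) with (S p + 2 * n)%nat by lia.
  rewrite pow_add; ring.
Qed.

Lemma cont_s2_delta (x : R) : continuous (fun x => s x ^ 2 / delta k x) x.
Proof.
apply (continuous_Rmult (fun x => s x ^ 2)); [| apply continuous_inv_delta, hk].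
apply continuous_Rpow, cont_s.
Qed.

Lemma norm_integral_even : p = 0%nat ->
  QInt (fun x => hM k xi s p x * kint k (hN c p) (sin x ^ 2)) = moment 0 * (ellipticK k / 2).
Proof.
intros Hp; assert (Hxi := xi_pos).
rewrite <- s2_delta, <- QInt_scal by apply cont_s2_delta.
apply QInt_ext; intros x.
generalize (generating_even k xi c s hk c_derive s_derive c_PI2 cs_1
  (ws_0_even k p m Hp) (wc_0_even k p m Hp) x).
rewrite moment_0, Hp; intros E.
unfold hM, Rdiv.
transitivity (s x * / delta k x * (xi * (sin x * kint k (hN c 0) (sin x ^ 2)))); [ring |].
rewrite E; ring.
Qed.

Lemma norm_integral_odd : p = 1%nat ->
  QInt (fun x => hM k xi s p x * kint k (hN c p) (sin x ^ 2)) = moment 0 * (ellipticK k / xi).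
Proof.
intros Hp; assert (Hxi := xi_pos).
transitivity (2 * moment 0 / xi * QInt (fun x => s x / delta k x)
  + 2 * moment 0 / xi * QInt (fun x => s x ^ 2 / delta k x)).
2: rewrite s2_delta, s_delta_odd by assumption; field; lra.
apply QInt_combination; [apply cont_s_delta | apply cont_s2_delta |].
intros x.
generalize (generating_odd k xi c s hk xi_pos c_derive s_derive c_PI2 cs_1
  (ws_0_odd k p m Hp) (wc_0_odd k p m Hp) x).
rewrite moment_0, Hp; intros E.
transitivity (s x / delta k x / xi * (xi ^ 2 * (sin x ^ 2 * kint k (hN c 1) (sin x ^ 2)))).
- unfold hM; field; split; first [lra | apply Rgt_not_eq, delta_pos, hk].
- rewrite E; field; split; first [lra | apply Rgt_not_eq, delta_pos, hk].
Qed.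

(** Up to a constant, the sum in row 0 of the matrix applied to the eigenvector, with Wallis factors
    written as integrals. The generating function reduces the integrand to [sin * s], and an
    integration by parts yields the coefficient of cn. *)
Lemma nu_series_even : p = 0%nat ->
  is_series (fun n => kmom n * QInt (fun x => sin x ^ 2 * sin x ^ (2 * n)))
    (moment 0 * kint k (hNc k c) 0).
Proof.
intros Hp; assert (Hxi := xi_pos); assert (Hk2 := k2_range k hk).
assert (Hc2 : forall x, continuous (fun x => sin x ^ 2) x)
  by (intros; apply continuous_Rpow, continuous_sin).
assert (H := series_QInt kmom (fun x => sin x ^ 2) (PI / 2) 1 (k ^ 2) Hk2 kmom_bound Hc2
  (fun x => sin_pow_bound x 2)).
replace (moment 0 * kint k (hNc k c) 0) with
  (QInt (fun x => sin x ^ 2 * PSeries kmom (sin x ^ 2))); [exact H |].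
rewrite (QInt_ext _ (fun x => moment 0 / xi * (sin x * s x))).
- assert (Hcs : forall x, continuous (fun x => sin x * s x) x).
  { intros x; apply (continuous_Rmult sin s); [apply continuous_sin |].
    apply cont_s. }
  assert (HcN : forall x, continuous (hNc k c) x).
  { intros x; eapply continuous_hNc; first [exact hk | exact c_derive]. }
  rewrite QInt_scal by exact Hcs.
  assert (HI : 1 * QInt (fun x => sin x * s x) + - xi * QInt (hNc k c) = 0).
  { rewrite <- QInt_lin by assumption.
    rewrite (QInt_derive (fun x => - cos x * s x)).
    - rewrite cos_PI2; unfold s; rewrite (ws_0_even k p m Hp); ring.
    - intros x; auto_derive; [repeat split; eexists; apply s_derive |].
      Derive_eq (s_derive x); unfold hNc, Rdiv; ring.
    - intros x; apply (continuous_lin 1 (- xi)); assumption. }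
  rewrite kint_0; assert (HI' : QInt (fun x => sin x * s x) = xi * QInt (hNc k c)) by lra.
  rewrite HI'; field; lra.
- intros x; rewrite kmom_PSeries.
  generalize (generating_even k xi c s hk c_derive s_derive c_PI2 cs_1
    (ws_0_even k p m Hp) (wc_0_even k p m Hp) x).
  rewrite moment_0, Hp; intros E.
  transitivity (sin x / xi * (xi * (sin x * kint k (hN c 0) (sin x ^ 2)))); [field; lra |].
  rewrite E; field; lra.
Qed.

(** The weight is chosen because [2 W (n + 2) - W (n + 1) = (2 n + 2) / (2 n + 4) * W (n + 1)] for
    Wallis integrals [W], the right side being what row 0 contains. The constant part of the
    generating function integrates to 0, and [ode_dn2] at [z = 0] turns the rest into the
    coefficient of dn. *)
Lemma nu_series_odd : p = 1%nat ->
  is_series (fun n => kmom n * QInt (fun x => (2 * sin x ^ 2 - 1) * sin x ^ 2 * sin x ^ (2 * n)))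
    (moment 0 * (2 / k ^ 2 * kint k (hNd s) 0)).
Proof.
intros Hp; assert (Hxi := xi_pos); assert (Hk2 := k2_range k hk).
assert (Hc1 : forall x, continuous (fun x => 2 * sin x ^ 2 - 1) x).
{ intros x; apply (ex_derive_continuous (fun x => 2 * sin x ^ 2 - 1)); auto_derive; trivial. }
assert (Hc2 : forall x, continuous (fun x => (2 * sin x ^ 2 - 1) * sin x ^ 2) x).
{ intros x; apply continuous_Rmult; [apply Hc1 | apply continuous_Rpow, continuous_sin]. }
assert (H := series_QInt kmom (fun x => (2 * sin x ^ 2 - 1) * sin x ^ 2) (PI / 2) 1 (k ^ 2) Hk2
  kmom_bound Hc2).
replace (moment 0 * (2 / k ^ 2 * kint k (hNd s) 0)) with
  (QInt (fun x => (2 * sin x ^ 2 - 1) * sin x ^ 2 * PSeries kmom (sin x ^ 2))).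
{ apply H; intros x; generalize (sin x ^ 2) (sin2_range x); intros y Hy; apply Rabs_le; nra. }
clear H.
assert (Hcs : forall x, continuous (fun x => (2 * sin x ^ 2 - 1) * s x) x).
{ intros x; apply continuous_Rmult; [apply Hc1 |].
  apply cont_s. }
assert (HcM : forall x, continuous (hMd k c) x).
{ intros x; eapply continuous_hMd; first [exact hk | exact c_derive]. }
transitivity (2 * moment 0 / xi ^ 2 * QInt (fun x => 2 * sin x ^ 2 - 1)
  + 2 * moment 0 / xi ^ 2 * QInt (fun x => (2 * sin x ^ 2 - 1) * s x)).
- apply QInt_combination; [exact Hc1 | exact Hcs |].
  intros x; rewrite kmom_PSeries.
  generalize (generating_odd k xi c s hk xi_pos c_derive s_derive c_PI2 cs_1
    (ws_0_odd k p m Hp) (wc_0_odd k p m Hp) x).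
  rewrite moment_0, Hp; intros E.
  transitivity ((2 * sin x ^ 2 - 1) / xi ^ 2 * (xi ^ 2 * (sin x ^ 2 * kint k (hN c 1) (sin x ^ 2))));
    [field; lra |].
  rewrite E; field; lra.
- rewrite (QInt_derive (fun x => - sin x * cos x)); [| | exact Hc1].
  2: { intros x; auto_derive; trivial.
       generalize (sin2_cos2 x); unfold Rsqr; intros; nra. }
  rewrite cos_PI2, sin_0.
  assert (HI : 1 * QInt (fun x => (2 * sin x ^ 2 - 1) * s x) + - xi * QInt (hMd k c) = 0).
  { rewrite <- QInt_lin by assumption.
    rewrite (QInt_derive (fun x => - (sin x * cos x) * s x)).
    - rewrite cos_PI2, sin_0; ring.
    - intros x; auto_derive; [repeat split; eexists; apply s_derive |].
      Derive_eq (s_derive x); unfold hMd.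
      assert (Hcos := cos_sqr x).
      field_simplify_eq; [ring [Hcos] | apply Rgt_not_eq, delta_pos, hk].
    - intros x; apply (continuous_lin 1 (- xi)); assumption. }
  assert (HI' : QInt (fun x => (2 * sin x ^ 2 - 1) * s x) = xi * QInt (hMd k c)) by lra.
  generalize (ode_dn2 k xi c s hk c_derive s_derive c_PI2 0).
  rewrite !kint_0; intros HMd.
  assert (HMd' : k ^ 2 * QInt (hMd k c) = xi * QInt (hNd s)).
  { rewrite <- HMd; [ring | rewrite Rmult_0_r; lra | apply (wc_0_odd k p m Hp)]. }
  rewrite HI'; transitivity (2 * moment 0 / xi / k ^ 2 * (k ^ 2 * QInt (hMd k c))); [field; lra |].
  rewrite HMd'; field; lra.
Qed.

Lemma orthogonal_moment (P : nat -> R) : P 0%nat = 1 ->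
  (forall n, P (S n) = (- xi ^ 2 + (k ^ 2 + 1) * (INR (2 * n + p) + 1) ^ 2) * P n
     - k ^ 2 * (INR (2 * n + p) - 1) * INR (2 * n + p) ^ 2 * (INR (2 * n + p) + 1)
       * match n with 0%nat => 0 | S r => P r end) ->
  forall n, INR (p + 1) * (P n * moment 0)
    = (k ^ 2) ^ n * INR (fact (2 * n + p + 1)) * moment n.
Proof.
intros P0 PS n.
assert (Hf0 : INR (fact (p + 1)) = INR (p + 1)) by (destruct hp as [-> | ->]; reflexivity).
assert (HF : forall i, INR (fact (2 * S i + p + 1)) =
  (INR (2 * i + p) + 3) * (INR (2 * i + p) + 2) * INR (fact (2 * i + p + 1))).
{ intros i; replace (2 * S i + p + 1)%nat with (S (S (2 * i + p + 1))) by lia.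
  rewrite !fact_simpl, !mult_INR, !S_INR, (plus_INR (2 * i + p) 1); simpl (INR 1); ring. }
assert (HJ : forall i, INR (2 * S i + p) = INR (2 * i + p) + 2).
{ intros i; replace (2 * S i + p)%nat with (2 * i + p + 2)%nat by lia; apply plus_INR. }
cut (INR (p + 1) * (P n * moment 0) = (k ^ 2) ^ n * INR (fact (2 * n + p + 1)) * moment n /\
  INR (p + 1) * (P (S n) * moment 0)
    = (k ^ 2) ^ (S n) * INR (fact (2 * S n + p + 1)) * moment (S n)); [tauto |].
induction n as [|n [IH1 IH2]].
- assert (E := moment_recurrence 0); rewrite PS, P0, HF.
  change (2 * 0 + p + 1)%nat with (p + 1)%nat; rewrite Hf0, pow_O, pow_1.
  set (J := INR (2 * 0 + p)) in *; split; [ring |].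
  transitivity (INR (p + 1) * (k ^ 2 * (J + 2) * (J + 3) * moment 1)); [rewrite E; ring | ring].
- split; [exact IH2 |].
  assert (E := moment_recurrence (S n)).
  rewrite PS, HF, <- (tech_pow_Rmult _ (S n)).
  set (J := INR (2 * S n + p)) in *.
  transitivity ((- xi ^ 2 + (k ^ 2 + 1) * (J + 1) ^ 2) * (INR (p + 1) * (P (S n) * moment 0))
      - k ^ 2 * (J - 1) * J ^ 2 * (J + 1) * (INR (p + 1) * (P n * moment 0))); [ring |].
  rewrite IH1, IH2, <- !(tech_pow_Rmult (k ^ 2) n), HF.
  replace (INR (2 * n + p)) with (J - 2) by (unfold J; rewrite HJ; ring).
  set (F := INR (fact (2 * n + p + 1))); set (q := (k ^ 2) ^ n).
  transitivity (k ^ 2 * q * (J + 1) * J * F * (k ^ 2 * (J + 2) * (J + 3) * moment (S (S n))));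
    [rewrite E; ring | ring].
Qed.

Lemma SC_f_moment (n : nat) : p = 0%nat ->
  SC_f k n (- xi ^ 2) * moment 0 = (k ^ 2) ^ n * INR (fact (2 * n + 1)) * moment n.
Proof.
intros Hp; generalize (orthogonal_moment (fun n => SC_f k n (- xi ^ 2)) eq_refl).
rewrite Hp; intros H; rewrite <- (Nat.add_0_r (2 * n)), <- H.
- simpl (INR (0 + 1)); ring.
- intros i; rewrite Nat.add_0_r, mult_INR; destruct i; reflexivity.
Qed.

Lemma SC_g_moment (n : nat) : p = 1%nat ->
  2 * (SC_g k n (- xi ^ 2) * moment 0) = (k ^ 2) ^ n * INR (fact (2 * n + 2)) * moment n.
Proof.
intros Hp; generalize (orthogonal_moment (fun n => SC_g k n (- xi ^ 2)) eq_refl).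
rewrite Hp; intros H; replace (2 * n + 2)%nat with (2 * n + 1 + 1)%nat by lia.
rewrite <- H; [simpl (INR (1 + 1)); ring |].
intros i; rewrite plus_INR, mult_INR; simpl (INR 2); simpl (INR 1).
destruct i; simpl; ring.
Qed.

End Coefficients.

(** * The matrices commute with the Jacobi recurrence *)

Definition wallis (n : nat) : R := QInt (fun x => sin x ^ (2 * n)).

Lemma continuous_sin_pow (n : nat) (x : R) : continuous (fun x => sin x ^ n) x.
Proof. apply continuous_Rpow, continuous_sin. Qed.

Lemma wallis_0 : wallis 0 = PI / 2.
Proof.
unfold wallis; rewrite (QInt_derive (fun x => x)); [ring | |].
- intros x; simpl; auto_derive; trivial.
- apply continuous_sin_pow.
Qed.

Lemma wallis_S (n : nat) : (2 * INR n + 2) * wallis (S n) = (2 * INR n + 1) * wallis n.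
Proof.
assert (E : (2 * INR n + 1) * wallis n + - (2 * INR n + 2) * wallis (S n) = 0); [| lra].
unfold wallis; rewrite <- QInt_lin by apply continuous_sin_pow.
rewrite (QInt_derive (fun x => sin x ^ (2 * n + 1) * cos x)).
- rewrite cos_PI2, sin_0, pow_i by lia; ring.
- intros x; replace (2 * S n)%nat with (2 * n + 2)%nat by lia.
  replace (2 * INR n) with (INR (2 * n)) by (rewrite mult_INR; trivial).
  generalize (2 * n)%nat; intros e; auto_derive; trivial.
  replace (pred (e + 1)) with e by lia.
  rewrite !pow_add, plus_INR; simpl INR.
  assert (Hc := cos_sqr x).
  ring [Hc].
- apply continuous_lin; apply continuous_sin_pow.
Qed.

Lemma wallis_bound (n : nat) : 0 < wallis n <= PI / 2.
Proof.
assert (Hpi := PI_RGT_0); induction n as [|n IH]; [rewrite wallis_0; lra |].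
assert (E := wallis_S n); assert (Hn := pos_INR n); split; nra.
Qed.

Definition cbin (p n : nat) : R := Binomial.C (2 * n + p) n / 4 ^ n.

Lemma cbin_even (n : nat) : cbin 0 n = 2 / PI * wallis n.
Proof.
assert (Hpi := PI_RGT_0).
induction n as [|n IH].
- rewrite wallis_0; unfold cbin, Binomial.C; simpl; field; lra.
- assert (Hn := pos_INR n).
  assert (E := wallis_S n).
  assert (EW : wallis (S n) = (2 * INR n + 1) / (2 * INR n + 2) * wallis n).
  { apply (Rmult_eq_reg_l (2 * INR n + 2)); [| lra]. rewrite E; field; lra. }
  rewrite EW.
  replace (2 / PI * ((2 * INR n + 1) / (2 * INR n + 2) * wallis n)) with
    ((2 * INR n + 1) / (2 * INR n + 2) * (2 / PI * wallis n)) by ring.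
  rewrite <- IH; unfold cbin, Binomial.C.
  replace (2 * S n + 0 - S n)%nat with (S n) by lia.
  replace (2 * n + 0 - n)%nat with n by lia.
  replace (2 * S n + 0)%nat with (S (S (2 * n))) by lia.
  replace (2 * n + 0)%nat with (2 * n)%nat by lia.
  rewrite !fact_simpl, !mult_INR, !S_INR, mult_INR, <- tech_pow_Rmult; simpl (INR 2).
  field; repeat split; try lra; try (apply pow_nonzero; lra); apply INR_fact_neq_0.
Qed.

Lemma cbin_odd (n : nat) : cbin 1 n = 4 / PI * wallis (S n).
Proof.
assert (Hn := pos_INR n); assert (Hpi := PI_RGT_0).
transitivity (2 * cbin 0 (S n)); [| rewrite cbin_even; field; lra].
unfold cbin, Binomial.C.
replace (2 * S n + 0 - S n)%nat with (S n) by lia.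
replace (2 * n + 1 - n)%nat with (S n) by lia.
replace (2 * S n + 0)%nat with (S (2 * n + 1)) by lia.
rewrite !fact_simpl, !mult_INR, !S_INR, plus_INR, mult_INR, <- tech_pow_Rmult; simpl.
field; repeat split; try lra; try (apply pow_nonzero; lra); apply INR_fact_neq_0.
Qed.

Lemma cbin_bound (p n : nat) : p = 0%nat \/ p = 1%nat -> 0 < cbin p n <= 2.
Proof.
assert (Hpi := PI_RGT_0).
intros [-> | ->]; [rewrite cbin_even | rewrite cbin_odd].
- assert (Hw := wallis_bound n); split.
  + apply Rmult_lt_0_compat; [apply Rdiv_lt_0_compat |]; lra.
  + apply (Rmult_le_reg_l PI); [assumption |].
    replace (PI * (2 / PI * wallis n)) with (2 * wallis n) by (field; lra); lra.
- assert (Hw := wallis_bound (S n)); split.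
  + apply Rmult_lt_0_compat; [apply Rdiv_lt_0_compat |]; lra.
  + apply (Rmult_le_reg_l PI); [assumption |].
    replace (PI * (4 / PI * wallis (S n))) with (4 * wallis (S n)) by (field; lra); lra.
Qed.

(** Ratios of consecutive [cbin] in terms of [t = 2 n + 1 + p]. The factors that accompany them in
    [cbin_ratio] are those of the outer terms of the moment recurrence. *)
Definition cbinA (p : nat) (t : R) : R := match p with O => t * (t + 2) | _ => (t + 1) ^ 2 end.
Definition cbinB (p : nat) (t : R) : R := match p with O => (t - 1) ^ 2 | _ => t * (t - 2) end.

Lemma cbin_ratio (p n : nat) : p = 0%nat \/ p = 1%nat ->
  (INR (2 * n + 1 + p) + 1) * (INR (2 * n + 1 + p) + 2) * cbin p (S n)
  = cbinA p (INR (2 * n + 1 + p)) * cbin p n /\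
  INR (2 * n + 1 + p) * (INR (2 * n + 1 + p) + 1) * cbin p n
  = cbinB p (INR (2 * n + 1 + p) + 2) * cbin p (S n).
Proof.
assert (Hn := pos_INR n).
intros [-> | ->]; rewrite !plus_INR, mult_INR; simpl INR; unfold cbinA, cbinB.
- rewrite !cbin_even; assert (E := wallis_S n); split.
  + transitivity (2 / PI * (2 * INR n + 3) * ((2 * INR n + 2) * wallis (S n))); [ring |].
    rewrite E; ring.
  + transitivity (2 / PI * (2 * INR n + 2) * ((2 * INR n + 1) * wallis n)); [ring |].
    rewrite <- E; ring.
- rewrite !cbin_odd; assert (E := wallis_S (S n)); rewrite S_INR in E; split.
  + transitivity (4 / PI * (2 * INR n + 3) * ((2 * (INR n + 1) + 2) * wallis (S (S n)))); [ring |].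
    rewrite E; ring.
  + transitivity (4 / PI * (2 * INR n + 2) * ((2 * (INR n + 1) + 1) * wallis (S n))); [ring |].
    rewrite <- E; ring.
Qed.

(** The algebraic reason for the commutation: the difference contains the shifted Cauchy denominator
    [t + u + 2], and in [cbinB_diff] it is [t + u - 2], so that only [t - u] remains after
    division. *)
Lemma cbinA_diff (p : nat) (t u : R) : cbinA p t - cbinA p u = (t - u) * (t + u + 2).
Proof. destruct p; unfold cbinA; ring. Qed.

Lemma cbinB_diff (p : nat) (t u : R) : cbinB p t - cbinB p u = (t - u) * (t + u - 2).
Proof. destruct p; unfold cbinB; ring. Qed.

Lemma cbinB_start (p : nat) : p = 0%nat \/ p = 1%nat -> cbinB p (INR (2 * 0 + 1 + p)) = 0.
Proof. intros [-> | ->]; unfold cbinB; simpl; ring. Qed.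

Lemma cbinA_bound (p : nat) (t u : R) : 1 <= t -> 1 <= u ->
  Rabs (cbinA p u) <= (u + 3) * (t + u + 2).
Proof. intros Ht Hu; unfold cbinA; destruct p; rewrite Rabs_pos_eq; nra. Qed.

Lemma cbinB_bound (p : nat) (t u : R) : 1 <= t -> 1 <= u ->
  Rabs (cbinB p (u + 2)) <= (u + 2 + 3) * (t + u).
Proof. intros Ht Hu; unfold cbinB; destruct p; rewrite Rabs_pos_eq; nra. Qed.

(** Bernoulli's inequality for [/ r]. *)
Lemma linear_geom (r : R) (n : nat) : 0 < r < 1 -> INR n * r ^ n <= r / (1 - r).
Proof.
intros Hr.
assert (Hx : 0 < / r - 1).
{ assert (1 < / r) by (rewrite <- Rinv_1; apply Rinv_lt_contravar; lra); lra. }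
assert (H := poly n (/ r - 1) Hx).
replace (1 + (/ r - 1)) with (/ r) in H by ring.
assert (Hrn : 0 < r ^ n) by (apply pow_lt; lra).
apply (Rmult_le_compat_r (r ^ n)) in H; [| lra].
rewrite pow_inv, Rinv_l in H by lra.
apply (Rmult_le_reg_r (/ r - 1)); [assumption |].
replace (r / (1 - r) * (/ r - 1)) with 1 by (field; lra).
nra.
Qed.

Section Eigen.

Variables (k : R) (p m : nat).
Hypothesis hk : 0 < k < 1.
Hypothesis hp : p = 0%nat \/ p = 1%nat.

Let jj (n : nat) : R := INR (2 * n + 1 + p).
Let M := moment k p m.
Let lam := freq k p m ^ 2.

(** Apart from the Cauchy denominator and constants, a summand of a matrix row against the
    eigenvector: matrix and vector each contribute [sqrt (2 n + 1 + p) * k ^ n]. *)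
Definition hweight (n : nat) : R := cbin p n * kmom k p m n * INR (2 * n + 1 + p).

Lemma jj_S (n : nat) : jj (S n) = jj n + 2.
Proof. unfold jj; replace (2 * S n + 1 + p)%nat with (2 * n + 1 + p + 2)%nat by lia; rewrite plus_INR; trivial. Qed.

Lemma jj_pos (n : nat) : 1 <= jj n.
Proof. unfold jj; rewrite !plus_INR, mult_INR; generalize (pos_INR n) (pos_INR p); simpl; lra. Qed.

Lemma M_rec (n : nat) :
  k ^ 2 * (jj n + 1) * (jj n + 2) * M (S n)
  = ((1 + k ^ 2) * jj n ^ 2 - lam) * M n
    - (jj n - 1) * (jj n - 2) * match n with 0%nat => 0 | S r => M r end.
Proof.
generalize (moment_recurrence k p m hk hp n); fold M lam.
replace (INR (2 * n + p)) with (jj n - 1); [intros E |].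
- replace (jj n - 1 + 2) with (jj n + 1) in E by ring.
  replace (jj n - 1 + 3) with (jj n + 2) in E by ring.
  replace (jj n - 1 + 1) with (jj n) in E by ring.
  replace (jj n - 1 - 1) with (jj n - 2) in E by ring.
  exact E.
- unfold jj; rewrite !plus_INR; simpl; ring.
Qed.

(** The moment recurrence in adjoint form: the coefficients sit at the neighbouring indices, as
    summation by parts requires. *)
Lemma hweight_rec (n : nat) :
  lam * hweight n = (1 + k ^ 2) * jj n ^ 2 * hweight n - cbinB p (jj (S n)) * hweight (S n)
    - k ^ 2 * match n with 0%nat => 0 | S r => cbinA p (jj r) * hweight r end.
Proof.
assert (Hk := proj1 hk).
assert (HB : cbinB p (jj (S n)) * hweight (S n) =
  cbin p n * (k ^ 2) ^ n * jj n * (k ^ 2 * (jj n + 1) * (jj n + 2) * M (S n))).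
{ destruct (cbin_ratio p n hp) as [_ E]; fold (jj n) in E.
  unfold hweight, kmom; fold M (jj (S n)); rewrite jj_S, <- (tech_pow_Rmult (k ^ 2)).
  transitivity (cbinB p (jj n + 2) * cbin p (S n) * (k ^ 2 * (k ^ 2) ^ n) * M (S n) * (jj n + 2));
    [ring |].
  rewrite <- E; ring. }
assert (HA : k ^ 2 * match n with 0%nat => 0 | S r => cbinA p (jj r) * hweight r end =
  cbin p n * (k ^ 2) ^ n * jj n * ((jj n - 1) * (jj n - 2) * match n with 0%nat => 0 | S r => M r end)).
{ destruct n as [|r]; [ring |].
  destruct (cbin_ratio p r hp) as [E _]; fold (jj r) in E.
  unfold hweight, kmom; fold M (jj r); rewrite jj_S, <- (tech_pow_Rmult (k ^ 2)).
  transitivity (k ^ 2 * (cbinA p (jj r) * cbin p r) * (k ^ 2) ^ r * M r * jj r); [ring |].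
  rewrite <- E; ring. }
rewrite HB, HA, M_rec; unfold hweight, kmom; fold M (jj n); ring.
Qed.

(** With [r = sqrt k], [(k ^ 2) ^ n = (r ^ n) ^ 2 * k ^ n]: the two factors [r ^ n] absorb the two
    linear factors in [jj n], and [k ^ n] is left as rate. *)
Lemma hweight_bound : exists C, forall n, (jj n + 3) * Rabs (hweight n) <= C * k ^ n.
Proof.
assert (Hpi := PI_RGT_0).
set (r := sqrt k).
assert (Hr2 : r ^ 2 = k) by (apply pow2_sqrt; lra).
assert (Hr : 0 < r < 1).
{ assert (0 < r) by (apply sqrt_lt_R0; lra); nra. }
set (C1 := 2 * (r / (1 - r)) + 5).
assert (HC1 : forall n, (jj n + 3) * r ^ n <= C1).
{ intros n; assert (H := linear_geom r n Hr).
  assert (Hrn : 0 < r ^ n) by (apply pow_lt; lra).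
  assert (Hrn1 : r ^ n <= 1) by (rewrite <- (pow1 n); apply pow_incr; lra).
  assert (Hj : jj n + 3 <= 2 * INR n + 5).
  { unfold jj; rewrite !plus_INR, mult_INR; destruct hp as [-> | ->]; simpl; lra. }
  assert (Hn := pos_INR n); unfold C1; nra. }
exists (PI * C1 ^ 2); intros n.
assert (Hj := jj_pos n); assert (Hc := cbin_bound p n hp).
unfold hweight; fold (jj n).
rewrite !Rabs_mult, (Rabs_pos_eq (cbin p n)), (Rabs_pos_eq (jj n)) by lra.
assert (Hkm := kmom_bound k p m hk n); assert (HC := HC1 n).
assert (Hq : (k ^ 2) ^ n = (r ^ n) ^ 2 * k ^ n).
{ rewrite <- Hr2, <- !pow_mult, <- pow_add; f_equal; lia. }
rewrite Hq in Hkm.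
assert (Hrn : 0 < r ^ n) by (apply pow_lt; lra).
assert (Hkn : 0 < k ^ n) by (apply pow_lt; lra).
assert (H0 := Rabs_pos (kmom k p m n)).
apply Rle_trans with ((jj n + 3) * (2 * (PI / 2 * ((r ^ n) ^ 2 * k ^ n)) * (jj n + 3))).
- apply Rmult_le_compat_l; [lra |].
  apply Rmult_le_compat; [apply Rmult_le_pos; lra | lra | | lra].
  apply Rmult_le_compat; lra.
- replace ((jj n + 3) * (2 * (PI / 2 * ((r ^ n) ^ 2 * k ^ n)) * (jj n + 3))) with
    (PI * ((jj n + 3) * r ^ n) ^ 2 * k ^ n) by field.
  apply Rmult_le_compat_r; [lra |]; apply Rmult_le_compat_l; [lra |].
  apply pow_incr; split; [| assumption]; apply Rmult_le_pos; lra.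
Qed.

Lemma ex_series_hweight (t : R) : 0 <= t -> ex_series (fun n => hweight n / (t + jj n)).
Proof.
intros Ht; destruct hweight_bound as [C HC].
apply (ex_series_geom_bound _ C k); [lra |].
intros n; assert (Hj := jj_pos n); eapply Rle_trans; [| apply HC].
unfold Rdiv; rewrite Rabs_mult, (Rmult_comm (jj n + 3)).
apply Rmult_le_compat_l; [apply Rabs_pos |].
rewrite Rabs_pos_eq by (left; apply Rinv_0_lt_compat; lra).
apply Rle_trans with 1; [| lra].
rewrite <- Rinv_1; apply Rinv_le_contravar; lra.
Qed.

Definition hsum (i : nat) : R := Series (fun n => hweight n / (jj i + jj n)).

(** The commutation itself. The combination [T] of three rows becomes, by [hweight_rec] and the
    difference formulas, a difference of boundary terms; its partial sums collapse to [Hsum] and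
    tend to 0 geometrically. *)
Lemma hsum_rec (i : nat) :
  k ^ 2 * cbinA p (jj i) * hsum (S i)
  = ((1 + k ^ 2) * jj i ^ 2 - lam) * hsum i
    - cbinB p (jj i) * match i with 0%nat => 0 | S r => hsum r end.
Proof.
set (J := jj i).
set (low := fun n => match i with 0%nat => 0 | S r => hweight n / (jj r + jj n) end).
assert (Hi := jj_pos i); fold J in Hi.
assert (HlowS : match i with 0%nat => 0 | S r => hsum r end = Series low).
{ unfold low; destruct i; [| reflexivity].
  assert (H := Series_scal_l 0 (fun _ => 0)).
  rewrite (Series_ext _ (fun _ => 0)) in H by (intros; ring); lra. }
assert (Hlow_ex : ex_series low).
{ unfold low; destruct i.
  - apply (ex_series_geom_bound _ 0 0); [lra |]; intros; rewrite Rabs_R0; lra.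
  - apply ex_series_hweight; generalize (jj_pos i); lra. }
set (T := fun n => k ^ 2 * cbinA p J * (hweight n / (J + 2 + jj n))
  + (- ((1 + k ^ 2) * J ^ 2 - lam) * (hweight n / (J + jj n)) + cbinB p J * low n)).
assert (Hsum : forall N, sum_n T N = k ^ 2 * cbinA p (jj N) * hweight N / (J + jj N + 2)
  - cbinB p (jj (S N)) * hweight (S N) / (J + jj N)).
{ assert (Hterm : forall n, T n =
    (cbinB p (jj n) * hweight n / (J + jj n - 2) - cbinB p (jj (S n)) * hweight (S n) / (J + jj n))
    + (k ^ 2 * cbinA p (jj n) * hweight n / (J + jj n + 2)
      - k ^ 2 * match n with 0%nat => 0 | S r => cbinA p (jj r) * hweight r end / (J + jj n))).
  { intros n; assert (Hn := jj_pos n).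
    assert (E := hweight_rec n).
    assert (Hl : cbinB p J * low n - cbinB p (jj n) * hweight n / (J + jj n - 2)
      = (J - jj n) * hweight n).
    (* The denominator vanishes exactly for [p = 0] and [i = n = 0]. There [cbinB 0 1 = 0] removes
       both terms, whatever value the quotient has. *)
    { destruct (Req_dec (J + jj n - 2) 0) as [E0 | E0].
      - assert (Hp0 : p = 0%nat).
        { destruct hp as [Hp | Hp]; trivial; exfalso.
          generalize (pos_INR i) (pos_INR n); revert E0; unfold J, jj.
          rewrite Hp, !plus_INR, !mult_INR; simpl; lra. }
        assert (HJ1 : J = 1) by lra; assert (Hj1 : jj n = 1) by lra.
        rewrite Hp0, HJ1, Hj1; unfold cbinB, Rdiv; ring.
      - assert (HB : cbinB p J - cbinB p (jj n) = (J - jj n) * (J + jj n - 2)) by apply cbinB_diff.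
        assert (Hlow : cbinB p J * low n = cbinB p J * (hweight n / (J + jj n - 2))).
        { unfold low; subst J; destruct i as [|r].
          - assert (B0 : cbinB p (jj 0) = 0) by apply cbinB_start, hp; rewrite B0; ring.
          - rewrite jj_S; f_equal; f_equal; ring. }
        rewrite Hlow; transitivity ((cbinB p J - cbinB p (jj n)) * hweight n / (J + jj n - 2));
          [field; assumption |].
        rewrite HB; field; assumption. }
    assert (HA : cbinA p J - cbinA p (jj n) = (J - jj n) * (J + jj n + 2)) by apply cbinA_diff.
    assert (HA' : k ^ 2 * cbinA p J * (hweight n / (J + 2 + jj n))
      - k ^ 2 * cbinA p (jj n) * hweight n / (J + jj n + 2) = k ^ 2 * (J - jj n) * hweight n).
    { transitivity (k ^ 2 * (cbinA p J - cbinA p (jj n)) * hweight n / (J + jj n + 2));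
        [field; lra |].
      rewrite HA; field; lra. }
    assert (HE : lam * hweight n / (J + jj n) = (1 + k ^ 2) * jj n ^ 2 * hweight n / (J + jj n)
      - cbinB p (jj (S n)) * hweight (S n) / (J + jj n)
      - k ^ 2 * match n with 0%nat => 0 | S r => cbinA p (jj r) * hweight r end / (J + jj n)).
    { rewrite E; field; lra. }
    assert (HJ : - ((1 + k ^ 2) * J ^ 2 - lam) * (hweight n / (J + jj n)) =
      - (1 + k ^ 2) * (J - jj n) * hweight n - (1 + k ^ 2) * jj n ^ 2 * hweight n / (J + jj n)
      + lam * hweight n / (J + jj n)) by (field; lra).
    unfold T; rewrite HJ, HE; lra. }
  induction N as [|N IH].
  - rewrite sum_O, Hterm.
    replace (cbinB p (jj 0)) with 0 by (symmetry; apply cbinB_start, hp).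
    match goal with |- ?a = ?b => change (@eq R a b) end.
    unfold Rdiv; ring.
  - transitivity (sum_n T N + T (S N)); [exact (sum_Sn T N) |].
    rewrite IH, Hterm.
    rewrite (jj_S N); replace (J + (jj N + 2) - 2) with (J + jj N) by ring.
    replace (J + (jj N + 2)) with (J + jj N + 2) by ring.
    match goal with |- ?a = ?b => change (@eq R a b) end.
    unfold Rdiv; ring. }
assert (HT0 : is_series T 0).
{ destruct hweight_bound as [C HC].
  assert (HC0 : 0 <= C).
  { generalize (HC 0%nat) (Rabs_pos (hweight 0)) (jj_pos 0); simpl; nra. }
  assert (HAB : forall n, Rabs (cbinA p (jj n)) <= (jj n + 3) * (J + jj n + 2) /\
     Rabs (cbinB p (jj (S n))) <= (jj (S n) + 3) * (J + jj n)).
  { intros n; rewrite jj_S; split; [apply cbinA_bound | apply cbinB_bound]; auto using jj_pos. }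
  apply (is_series_geom_rate _ _ (2 * C) k); [lra |].
  intros N; rewrite Hsum, Rminus_0_r.
  assert (Hn := jj_pos N); fold J in Hi.
  destruct (HAB N) as [HA HB].
  assert (H1 : Rabs (k ^ 2 * cbinA p (jj N) * hweight N / (J + jj N + 2)) <= C * k ^ N).
  { eapply Rle_trans; [| apply (HC N)].
    unfold Rdiv; rewrite !Rabs_mult, (Rabs_pos_eq (/ _)) by (left; apply Rinv_0_lt_compat; lra).
    rewrite (Rabs_pos_eq (k ^ 2)) by nra.
    apply (Rmult_le_reg_r (J + jj N + 2)); [lra |].
    rewrite !Rmult_assoc, Rinv_l, Rmult_1_r by lra.
    assert (P1 := Rabs_pos (cbinA p (jj N))); assert (P2 := Rabs_pos (hweight N)).
    assert (Hk2 := k2_range k hk).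
    apply Rle_trans with (1 * ((jj N + 3) * (J + jj N + 2) * Rabs (hweight N))); [| right; ring].
    apply Rmult_le_compat; [lra | apply Rmult_le_pos; assumption | lra |].
    apply Rmult_le_compat_r; assumption. }
  assert (H2 : Rabs (cbinB p (jj (S N)) * hweight (S N) / (J + jj N)) <= C * k ^ N).
  { eapply Rle_trans; [eapply Rle_trans; [| apply (HC (S N))] |].
    - unfold Rdiv; rewrite !Rabs_mult, (Rabs_pos_eq (/ _)) by (left; apply Rinv_0_lt_compat; lra).
      apply (Rmult_le_reg_r (J + jj N)); [lra |].
      rewrite !Rmult_assoc, Rinv_l, Rmult_1_r by lra.
      assert (P2 := Rabs_pos (hweight (S N))).
      apply Rle_trans with ((jj (S N) + 3) * (J + jj N) * Rabs (hweight (S N))); [| right; ring].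
      apply Rmult_le_compat_r; assumption.
    - rewrite <- tech_pow_Rmult; assert (0 < k ^ N) by (apply pow_lt; lra).
      apply Rmult_le_compat_l; [assumption | nra]. }
  eapply Rle_trans; [apply Rabs_triang |]; rewrite Rabs_Ropp; lra. }
assert (HS : Series T = k ^ 2 * cbinA p J * hsum (S i)
  + (- ((1 + k ^ 2) * J ^ 2 - lam) * hsum i + cbinB p J * Series low)).
{ assert (Hex1 : ex_series (fun n => hweight n / (J + 2 + jj n)))
    by (apply ex_series_hweight; lra).
  assert (Hex2 : ex_series (fun n => hweight n / (J + jj n)))
    by (apply ex_series_hweight; lra).
  unfold T; rewrite Series_plus.
  - rewrite Series_plus; [| apply (ex_series_scal_l (- ((1 + k ^ 2) * J ^ 2 - lam)) _ Hex2)
      | apply (ex_series_scal_l (cbinB p J) _ Hlow_ex)].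
    rewrite !Series_scal_l; unfold hsum; rewrite jj_S; reflexivity.
  - apply (ex_series_scal_l (k ^ 2 * cbinA p J) _ Hex1).
  - apply (ex_series_plus (fun n => - ((1 + k ^ 2) * J ^ 2 - lam) * (hweight n / (J + jj n)))
      (fun n => cbinB p J * low n)).
    + apply (ex_series_scal_l (- ((1 + k ^ 2) * J ^ 2 - lam)) _ Hex2).
    + apply (ex_series_scal_l (cbinB p J) _ Hlow_ex). }
rewrite (is_series_unique _ _ HT0) in HS; rewrite HlowS; lra.
Qed.

(** The recurrence has a positive leading coefficient and no predecessor at index 0, so its
    solutions are determined by their value at 0. Both [cbin * hsum] and [moment] solve it, and
    [cbin p 0 = 1]. *)
Lemma hsum_moment (i : nat) : cbin p i * hsum i * moment k p m 0 = hsum 0 * moment k p m i.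
Proof.
fold M.
assert (Hk2 := k2_range k hk).
assert (Hc0 : cbin p 0 = 1).
{ unfold cbin, Binomial.C; destruct hp as [-> | ->]; simpl; field. }
assert (Hrec : forall i, k ^ 2 * (jj i + 1) * (jj i + 2) * (cbin p (S i) * hsum (S i))
  = ((1 + k ^ 2) * jj i ^ 2 - lam) * (cbin p i * hsum i)
    - (jj i - 1) * (jj i - 2) * match i with 0%nat => 0 | S r => cbin p r * hsum r end).
{ clear i; intros i; destruct (cbin_ratio p i hp) as [EA _]; fold (jj i) in EA.
  transitivity (k ^ 2 * ((jj i + 1) * (jj i + 2) * cbin p (S i)) * hsum (S i)); [ring |].
  rewrite EA; transitivity (cbin p i * (k ^ 2 * cbinA p (jj i) * hsum (S i))); [ring |].
  rewrite hsum_rec; destruct i as [|r]; [ring |].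
  destruct (cbin_ratio p r hp) as [_ EB]; fold (jj r) in EB.
  rewrite jj_S.
  transitivity (((1 + k ^ 2) * (jj r + 2) ^ 2 - lam) * (cbin p (S r) * hsum (S r)) -
    (cbinB p (jj r + 2) * cbin p (S r)) * hsum r); [ring |].
  rewrite <- EB; ring. }
cut (cbin p i * hsum i * M 0 = hsum 0 * M i /\ cbin p (S i) * hsum (S i) * M 0 = hsum 0 * M (S i));
  [tauto |].
assert (Hpos : forall i, 0 < k ^ 2 * (jj i + 1) * (jj i + 2)).
{ clear i; intros i; generalize (jj_pos i); intros; apply Rmult_lt_0_compat; nra. }
induction i as [|i [IH1 IH2]].
- split; [rewrite Hc0; ring |].
  apply (Rmult_eq_reg_l (k ^ 2 * (jj 0 + 1) * (jj 0 + 2))); [| apply Rgt_not_eq, Hpos].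
  rewrite <- !Rmult_assoc.
  transitivity (k ^ 2 * (jj 0 + 1) * (jj 0 + 2) * (cbin p 1 * hsum 1) * M 0); [ring |].
  rewrite Hrec, Hc0.
  transitivity (hsum 0 * (k ^ 2 * (jj 0 + 1) * (jj 0 + 2) * M 1)); [| ring].
  rewrite (M_rec 0); ring.
- split; [exact IH2 |].
  apply (Rmult_eq_reg_l (k ^ 2 * (jj (S i) + 1) * (jj (S i) + 2))); [| apply Rgt_not_eq, Hpos].
  transitivity (k ^ 2 * (jj (S i) + 1) * (jj (S i) + 2) * (cbin p (S (S i)) * hsum (S (S i))) * M 0);
    [ring |].
  rewrite Hrec.
  transitivity (hsum 0 * (k ^ 2 * (jj (S i) + 1) * (jj (S i) + 2) * M (S (S i)))); [| ring].
  rewrite (M_rec (S i)).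
  transitivity (((1 + k ^ 2) * jj (S i) ^ 2 - lam) * (cbin p (S i) * hsum (S i) * M 0)
    - (jj (S i) - 1) * (jj (S i) - 2) * (cbin p i * hsum i * M 0)); [ring |].
  rewrite IH1, IH2; ring.
Qed.

End Eigen.

(** * Self-adjoint operators with rapidly decaying matrix entries *)

Lemma sum_n_geom_bound (a : nat -> R) (C r : R) (N : nat) :
  0 <= r < 1 -> (forall n, (n <= N)%nat -> Rabs (a n) <= C * r ^ n) ->
  Rabs (sum_n a N) <= C / (1 - r).
Proof.
intros Hr Ha.
assert (HC : 0 <= C).
{ generalize (Ha 0%nat (Nat.le_0_l N)) (Rabs_pos (a 0%nat)); simpl; lra. }
assert (H : Rabs (sum_n a N) <= C * (1 - r ^ S N) / (1 - r)).
{ induction N as [|N IH].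
  - rewrite sum_O; eapply Rle_trans; [apply Ha; lia |]; right; simpl; field; lra.
  - change (Rabs (sum_n a (S N)) <= C * (1 - r ^ S (S N)) / (1 - r)).
    replace (sum_n a (S N)) with (sum_n a N + a (S N)) by (symmetry; exact (sum_Sn a N)).
    eapply Rle_trans; [apply Rabs_triang |].
    assert (H1 := Ha (S N) (Nat.le_refl _)).
    assert (H2 : Rabs (sum_n a N) <= C * (1 - r ^ S N) / (1 - r))
      by (apply IH; intros n Hn; apply Ha; lia).
    replace (C * (1 - r ^ S (S N)) / (1 - r)) with (C * (1 - r ^ S N) / (1 - r) + C * r ^ S N)
      by (simpl; field; lra).
    lra. }
eapply Rle_trans; [exact H |].
apply Rmult_le_compat_r; [left; apply Rinv_0_lt_compat; lra |].
assert (0 <= r ^ S N) by (apply pow_le; lra); nra.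
Qed.

Lemma Series_term_le (a : nat -> R) (n : nat) :
  ex_series a -> (forall i, 0 <= a i) -> a n <= Series a.
Proof.
intros Ha Hpos.
assert (Hle : forall N, sum_n a N <= Series a).
{ apply (is_lim_seq_incr_compare (sum_n a)).
  - apply Series_correct, Ha.
  - intros N; replace (sum_n a (S N)) with (sum_n a N + a (S N)) by (symmetry; exact (sum_Sn a N)).
    generalize (Hpos (S N)); lra. }
eapply Rle_trans; [| apply (Hle n)].
destruct n as [|n]; [rewrite sum_O; lra |].
replace (sum_n a (S n)) with (sum_n a n + a (S n)) by (symmetry; exact (sum_Sn a n)).
assert (0 <= sum_n a n); [| lra].
clear Hle; induction n as [|n IH]; [rewrite sum_O; apply Hpos |].
replace (sum_n a (S n)) with (sum_n a n + a (S n)) by (symmetry; exact (sum_Sn a n)).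
generalize (Hpos (S n)); lra.
Qed.

Definition bounded_seq (x : nat -> R) : Prop := exists X, forall n, Rabs (x n) <= X.

Lemma bounded_seq_nonneg (x : nat -> R) : bounded_seq x ->
  exists X, 0 <= X /\ forall n, Rabs (x n) <= X.
Proof.
intros [X HX]; exists X; split; trivial.
generalize (HX 0%nat) (Rabs_pos (x 0%nat)); lra.
Qed.

Lemma sqr_le_sqrt (a b : R) : a ^ 2 <= b -> Rabs a <= sqrt b.
Proof.
intros H; rewrite <- sqrt_Rsqr_abs; apply sqrt_le_1_alt; unfold Rsqr; lra.
Qed.

Lemma l2norm_sqr (u : nat -> C) : l2 u -> l2norm u ^ 2 = Series (fun n => Cmod (u n) ^ 2).
Proof.
intros Hu; apply pow2_sqrt.
eapply Rle_trans; [| apply (Series_term_le _ 0 Hu); intros; apply pow2_ge_0].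
apply pow2_ge_0.
Qed.

Lemma l2_bound (u : nat -> C) : l2 u ->
  forall n, Rabs (Re (u n)) <= l2norm u /\ Rabs (Im (u n)) <= l2norm u.
Proof.
intros Hu n.
assert (H := Series_term_le _ n Hu (fun i => pow2_ge_0 (Cmod (u i)))).
cbv beta in H; rewrite Cmod2_alt in H.
assert (H1 := pow2_ge_0 (Re (u n))); assert (H2 := pow2_ge_0 (Im (u n))).
split; apply sqr_le_sqrt; lra.
Qed.

Lemma l2_bounded_Re (u : nat -> C) : l2 u -> bounded_seq (fun n => Re (u n)).
Proof. intros Hu; exists (l2norm u); apply l2_bound, Hu. Qed.
Lemma l2_bounded_Im (u : nat -> C) : l2 u -> bounded_seq (fun n => Im (u n)).
Proof. intros Hu; exists (l2norm u); apply l2_bound, Hu. Qed.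

Lemma geom_l2 (u : nat -> C) (C r : R) : 0 < r < 1 -> 0 <= C ->
  (forall n, Rabs (Re (u n)) <= C * r ^ n /\ Rabs (Im (u n)) <= C * r ^ n) ->
  l2 u /\ l2norm u <= C * sqrt (2 / (1 - r ^ 2)).
Proof.
intros Hr HC Hu.
assert (Hb : forall n, Rabs (Cmod (u n) ^ 2) <= 2 * C ^ 2 * (r ^ 2) ^ n).
{ intros n; destruct (Hu n) as [H1 H2].
  rewrite Rabs_pos_eq by apply pow2_ge_0; rewrite Cmod2_alt.
  rewrite <- (pow2_abs (Re (u n))), <- (pow2_abs (Im (u n))).
  replace (2 * C ^ 2 * (r ^ 2) ^ n) with ((C * r ^ n) ^ 2 + (C * r ^ n) ^ 2)
    by (rewrite <- pow_mult, Nat.mul_comm, pow_mult; ring).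
  apply Rplus_le_compat; apply pow_incr; split; auto using Rabs_pos. }
split.
- apply (ex_series_geom_bound _ (2 * C ^ 2) (r ^ 2)); [nra | exact Hb].
- unfold l2norm.
  replace (C * sqrt (2 / (1 - r ^ 2))) with (sqrt (2 * C ^ 2 / (1 - r ^ 2))).
  + apply sqrt_le_1_alt; eapply Rle_trans; [apply Rle_abs |].
    apply Series_geom_bound; [nra | exact Hb].
  + replace (2 * C ^ 2 / (1 - r ^ 2)) with (C ^ 2 * (2 / (1 - r ^ 2))) by (field; nra).
    rewrite sqrt_mult_alt by apply pow2_ge_0; rewrite sqrt_pow2 by assumption; reflexivity.
Qed.

Lemma Series_delta (f : nat -> R) (m : nat) :
  is_series (fun n => f n * (if Nat.eqb n m then 1 else 0)) (f m).
Proof.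
assert (H : forall N, (m <= N)%nat ->
  @eq R (sum_n (fun n => f n * (if Nat.eqb n m then 1 else 0)) N) (f m)).
{ assert (H0 : forall N, (N < m)%nat ->
    @eq R (sum_n (fun n => f n * (if Nat.eqb n m then 1 else 0)) N) 0).
  { induction N as [|N IH]; intros HN.
    - rewrite sum_O; destruct (Nat.eqb_spec 0 m); [lia | ring].
    - transitivity (sum_n (fun n => f n * (if Nat.eqb n m then 1 else 0)) N
        + f (S N) * (if Nat.eqb (S N) m then 1 else 0)); [exact (sum_Sn _ N) |].
      rewrite IH by lia; destruct (Nat.eqb_spec (S N) m); [lia | ring]. }
  induction N as [|N IH]; intros HN.
  - rewrite sum_O; destruct (Nat.eqb_spec 0 m); [subst m; ring | lia].
  - transitivity (sum_n (fun n => f n * (if Nat.eqb n m then 1 else 0)) N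
      + f (S N) * (if Nat.eqb (S N) m then 1 else 0)); [exact (sum_Sn _ N) |].
    destruct (Nat.eqb_spec (S N) m) as [E | E].
    + rewrite H0 by lia; rewrite E; ring.
    + rewrite IH by lia; ring. }
change (is_lim_seq (sum_n (fun n => f n * (if Nat.eqb n m then 1 else 0))) (f m)).
apply (is_lim_seq_ext_loc (fun _ => f m)); [| apply is_lim_seq_const].
exists m; intros n Hn; symmetry; apply H, Hn.
Qed.

Section Operator.

Variables (H : nat -> nat -> R) (B r : R).
Hypothesis hr : 0 < r < 1.
Hypothesis H_bound : forall m n, Rabs (H m n) <= B * r ^ m * r ^ n.
Hypothesis H_sym : forall m n, H m n = H n m.
Hypothesis H_pos : forall x N, 0 <= sum_n (fun m => sum_n (fun n => H m n * x n) N * x m) N.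

Definition mat_vec (x : nat -> R) (m : nat) : R := Series (fun n => H m n * x n).

Lemma B_nonneg : 0 <= B.
Proof. generalize (H_bound 0 0) (Rabs_pos (H 0 0)); simpl; lra. Qed.

Lemma row_bound (x : nat -> R) (X : R) (m n : nat) :
  (forall n, Rabs (x n) <= X) -> Rabs (H m n * x n) <= B * r ^ m * X * r ^ n.
Proof.
intros HX; rewrite Rabs_mult.
replace (B * r ^ m * X * r ^ n) with (B * r ^ m * r ^ n * X) by ring.
apply Rmult_le_compat; auto using Rabs_pos.
Qed.

Lemma ex_row (x : nat -> R) (m : nat) : bounded_seq x -> ex_series (fun n => H m n * x n).
Proof.
intros [X HX]; apply (ex_series_geom_bound _ (B * r ^ m * X) r); [lra |].
intros n; apply row_bound, HX.
Qed.

Lemma mat_vec_bound (x : nat -> R) (X : R) (m : nat) :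
  (forall n, Rabs (x n) <= X) -> Rabs (mat_vec x m) <= B * X / (1 - r) * r ^ m.
Proof.
intros HX.
replace (B * X / (1 - r) * r ^ m) with (B * r ^ m * X / (1 - r)) by (field; lra).
apply Series_geom_bound; [lra |]; intros n; apply row_bound, HX.
Qed.

Lemma mat_vec_lin (x y : nat -> R) (a b : R) (m : nat) : bounded_seq x -> bounded_seq y ->
  mat_vec (fun n => a * x n + b * y n) m = a * mat_vec x m + b * mat_vec y m.
Proof.
intros Hx Hy; unfold mat_vec.
rewrite <- !Series_scal_l, <- Series_plus.
- apply Series_ext; intros n; ring.
- apply (ex_series_scal_l a (fun n => H m n * x n)), ex_row, Hx.
- apply (ex_series_scal_l b (fun n => H m n * y n)), ex_row, Hy.
Qed.

Lemma mat_vec_ext (x y : nat -> R) (m : nat) : (forall n, x n = y n) -> mat_vec x m = mat_vec y m.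
Proof. intros E; apply Series_ext; intros n; rewrite E; trivial. Qed.

Lemma ex_mat_vec_mul (x y : nat -> R) : bounded_seq x -> bounded_seq y ->
  ex_series (fun m => mat_vec x m * y m).
Proof.
intros Hx Hy.
destruct (bounded_seq_nonneg x Hx) as [X [HX0 HX]].
destruct (bounded_seq_nonneg y Hy) as [Y [HY0 HY]].
apply (ex_series_geom_bound _ (B * X / (1 - r) * Y) r); [lra |].
intros n; rewrite Rabs_mult.
replace (B * X / (1 - r) * Y * r ^ n) with (B * X / (1 - r) * r ^ n * Y) by ring.
apply Rmult_le_compat; auto using Rabs_pos, mat_vec_bound.
Qed.

(** Square truncations converge to the quadratic form, the neglected row tails being of total size
    [r ^ N]. Symmetry and positivity then come from finite sums, where the order of summation is
    free. *)
Lemma form_limit (x y : nat -> R) : bounded_seq x -> bounded_seq y ->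
  is_lim_seq (fun N => sum_n (fun m => sum_n (fun n => H m n * x n) N * y m) N)
    (Series (fun m => mat_vec x m * y m)).
Proof.
intros Hx Hy; assert (HB := B_nonneg).
assert (Hex := ex_mat_vec_mul x y Hx Hy).
destruct (bounded_seq_nonneg x Hx) as [X [HX0 HX]].
destruct (bounded_seq_nonneg y Hy) as [Y [HY0 HY]].
set (C := B * X * r / (1 - r) * Y).
assert (HC : 0 <= C).
{ unfold C; apply Rmult_le_pos; [| assumption]; apply Rmult_le_pos;
    [repeat apply Rmult_le_pos; lra | left; apply Rinv_0_lt_compat; lra]. }
assert (Hd : is_lim_seq (fun N => sum_n (fun m => (sum_n (fun n => H m n * x n) N - mat_vec x m) * y m) N) 0).
{ apply is_lim_seq_abs_0.
  apply (is_lim_seq_le_le (fun _ => 0) _ (fun N => C / (1 - r) * r ^ N)).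
  - intros N; split; [apply Rabs_pos |].
    replace (C / (1 - r) * r ^ N) with (C * r ^ N / (1 - r)) by (field; lra).
    apply sum_n_geom_bound; [lra |]; intros n _.
    rewrite Rabs_mult.
    replace (C * r ^ N * r ^ n) with (B * r ^ n * X * r / (1 - r) * r ^ N * Y)
      by (unfold C; field; lra).
    apply Rmult_le_compat; auto using Rabs_pos.
    apply Series_geom_tail; [lra |]; intros i; apply row_bound, HX.
  - apply is_lim_seq_const.
  - replace (Finite 0) with (Rbar_mult (C / (1 - r)) 0) by (simpl; f_equal; ring).
    apply is_lim_seq_scal_l, is_lim_seq_geom; rewrite Rabs_pos_eq; lra. }
assert (Hs : is_lim_seq (fun N => sum_n (fun m => mat_vec x m * y m) N)
  (Series (fun m => mat_vec x m * y m))) by (apply Series_correct, Hex).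
generalize (is_lim_seq_plus' _ _ _ _ Hd Hs); rewrite Rplus_0_l.
apply is_lim_seq_ext; intros N.
transitivity (sum_n (fun m => plus ((sum_n (fun n => H m n * x n) N - mat_vec x m) * y m)
  (mat_vec x m * y m)) N).
- symmetry; exact (sum_n_plus (fun m => (sum_n (fun n => H m n * x n) N - mat_vec x m) * y m)
    (fun m => mat_vec x m * y m) N).
- apply sum_n_ext; intros m; unfold plus; simpl.
  match goal with |- ?a = ?b => change (@eq R a b) end; ring.
Qed.

Lemma mat_vec_sym (x y : nat -> R) : bounded_seq x -> bounded_seq y ->
  Series (fun m => mat_vec x m * y m) = Series (fun m => mat_vec y m * x m).
Proof.
intros Hx Hy.
assert (H1 := form_limit x y Hx Hy); assert (H2 := form_limit y x Hy Hx).
assert (H3 : is_lim_seq (fun N => sum_n (fun m => sum_n (fun n => H m n * y n) N * x m) N)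
  (Series (fun m => mat_vec x m * y m))).
{ revert H1; apply is_lim_seq_ext; intros N.
  transitivity (sum_n (fun m => sum_n (fun n => H m n * x n * y m) N) N).
  - apply sum_n_ext; intros m; symmetry.
    exact (sum_n_mult_r (y m) (fun n => H m n * x n) N).
  - rewrite sum_n_switch; apply sum_n_ext; intros n.
    transitivity (sum_n (fun m => H n m * y m * x n) N).
    + apply sum_n_ext; intros m; rewrite (H_sym m n).
      match goal with |- ?a = ?b => change (@eq R a b) end; ring.
    + exact (sum_n_mult_r (x n) (fun m => H n m * y m) N). }
apply is_lim_seq_unique in H2; apply is_lim_seq_unique in H3.
rewrite H2 in H3; injection H3; auto.
Qed.

Lemma mat_vec_nonneg (x : nat -> R) : bounded_seq x -> 0 <= Series (fun m => mat_vec x m * x m).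
Proof.
intros Hx.
exact (is_lim_seq_le _ _ (Finite 0) (Finite _) (fun N => H_pos x N) (is_lim_seq_const 0)
  (form_limit x x Hx Hx)).
Qed.

(** The entries are real, so real and imaginary parts are treated separately and every sum is a real
    series. *)
Definition mat_op (u : nat -> C) (m : nat) : C :=
  (mat_vec (fun n => Re (u n)) m, mat_vec (fun n => Im (u n)) m).

Lemma mat_op_l2 (u : nat -> C) : l2 u ->
  l2 (mat_op u) /\ l2norm (mat_op u) <= B / (1 - r) * sqrt (2 / (1 - r ^ 2)) * l2norm u.
Proof.
intros Hu.
assert (HB := B_nonneg).
assert (HU : 0 <= l2norm u) by apply sqrt_pos.
destruct (geom_l2 (mat_op u) (B * l2norm u / (1 - r)) r hr) as [H1 H2].
- apply Rmult_le_pos; [apply Rmult_le_pos; lra | left; apply Rinv_0_lt_compat; lra].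
- intros n; split; apply mat_vec_bound; intros i; apply (l2_bound u Hu i).
- split; [exact H1 |].
  eapply Rle_trans; [exact H2 |]; right; field; lra.
Qed.

Lemma bounded_seq_lin (x y : nat -> R) (a b : R) : bounded_seq x -> bounded_seq y ->
  bounded_seq (fun n => a * x n + b * y n).
Proof.
intros [X HX] [Y HY]; exists (Rabs a * X + Rabs b * Y); intros n.
eapply Rle_trans; [apply Rabs_triang |]; rewrite !Rabs_mult.
apply Rplus_le_compat; apply Rmult_le_compat_l; auto using Rabs_pos.
Qed.

Lemma mat_op_bounded : bounded_operator mat_op.
Proof.
split; [intros u Hu; apply mat_op_l2, Hu |].
split; [| eexists; intros u Hu; apply mat_op_l2, Hu].
intros a b u v Hu Hv n.
assert (Hur := l2_bounded_Re u Hu); assert (Hui := l2_bounded_Im u Hu).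
assert (Hvr := l2_bounded_Re v Hv); assert (Hvi := l2_bounded_Im v Hv).
assert (E1 : mat_vec (fun i => Re (a * u i + b * v i)%C) n =
  Re a * mat_vec (fun i => Re (u i)) n - Im a * mat_vec (fun i => Im (u i)) n
  + (Re b * mat_vec (fun i => Re (v i)) n - Im b * mat_vec (fun i => Im (v i)) n)).
{ transitivity (mat_vec (fun i => 1 * (Re a * Re (u i) + - Im a * Im (u i))
    + 1 * (Re b * Re (v i) + - Im b * Im (v i))) n).
  - apply mat_vec_ext; intros i; unfold Re, Im; simpl; ring.
  - rewrite mat_vec_lin by (apply bounded_seq_lin; assumption).
    rewrite !mat_vec_lin by assumption; ring. }
assert (E2 : mat_vec (fun i => Im (a * u i + b * v i)%C) n =
  Re a * mat_vec (fun i => Im (u i)) n + Im a * mat_vec (fun i => Re (u i)) n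
  + (Re b * mat_vec (fun i => Im (v i)) n + Im b * mat_vec (fun i => Re (v i)) n)).
{ transitivity (mat_vec (fun i => 1 * (Re a * Im (u i) + Im a * Re (u i))
    + 1 * (Re b * Im (v i) + Im b * Re (v i))) n).
  - apply mat_vec_ext; intros i; unfold Re, Im; simpl; ring.
  - rewrite mat_vec_lin by (apply bounded_seq_lin; assumption).
    rewrite !mat_vec_lin by assumption; ring. }
unfold mat_op; rewrite E1, E2; unfold Cplus, Cmult, Re, Im; simpl; f_equal; ring.
Qed.

Lemma inner_mat_op (u v : nat -> C) : l2 u -> l2 v ->
  inner (mat_op u) v =
  (Series (fun m => mat_vec (fun n => Re (u n)) m * Re (v m))
     + Series (fun m => mat_vec (fun n => Im (u n)) m * Im (v m)),
   Series (fun m => mat_vec (fun n => Im (u n)) m * Re (v m))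
     - Series (fun m => mat_vec (fun n => Re (u n)) m * Im (v m))).
Proof.
intros Hu Hv.
assert (Hur := l2_bounded_Re u Hu); assert (Hui := l2_bounded_Im u Hu).
assert (Hvr := l2_bounded_Re v Hv); assert (Hvi := l2_bounded_Im v Hv).
rewrite <- Series_plus, <- Series_minus by (apply ex_mat_vec_mul; assumption).
unfold inner, CSeries; f_equal; apply Series_ext; intros m; unfold mat_op, Re, Im; simpl; ring.
Qed.

Lemma mat_op_self_adjoint : is_adjoint mat_op mat_op.
Proof.
intros u v Hu Hv.
assert (Hc : inner u (mat_op v) = (Re (inner (mat_op v) u), - Im (inner (mat_op v) u))).
{ unfold inner, CSeries, Re at 3, Im at 3; simpl; rewrite <- Series_opp.
  f_equal; apply Series_ext; intros m; unfold Re, Im; simpl; ring. }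
rewrite Hc, !inner_mat_op by assumption; unfold Re at 5, Im at 5; simpl.
assert (Hur := l2_bounded_Re u Hu); assert (Hui := l2_bounded_Im u Hu).
assert (Hvr := l2_bounded_Re v Hv); assert (Hvi := l2_bounded_Im v Hv).
rewrite Ropp_minus_distr.
apply (f_equal2 (@pair R R)); [apply (f_equal2 Rplus) | apply (f_equal2 Rminus)];
  apply (mat_vec_sym (fun n => _ (u n)) (fun n => _ (v n))); assumption.
Qed.

Lemma mat_op_positive : positive_operator mat_op.
Proof.
intros u Hu; rewrite inner_mat_op by assumption.
assert (Hur := l2_bounded_Re u Hu); assert (Hui := l2_bounded_Im u Hu).
unfold Re at 3, Im at 1; simpl; split.
- rewrite mat_vec_sym by assumption; apply Rminus_diag.
- apply Rplus_le_le_0_compat; apply mat_vec_nonneg; assumption.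
Qed.

Lemma basis_vec_l2 (n : nat) : l2 (basis_vec n).
Proof.
exists 1; apply (is_series_ext_R (fun i => 1 * (if Nat.eqb i n then 1 else 0))).
- intros i; unfold basis_vec; destruct (Nat.eqb i n); rewrite Cmod_R.
  + rewrite Rabs_R1; ring.
  + rewrite Rabs_R0; ring.
- apply (Series_delta (fun _ => 1)).
Qed.

Lemma mat_op_represents : represents H mat_op.
Proof.
intros m n; rewrite inner_mat_op by apply basis_vec_l2.
assert (HRe : forall i, mat_vec (fun j => Re (basis_vec n j)) i = H i n).
{ intros i; apply is_series_unique.
  apply (is_series_ext_R (fun j => H i j * (if Nat.eqb j n then 1 else 0))).
  - intros j; unfold basis_vec; destruct (Nat.eqb j n); reflexivity.
  - apply Series_delta. }
assert (HIm : forall i j, Im (basis_vec j i) = 0)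
  by (intros i j; unfold basis_vec; destruct (Nat.eqb i j); reflexivity).
assert (HI0 : forall i, mat_vec (fun j => Im (basis_vec n j)) i = 0).
{ intros i; unfold mat_vec; rewrite (Series_ext _ (fun j => 0 * H i j)).
  - rewrite Series_scal_l; ring.
  - intros j; rewrite HIm; ring. }
assert (HS : forall f : nat -> R, (forall i, f i = 0) -> Series f = 0).
{ intros f Hf; rewrite (Series_ext _ (fun j => 0 * f j)).
  - rewrite Series_scal_l; ring.
  - intros j; rewrite Hf; ring. }
unfold RtoC; f_equal.
- rewrite (HS (fun i => _ * Im _)) by (intros; rewrite HIm; ring).
  rewrite Rplus_0_r; apply is_series_unique.
  apply (is_series_ext_R (fun j => H j n * (if Nat.eqb j m then 1 else 0))).
  + intros j; rewrite HRe; unfold basis_vec; destruct (Nat.eqb j m); reflexivity.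
  + apply (Series_delta (fun j => H j n)).
- rewrite (HS (fun i => _ * Im _)) by (intros; rewrite HIm; ring).
  rewrite HS by (intros; rewrite HI0; ring); ring.
Qed.

(** A positive self-adjoint operator is its own absolute value, and the diagonal entries are bounded
    by [B * (r ^ 2) ^ n]. *)
Lemma mat_op_trace_class : trace_class mat_op.
Proof.
split; [exact mat_op_bounded |].
exists mat_op; split.
- split; [exact mat_op_bounded |]; split; [exact mat_op_positive |].
  exists mat_op; split; [exact mat_op_bounded |]; split; [exact mat_op_self_adjoint |]; trivial.
- apply (ex_series_geom_bound _ B (r ^ 2)); [nra |].
  intros n; rewrite mat_op_represents; unfold Re, RtoC; simpl fst.
  eapply Rle_trans; [apply H_bound |]; right.
  rewrite <- pow_mult, Rmult_assoc, <- pow_add; f_equal; f_equal; lia.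
Qed.


Lemma ex_mul_geom (x y : nat -> R) (C : R) :
  bounded_seq x -> (forall n, Rabs (y n) <= C * r ^ n) -> ex_series (fun n => x n * y n).
Proof.
intros Hx Hy; destruct (bounded_seq_nonneg x Hx) as [X [HX0 HX]].
apply (ex_series_geom_bound _ (X * C) r); [lra |].
intros n; rewrite Rabs_mult, Rmult_assoc; apply Rmult_le_compat; auto using Rabs_pos.
Qed.

(** * The spectrum from a complete family of eigenvectors *)

Variables (Psi : nat -> nat -> R) (nu : nat -> R).
Hypothesis Psi_geom : forall m, exists C, forall n, Rabs (Psi m n) <= C * r ^ n.
Hypothesis Psi_0 : forall m, Psi m 0%nat <> 0.
Hypothesis Psi_eigen : forall m n, mat_vec (Psi m) n = nu m * Psi m n.
Hypothesis nu_decreasing : forall m, nu (S m) < nu m.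
Hypothesis Psi_complete : forall x, ex_series (fun n => x n ^ 2) ->
  (forall m, Series (fun n => x n * Psi m n) = 0) -> forall n, x n = 0.

Lemma nu_lt (i j : nat) : (i < j)%nat -> nu j < nu i.
Proof.
induction 1 as [|j _ IH]; [apply nu_decreasing |].
generalize (nu_decreasing j); lra.
Qed.

Lemma nu_inj (i j : nat) : nu i = nu j -> i = j.
Proof.
intros E; destruct (Nat.lt_trichotomy i j) as [Hlt | [? | Hlt]]; trivial;
  apply nu_lt in Hlt; lra.
Qed.

Lemma Psi_bounded (m : nat) : bounded_seq (Psi m).
Proof.
destruct (Psi_geom m) as [C HC]; exists C; intros n.
assert (H0 : 0 <= C) by (generalize (HC 0%nat) (Rabs_pos (Psi m 0)); simpl; lra).
eapply Rle_trans; [apply HC |].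
rewrite <- (Rmult_1_r C) at 2; apply Rmult_le_compat_l; [assumption |].
rewrite <- (pow1 n); apply pow_incr; lra.
Qed.

Lemma Psi_l2 (m : nat) : l2 (fun n => RtoC (Psi m n)).
Proof.
destruct (Psi_geom m) as [C HC].
assert (H0 : 0 <= C) by (generalize (HC 0%nat) (Rabs_pos (Psi m 0)); simpl; lra).
apply (geom_l2 _ C r hr H0); intros n; unfold Re, Im, RtoC; simpl; split; [apply HC |].
rewrite Rabs_R0; apply Rmult_le_pos; [assumption | apply pow_le; lra].
Qed.

Lemma mat_vec_zero (n : nat) (x : nat -> R) : (forall i, x i = 0) -> mat_vec x n = 0.
Proof.
intros Hx; unfold mat_vec; rewrite (Series_ext _ (fun j => 0 * H n j)).
- rewrite Series_scal_l; ring.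
- intros j; rewrite Hx; ring.
Qed.

Lemma Psi_eigenvector (m : nat) : is_eigenvector mat_op (RtoC (nu m)) (fun n => RtoC (Psi m n)).
Proof.
split; [apply Psi_l2 |]; split.
- exists 0%nat; intros E; apply (Psi_0 m); injection E; trivial.
- intros n; unfold mat_op.
  rewrite (mat_vec_zero n (fun j => Im _)) by reflexivity.
  change (fun n => Re (RtoC (Psi m n))) with (Psi m); rewrite Psi_eigen.
  unfold RtoC, Cmult; simpl; f_equal; ring.
Qed.

Definition coef (x : nat -> R) (m : nat) : R := Series (fun n => x n * Psi m n).

Lemma coef_lin (x y : nat -> R) (a b : R) (m : nat) : bounded_seq x -> bounded_seq y ->
  coef (fun n => a * x n + b * y n) m = a * coef x m + b * coef y m.
Proof.
intros Hx Hy; destruct (Psi_geom m) as [C HC]; unfold coef.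
rewrite <- !Series_scal_l, <- Series_plus.
- apply Series_ext; intros n; ring.
- apply (ex_series_scal_l a (fun n => x n * Psi m n)), (ex_mul_geom x (Psi m) C); assumption.
- apply (ex_series_scal_l b (fun n => y n * Psi m n)), (ex_mul_geom y (Psi m) C); assumption.
Qed.

Lemma coef_mat_vec (x : nat -> R) (m : nat) : bounded_seq x ->
  Series (fun n => mat_vec x n * Psi m n) = nu m * coef x m.
Proof.
intros Hx; rewrite mat_vec_sym by (trivial; apply Psi_bounded).
unfold coef; rewrite <- Series_scal_l; apply Series_ext; intros n.
rewrite Psi_eigen; ring.
Qed.

(** Symmetry gives [(lambda - nu m)] times the complex coefficient equal to 0. In real and imaginary
    parts this is a linear system of determinant [(a - nu m) ^ 2 + b ^ 2], so [lambda] need not be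
    known to be real. *)
Lemma eigen_orthogonal (lambda : C) (u : nat -> C) (m : nat) :
  is_eigenvector mat_op lambda u -> lambda <> RtoC (nu m) ->
  coef (fun n => Re (u n)) m = 0 /\ coef (fun n => Im (u n)) m = 0.
Proof.
intros [Hu [_ He]] Hl.
assert (Hur := l2_bounded_Re u Hu); assert (Hui := l2_bounded_Im u Hu).
destruct lambda as [a b].
set (x := fun n => Re (u n)) in *; set (y := fun n => Im (u n)) in *.
assert (E1 : nu m * coef x m = a * coef x m + - b * coef y m).
{ rewrite <- coef_mat_vec, <- coef_lin by assumption.
  apply Series_ext; intros n; f_equal.
  transitivity (Re ((a, b) * u n)%C); [exact (f_equal Re (He n)) |].
  unfold x, y, Re, Im; simpl; ring. }
assert (E2 : nu m * coef y m = a * coef y m + b * coef x m).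
{ rewrite <- coef_mat_vec, <- coef_lin by assumption.
  apply Series_ext; intros n; f_equal.
  transitivity (Im ((a, b) * u n)%C); [exact (f_equal Im (He n)) |].
  unfold x, y, Re, Im; simpl; ring. }
set (p := coef x m) in *; set (q := coef y m) in *.
assert (Hne : 0 < (a - nu m) ^ 2 + b ^ 2).
{ assert (P1 := pow2_ge_0 (a - nu m)); assert (P2 := pow2_ge_0 b).
  destruct (Req_dec b 0) as [Hb | Hb]; [| generalize (pow2_gt_0 b Hb); lra].
  assert (Ha : a - nu m <> 0); [| generalize (pow2_gt_0 _ Ha); lra].
  intros E; apply Hl; unfold RtoC; f_equal; lra. }
assert (F1 : ((a - nu m) ^ 2 + b ^ 2) * p = 0).
{ transitivity ((a - nu m) * (a * p + - b * q - nu m * p) + b * (a * q + b * p - nu m * q)); [ring |].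
  rewrite <- E1, <- E2; ring. }
assert (F2 : ((a - nu m) ^ 2 + b ^ 2) * q = 0).
{ transitivity ((a - nu m) * (a * q + b * p - nu m * q) - b * (a * p + - b * q - nu m * p)); [ring |].
  rewrite <- E1, <- E2; ring. }
apply Rmult_integral in F1; apply Rmult_integral in F2.
split; [destruct F1 | destruct F2]; lra.
Qed.

Lemma ex_series_sqr_le (a : nat -> R) (u : nat -> C) : l2 u ->
  (forall n, a n ^ 2 <= Cmod (u n) ^ 2) -> ex_series (fun n => a n ^ 2).
Proof.
intros Hu Ha; apply (ex_series_le (fun n => a n ^ 2) (fun n => Cmod (u n) ^ 2)); [| exact Hu].
intros n; unfold norm; simpl; unfold abs; simpl.
rewrite Rabs_pos_eq by (generalize (pow2_ge_0 (a n)); simpl; trivial).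
apply (Ha n).
Qed.

Lemma l2_Re_sqr (u : nat -> C) : l2 u -> ex_series (fun n => Re (u n) ^ 2).
Proof.
intros Hu; apply (ex_series_sqr_le _ u Hu); intros n; rewrite Cmod2_alt.
generalize (pow2_ge_0 (Im (u n))); lra.
Qed.

Lemma l2_Im_sqr (u : nat -> C) : l2 u -> ex_series (fun n => Im (u n) ^ 2).
Proof.
intros Hu; apply (ex_series_sqr_le _ u Hu); intros n; rewrite Cmod2_alt.
generalize (pow2_ge_0 (Re (u n))); lra.
Qed.

Lemma eigenvalue_in_range (lambda : C) (u : nat -> C) :
  is_eigenvector mat_op lambda u -> exists m, lambda = RtoC (nu m).
Proof.
intros Hu; apply NNPP; intros Hn.
assert (Hne : forall m, lambda <> RtoC (nu m)) by (intros m E; apply Hn; exists m; exact E).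
destruct (Hu) as [Hl2 [[n Hnz] _]]; apply Hnz.
assert (E1 : Re (u n) = 0).
{ apply (Psi_complete (fun n => Re (u n)) (l2_Re_sqr u Hl2)).
  intros m; apply (eigen_orthogonal lambda u m Hu (Hne m)). }
assert (E2 : Im (u n) = 0).
{ apply (Psi_complete (fun n => Im (u n)) (l2_Im_sqr u Hl2)).
  intros m; apply (eigen_orthogonal lambda u m Hu (Hne m)). }
rewrite (surjective_pairing (u n)); unfold Re, Im in *; rewrite E1, E2; reflexivity.
Qed.

Lemma Psi_orthogonal (i j : nat) : i <> j -> coef (Psi i) j = 0.
Proof.
intros Hij.
destruct (eigen_orthogonal (RtoC (nu i)) (fun n => RtoC (Psi i n)) j (Psi_eigenvector i)) as [E _].
- intros E; apply Hij, nu_inj; injection E; trivial.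
- exact E.
Qed.

Lemma Psi_norm_pos (m : nat) : 0 < coef (Psi m) m.
Proof.
destruct (Psi_geom m) as [C HC].
apply Rlt_le_trans with (Psi m 0 * Psi m 0).
- generalize (Psi_0 m); nra.
- apply (Series_term_le (fun n => Psi m n * Psi m n)).
  + apply (ex_mul_geom _ _ C); [apply Psi_bounded | exact HC].
  + intros i; nra.
Qed.

Lemma real_multiple (x : nat -> R) (m : nat) :
  ex_series (fun n => x n ^ 2) -> bounded_seq x -> (forall i, i <> m -> coef x i = 0) ->
  forall n, x n = coef x m / coef (Psi m) m * Psi m n.
Proof.
intros Hx2 Hx Ho n.
assert (HN := Psi_norm_pos m).
set (t := coef x m / coef (Psi m) m).
assert (E : 1 * x n + - t * Psi m n = 0); [| lra].
apply (Psi_complete (fun n => 1 * x n + - t * Psi m n)).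
- apply (ex_series_le (fun n => (1 * x n + - t * Psi m n) ^ 2) (fun n => 2 * x n ^ 2 + 2 * t ^ 2 * (Psi m n * Psi m n))).
  + intros i; unfold norm; simpl; unfold abs; simpl.
    rewrite Rabs_pos_eq by (generalize (pow2_ge_0 (1 * x i + - t * Psi m i)); simpl; lra).
    generalize (pow2_ge_0 (x i + t * Psi m i)); nra.
  + destruct (Psi_geom m) as [C HC].
    apply (ex_series_plus (fun n => 2 * x n ^ 2) (fun n => 2 * t ^ 2 * (Psi m n * Psi m n))).
    * apply (ex_series_scal_l 2 (fun n => x n ^ 2)), Hx2.
    * apply (ex_series_scal_l (2 * t ^ 2) (fun n => Psi m n * Psi m n)).
      apply (ex_mul_geom _ _ C); [apply Psi_bounded | exact HC].
- intros i; change (coef (fun n => 1 * x n + - t * Psi m n) i = 0).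
  rewrite coef_lin by (trivial; apply Psi_bounded).
  destruct (Nat.eq_dec i m) as [-> | Hi].
  + unfold t; field; lra.
  + rewrite Ho, (Psi_orthogonal m i) by auto; ring.
Qed.

Lemma eigenvector_multiple (u : nat -> C) (m : nat) :
  is_eigenvector mat_op (RtoC (nu m)) u -> exists c : C, forall n, u n = (c * RtoC (Psi m n))%C.
Proof.
intros Hu; assert (Hl2 := proj1 Hu).
assert (Ho : forall i, i <> m -> RtoC (nu m) <> RtoC (nu i)).
{ intros i Hi E; apply Hi, nu_inj; injection E; auto. }
exists (coef (fun n => Re (u n)) m / coef (Psi m) m, coef (fun n => Im (u n)) m / coef (Psi m) m).
intros n; rewrite (surjective_pairing (u n)).
change (fst (u n)) with (Re (u n)); change (snd (u n)) with (Im (u n)).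
rewrite (real_multiple (fun n => Re (u n)) m (l2_Re_sqr u Hl2) (l2_bounded_Re u Hl2)).
2: intros i Hi; apply (eigen_orthogonal _ u i Hu (Ho i Hi)).
rewrite (real_multiple (fun n => Im (u n)) m (l2_Im_sqr u Hl2) (l2_bounded_Im u Hl2)).
2: intros i Hi; apply (eigen_orthogonal _ u i Hu (Ho i Hi)).
unfold Cmult, RtoC; simpl; f_equal; ring.
Qed.

Lemma mat_op_simple : simple_eigenvalues mat_op.
Proof.
intros lambda u v Hu Hv.
destruct (eigenvalue_in_range lambda u Hu) as [m ->].
destruct (eigenvector_multiple u m Hu) as [cu Ecu].
destruct (eigenvector_multiple v m Hv) as [cv Ecv].
assert (Hcu : cu <> RtoC 0).
{ intros E; destruct Hu as [_ [[n Hn] _]]; apply Hn; rewrite Ecu, E; ring. }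
exists (cv / cu)%C; intros n; rewrite Ecu, Ecv; field; exact Hcu.
Qed.

Lemma mat_op_eigenvalues : eigenvalues_in_descending_order mat_op nu.
Proof.
split; [exact nu_decreasing |].
intros lambda; split.
- intros [u Hu]; apply (eigenvalue_in_range lambda u Hu).
- intros [m ->]; eexists; apply Psi_eigenvector.
Qed.

End Operator.

(** * Completeness of the eigenvectors *)

Lemma RInt_split (f : R -> R) (a b c : R) : (forall x, continuous f x) ->
  RInt f a c = RInt f a b + RInt f b c.
Proof. intros Hf; symmetry; apply (RInt_Chasles f); apply ex_RInt_cont, Hf. Qed.

(* The weights [w ^ N] concentrate at [0], where [g] is positive. *)
Lemma laplace_concentration (w g : R -> R) (d : R) :
  (forall x, continuous w x) -> (forall x, continuous g x) ->
  (forall x y, 0 <= x < y -> y <= PI / 2 -> w y < w x) ->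
  0 <= w (PI / 2) -> 0 < d < PI / 2 -> (forall x, 0 < x < d -> 0 < g x) ->
  ~ (forall N, QInt (fun x => w x ^ N * g x) = 0).
Proof.
intros Hw Hg Hdec Hw0 Hd Hpos H0.
assert (Hwpos : forall x, 0 <= x <= PI / 2 -> 0 <= w x).
{ intros x Hx; destruct (Req_dec x (PI / 2)) as [-> | Hne]; trivial.
  generalize (Hdec x (PI / 2)); lra. }
assert (Hcont : forall N x, continuous (fun x => w x ^ N * g x) x).
{ intros N x; apply continuous_Rmult; [apply continuous_Rpow, Hw | apply Hg]. }
(* The mass [I0] between [d / 4] and [e] is weighted by at least [a ^ N] with [a = w e], the part
   beyond [d] by at most [b ^ N] with [b = w d < a]. The remaining pieces are nonnegative, so [I0]
   is bounded by a multiple of [(b / a) ^ N]. *)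
set (e := d / 2).
set (I0 := RInt g (d / 4) e).
assert (HI0 : 0 < I0).
{ apply RInt_gt_0; [unfold e; lra | intros x Hx; apply Hpos; unfold e in *; lra | auto]. }
destruct (continuity_ab_maj (fun x => Rabs (g x)) d (PI / 2)) as [xm [Hxm _]].
{ lra. }
{ intros x _; apply continuity_pt_filterlim.
  apply (continuous_comp g Rabs); [apply Hg | apply continuous_Rabs]. }
set (G := Rabs (g xm)) in *.
set (a := w e); set (b := w d).
assert (Hb : 0 <= b) by (apply Hwpos; lra).
assert (Hab : b < a) by (apply Hdec; unfold e; lra).
assert (Hkey : forall N, a ^ N * I0 <= (PI / 2 - d) * (b ^ N * G)).
{ intros N; specialize (H0 N); unfold QInt in H0.
  rewrite (RInt_split _ 0 (d / 4)), (RInt_split _ (d / 4) e), (RInt_split _ e d) in H0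
    by apply Hcont.
  assert (Hnn : forall x y, 0 <= x -> x <= y -> y <= d -> 0 <= RInt (fun x => w x ^ N * g x) x y).
  { intros x y Hx Hxy Hy; destruct (Req_dec x y) as [-> | Hne].
    - rewrite RInt_point; right; reflexivity.
    - apply RInt_ge_0; [lra | apply ex_RInt_cont, Hcont |].
      intros t Ht; apply Rmult_le_pos; [apply pow_le, Hwpos; lra | left; apply Hpos; lra]. }
  assert (H1 := Hnn 0 (d / 4) ltac:(lra) ltac:(lra) ltac:(lra)).
  assert (H2 := Hnn e d ltac:(unfold e; lra) ltac:(unfold e; lra) ltac:(lra)).
  assert (H3 : a ^ N * I0 <= RInt (fun x => w x ^ N * g x) (d / 4) e).
  { unfold I0; replace (a ^ N * RInt g (d / 4) e) with (RInt (fun x => a ^ N * g x) (d / 4) e).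
    - apply RInt_le; [unfold e; lra | | apply ex_RInt_cont, Hcont |].
      + apply ex_RInt_cont; intros x; apply (continuous_Rmult (fun _ => a ^ N));
          [apply continuous_const | apply Hg].
      + intros x Hx; apply Rmult_le_compat_r; [left; apply Hpos; unfold e in *; lra |].
        apply pow_incr; split; [apply Hwpos; unfold e; lra |].
        left; apply Hdec; unfold e in *; lra.
    - apply (RInt_scal g); apply ex_RInt_cont, Hg. }
  assert (H4 : Rabs (RInt (fun x => w x ^ N * g x) d (PI / 2)) <= (PI / 2 - d) * (b ^ N * G)).
  { apply abs_RInt_le_const; [lra | apply ex_RInt_cont, Hcont |].
    intros x Hx; rewrite Rabs_mult; apply Rmult_le_compat; auto using Rabs_pos.
    rewrite Rabs_pos_eq by (apply pow_le, Hwpos; lra).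
    apply pow_incr; split; [apply Hwpos; lra |].
    destruct (Req_dec x d) as [-> | Hne]; [right; reflexivity | left; apply Hdec; lra]. }
  assert (H5 := Rabs_def2 _ _ (Rle_lt_trans _ _ _ H4 (Rlt_plus_1 _))).
  assert (H6 := Rle_abs (- RInt (fun x => w x ^ N * g x) d (PI / 2))).
  rewrite Rabs_Ropp in H6; lra. }
assert (Ha : 0 < a) by lra.
assert (Hlim : is_lim_seq (fun N => (PI / 2 - d) * G * (b / a) ^ N) 0).
{ replace (Finite 0) with (Rbar_mult ((PI / 2 - d) * G) 0) by (simpl; f_equal; ring).
  apply is_lim_seq_scal_l, is_lim_seq_geom.
  rewrite Rabs_pos_eq; [apply (Rmult_lt_reg_r a); [lra |]; field_simplify; lra |].
  apply Rmult_le_pos; [lra | left; apply Rinv_0_lt_compat, Ha]. }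
assert (Hle : Rbar_le I0 0).
{ apply (is_lim_seq_le (fun _ => I0) (fun N => (PI / 2 - d) * G * (b / a) ^ N));
    [| apply is_lim_seq_const | exact Hlim].
  intros N; assert (HaN : 0 < a ^ N) by (apply pow_lt, Ha).
  apply (Rmult_le_reg_l (a ^ N)); [assumption |].
  eapply Rle_trans; [apply Hkey |]; right.
  unfold Rdiv; rewrite Rpow_mult_distr, pow_inv; field; lra. }
simpl in Hle; lra.
Qed.

(** The induction divides by [y] until the positive coefficient is the constant term; continuity at
    0 then suffices. *)
Lemma PSeries_pos_near_0 (n : nat) : forall (b : nat -> R) (C r : R), 0 < r < 1 ->
  (forall i, Rabs (b i) <= C * r ^ i) -> (forall i, (i < n)%nat -> b i = 0) -> 0 < b n ->
  exists d, 0 < d < 1 /\ forall y, 0 < y < d -> 0 < PSeries b y.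
Proof.
induction n as [|n IH]; intros b C r Hr Hb Hz Hpos.
- assert (Hc := PSeries_continuous_unit b C r 0 Hr Hb ltac:(lra)).
  assert (Hp0 : 0 < PSeries b 0) by (rewrite PSeries_0; exact Hpos).
  destruct (Hc (fun y => 0 < y) (open_gt 0 _ Hp0)) as [e He].
  exists (Rmin e (1 / 2)); assert (He0 := cond_pos e).
  split; [unfold Rmin; destruct Rle_dec; lra |].
  intros y Hy; apply He; apply Rabs_lt_between'; simpl.
  generalize (Rmin_l e (1 / 2)); lra.
- destruct (IH (PS_decr_1 b) (C * r) r Hr) as [d [Hd HP]].
  + intros i; unfold PS_decr_1; eapply Rle_trans; [apply Hb |]; right; simpl; ring.
  + intros i Hi; apply Hz; lia.
  + exact Hpos.
  + exists d; split; [exact Hd |]; intros y Hy.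
    rewrite PSeries_decr_1.
    * rewrite (Hz 0%nat) by lia; generalize (HP y Hy); nra.
    * apply ex_pseries_R, (ex_series_geom_bound _ C r); [lra |].
      intros i; rewrite Rabs_mult, <- (Rmult_1_r (C * r ^ i)).
      apply Rmult_le_compat; auto using Rabs_pos.
      rewrite Rabs_pos_eq by (apply pow_le; lra); rewrite <- (pow1 i); apply pow_incr; lra.
Qed.

Section Completeness.

Variables (k : R) (p : nat).
Hypothesis hk : 0 < k < 1.
Hypothesis hp : p = 0%nat \/ p = 1%nat.

(* The angle [theta] runs through [0, PI/2] while [phi] does; [wc k p m] is a trigonometric monomial in it. *)
Definition theta (x : R) : R := PI / (2 * ellipticK k) * ellF k x.

Lemma continuous_theta (x : R) : continuous theta x.
Proof.
apply (continuous_Rmult (fun _ => PI / (2 * ellipticK k))); [apply continuous_const |].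
apply (ex_derive_continuous (ellF k)); eexists; apply is_derive_ellF, hk.
Qed.

Lemma ellF_increasing (x y : R) : x < y -> ellF k x < ellF k y.
Proof.
intros Hxy; unfold ellF; rewrite (RInt_split _ 0 x y) by apply continuous_inv_delta, hk.
assert (0 < RInt (fun t => / delta k t) x y); [| lra].
apply RInt_gt_0; [exact Hxy | |].
- intros; apply Rinv_0_lt_compat, delta_pos, hk.
- intros; apply continuous_inv_delta, hk.
Qed.

Lemma theta_increasing (x y : R) : x < y -> theta x < theta y.
Proof.
intros Hxy; apply Rmult_lt_compat_l, ellF_increasing, Hxy.
apply Rdiv_lt_0_compat; [apply PI_RGT_0 |]; generalize (ellipticK_pos k hk); lra.
Qed.

Lemma theta_0 : theta 0 = 0.
Proof. unfold theta; rewrite ellF_0; ring. Qed.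

Lemma theta_PI2 : theta (PI / 2) = PI / 2.
Proof. unfold theta; rewrite ellF_PI2; field; apply Rgt_not_eq, ellipticK_pos, hk. Qed.

Lemma wc_theta (m : nat) (x : R) :
  wc k p m x = cos (INR (2 * m + 1 + p) * theta x - INR p * (PI / 2)).
Proof. unfold wc, freq, theta; f_equal; unfold Rdiv; ring. Qed.

(** Multiplication by cos(theta)^2 shifts the frequency by 0 and by 2 up or down, so it preserves
    the span of the family. At [m = 0] the lower neighbour folds back: cos(- theta) = cos(theta) for
    [p = 0], and sin(0) = 0 for [p = 1]. *)
Lemma wc_cos_sqr (m : nat) (x : R) : cos (theta x) ^ 2 * wc k p m x =
  / 2 * wc k p m x + (/ 4 * wc k p (S m) x + / 4 * match m with
    | 0%nat => match p with 0%nat => wc k p 0 x | _ => 0 end | S r => wc k p r x end).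
Proof.
assert (Hid : forall a b, cos a ^ 2 * cos b = / 2 * cos b + (/ 4 * cos (b + 2 * a) + / 4 * cos (b - 2 * a))).
{ intros a b; rewrite cos_plus, cos_minus, cos_2a_cos; field. }
rewrite (wc_theta m), (wc_theta (S m)), Hid.
set (b := INR (2 * m + 1 + p) * theta x - INR p * (PI / 2)).
replace (INR (2 * S m + 1 + p) * theta x - INR p * (PI / 2)) with (b + 2 * theta x)
  by (unfold b; rewrite !plus_INR, !mult_INR, (S_INR m); simpl; ring).
replace (cos (b - 2 * theta x)) with match m with
    | 0%nat => match p with 0%nat => wc k p 0 x | _ => 0 end | S r => wc k p r x end; [trivial |].
unfold b; destruct m as [|r].
- destruct hp as [Hp | Hp].
  + transitivity (wc k p 0 x); [rewrite Hp; reflexivity |].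
    rewrite wc_theta, <- cos_neg, Hp; f_equal; simpl; ring.
  + transitivity 0; [rewrite Hp; reflexivity |].
    rewrite <- cos_PI2, <- (cos_neg (PI / 2)), Hp; f_equal; simpl; ring.
- rewrite wc_theta; f_equal; rewrite !plus_INR, !mult_INR, (S_INR r); simpl; ring.
Qed.

Lemma wc_0_pos (x : R) : 0 < x < PI / 2 -> 0 < wc k p 0 x.
Proof.
intros Hx; assert (H1 := theta_increasing 0 x (proj1 Hx)).
assert (H2 := theta_increasing x _ (proj2 Hx)).
rewrite theta_0 in H1; rewrite theta_PI2 in H2.
rewrite wc_theta; destruct hp as [-> | ->]; simpl.
- apply cos_gt_0; lra.
- apply cos_gt_0; lra.
Qed.

Lemma cont_wN (m : nat) (x : R) : continuous (hN (wc k p m) p) x.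
Proof. apply (cont_hN k p m hk). Qed.

(** Induction on [N] for all [m] at once, since [wc_cos_sqr] brings in the neighbours of [m]. Powers
    of cos(theta)^2 are thereby available as weights without a completeness theorem for
    trigonometric functions. *)
Lemma cos_moments_vanish (A : R -> R) : (forall x, continuous A x) ->
  (forall m, QInt (fun x => hN (wc k p m) p x * A x) = 0) ->
  forall N m, QInt (fun x => (cos (theta x) ^ 2) ^ N * (hN (wc k p m) p x * A x)) = 0.
Proof.
intros HA H0.
assert (Hc : forall N m x, continuous (fun x => (cos (theta x) ^ 2) ^ N * (hN (wc k p m) p x * A x)) x).
{ intros N m x; apply continuous_Rmult.
  - apply continuous_Rpow, continuous_Rpow, (continuous_comp theta cos);
      [apply continuous_theta | apply continuous_cos].
  - apply continuous_Rmult; [apply cont_wN | apply HA]. }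
induction N as [|N IH]; intros m.
- rewrite <- (H0 m); apply QInt_ext; intros x; simpl; ring.
- assert (Hz : exists f : R -> R, (forall x, continuous f x) /\ QInt f = 0 /\
    forall x, f x = (cos (theta x) ^ 2) ^ N * (match m with
    | 0%nat => match p with 0%nat => wc k p 0 x | _ => 0 end | S r => wc k p r x end
    * (sin x ^ p * cos x) * A x)).
  { destruct m as [|r].
    - destruct hp as [Hp | Hp].
      + exists (fun x => (cos (theta x) ^ 2) ^ N * (hN (wc k p 0) p x * A x)).
        split; [apply Hc |]; split; [apply IH |]; intros x; unfold hN; rewrite Hp; reflexivity.
      + exists (fun _ => 0); split; [intros; apply continuous_const |].
        split; [exact (QInt_zero) | intros x; rewrite Hp; ring].
    - exists (fun x => (cos (theta x) ^ 2) ^ N * (hN (wc k p r) p x * A x)).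
      split; [apply Hc |]; split; [apply IH |]; trivial. }
  destruct Hz as [f [Hfc [Hf0 Hf]]].
  transitivity (1 * QInt (fun x => / 2 * ((cos (theta x) ^ 2) ^ N * (hN (wc k p m) p x * A x))
    + / 4 * ((cos (theta x) ^ 2) ^ N * (hN (wc k p (S m)) p x * A x))) + / 4 * QInt f).
  + apply QInt_combination; [apply continuous_lin; apply Hc | exact Hfc |].
    intros x; rewrite Hf; unfold hN; rewrite <- tech_pow_Rmult.
    transitivity ((cos (theta x) ^ 2) ^ N * (cos (theta x) ^ 2 * wc k p m x) * (sin x ^ p * cos x) * A x);
      [ring |].
    rewrite wc_cos_sqr; ring.
  + rewrite QInt_lin, !IH, Hf0 by apply Hc; ring.
Qed.

(** Near 0 both [hN (wc k p 0) p] and the power series are positive, while cos(theta)^2 decreases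
    from 1 to 0 over the quarter period; the vanishing integrals contradict
    [laplace_concentration]. *)
Lemma no_positive_leading_coef (b : nat -> R) (C r : R) (n : nat) : 0 < r < 1 ->
  (forall i, Rabs (b i) <= C * r ^ i) ->
  (forall m, QInt (fun x => hN (wc k p m) p x * PSeries b (sin x ^ 2)) = 0) ->
  (forall i, (i < n)%nat -> b i = 0) -> ~ 0 < b n.
Proof.
intros Hr Hb H0 Hz Hpos.
assert (Hpi := PI_RGT_0).
destruct (PSeries_pos_near_0 n b C r Hr Hb Hz Hpos) as [d [Hd HP]].
assert (HA : forall x, continuous (fun x => PSeries b (sin x ^ 2)) x).
{ intros x; apply (continuous_comp (fun x => sin x ^ 2) (PSeries b)).
  - apply continuous_Rpow, continuous_sin.
  - apply (PSeries_continuous_unit b C r); [assumption | assumption | apply sin2_range]. }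
apply (laplace_concentration (fun x => cos (theta x) ^ 2)
  (fun x => hN (wc k p 0) p x * PSeries b (sin x ^ 2)) d).
- intros x; apply continuous_Rpow, (continuous_comp theta cos);
    [apply continuous_theta | apply continuous_cos].
- intros x; apply continuous_Rmult; [apply cont_wN | apply HA].
- intros x y Hx Hy.
  assert (T1 : 0 <= theta x).
  { rewrite <- theta_0; destruct (Req_dec x 0) as [-> | Hne]; [right; reflexivity |].
    left; apply theta_increasing; lra. }
  assert (T2 := theta_increasing x y (proj2 Hx)).
  assert (T3 : theta y <= PI / 2).
  { rewrite <- theta_PI2; destruct (Req_dec y (PI / 2)) as [-> | Hne]; [right; reflexivity |].
    left; apply theta_increasing; lra. }
  assert (cos (theta y) < cos (theta x)) by (apply cos_decreasing_1; lra).
  assert (0 <= cos (theta y)) by (apply cos_ge_0; lra).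
  nra.
- apply pow2_ge_0.
- generalize PI2_3_2; lra.
- intros x Hx.
  assert (H32 := PI2_3_2).
  assert (Hs : 0 < sin x) by (apply sin_gt_0; lra).
  assert (Hc : 0 < cos x) by (apply cos_gt_0; lra).
  assert (Hw := wc_0_pos x ltac:(lra)).
  assert (Hsx : sin x <= x) by (left; apply sin_lt_x; lra).
  apply Rmult_lt_0_compat.
  + unfold hN; repeat apply Rmult_lt_0_compat; trivial; apply pow_lt; trivial.
  + apply HP; nra.
- intros N; apply cos_moments_vanish; assumption.
Qed.

Lemma coefficients_vanish (b : nat -> R) (C r : R) : 0 < r < 1 ->
  (forall i, Rabs (b i) <= C * r ^ i) ->
  (forall m, QInt (fun x => hN (wc k p m) p x * PSeries b (sin x ^ 2)) = 0) ->
  forall n, b n = 0.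
Proof.
intros Hr Hb H0 n.
induction n as [n IH] using lt_wf_ind.
apply Rle_antisym; apply Rnot_lt_le.
- apply (no_positive_leading_coef b C r n); assumption.
- intros Hneg.
  apply (no_positive_leading_coef (fun i => - b i) C r n Hr).
  + intros i; rewrite Rabs_Ropp; apply Hb.
  + intros m; rewrite (QInt_ext _ (fun x => -1 * (hN (wc k p m) p x * PSeries b (sin x ^ 2)))).
    * rewrite QInt_scal, H0; [ring |].
      intros x; apply continuous_Rmult; [apply cont_wN |].
      apply (continuous_comp (fun x => sin x ^ 2) (PSeries b)).
      -- apply continuous_Rpow, continuous_sin.
      -- apply (PSeries_continuous_unit b C r); [assumption | assumption | apply sin2_range].
    * intros x; change (fun i => - b i) with (PS_opp b); rewrite PSeries_opp; ring.
  + intros i Hi; rewrite IH by assumption; ring.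
  + lra.
Qed.

Lemma sqrt_k_range : 0 < sqrt k < 1.
Proof.
assert (H : 0 < sqrt k) by (apply sqrt_lt_R0; lra).
assert (E : sqrt k ^ 2 = k) by (apply pow2_sqrt; lra); nra.
Qed.

Lemma linear_factor_bound : exists C, 0 <= C /\
  forall n, sqrt (INR (2 * n + 1 + p)) * k ^ n <= C * sqrt k ^ n.
Proof.
assert (Hr := sqrt_k_range).
exists (2 * (sqrt k / (1 - sqrt k)) + 2); split.
- assert (0 < sqrt k / (1 - sqrt k)) by (apply Rdiv_lt_0_compat; lra); lra.
- intros n; assert (H := linear_geom (sqrt k) n Hr).
  assert (Hrn : 0 < sqrt k ^ n) by (apply pow_lt; lra).
  assert (Hrn1 : sqrt k ^ n <= 1) by (rewrite <- (pow1 n); apply pow_incr; lra).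
  assert (Hk : k ^ n = sqrt k ^ n * sqrt k ^ n).
  { rewrite <- Rpow_mult_distr; f_equal; symmetry; apply sqrt_sqrt; lra. }
  assert (Hn := pos_INR n).
  assert (Hj : 1 <= INR (2 * n + 1 + p) <= 2 * INR n + 2).
  { rewrite !plus_INR, mult_INR; destruct hp as [-> | ->]; simpl; lra. }
  assert (Hsq : sqrt (INR (2 * n + 1 + p)) <= INR (2 * n + 1 + p)).
  { rewrite <- (sqrt_pow2 (INR (2 * n + 1 + p))) at 2 by lra; apply sqrt_le_1_alt; nra. }
  rewrite Hk, <- Rmult_assoc; apply Rmult_le_compat_r; [lra |].
  apply Rle_trans with ((2 * INR n + 2) * sqrt k ^ n); [apply Rmult_le_compat_r; lra | nra].
Qed.

Lemma psi_geom (m : nat) : exists C, forall n, Rabs (psi k p m n) <= C * sqrt k ^ n.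
Proof.
destruct linear_factor_bound as [C [HC0 HC]].
assert (HM := moment_0_pos k p m hk hp).
exists (C * (PI / 2 / moment k p m 0)); intros n.
unfold psi; rewrite Rabs_mult, (Rabs_pos_eq (_ * k ^ n))
  by (apply Rmult_le_pos; [apply sqrt_pos | apply pow_le; lra]).
replace (C * (PI / 2 / moment k p m 0) * sqrt k ^ n)
  with (C * sqrt k ^ n * (PI / 2 / moment k p m 0)) by ring.
apply Rmult_le_compat; [| apply Rabs_pos | apply HC |].
- apply Rmult_le_pos; [apply sqrt_pos | apply pow_le; lra].
- unfold Rdiv at 1; rewrite Rabs_mult, (Rabs_pos_eq (/ _)) by (left; apply Rinv_0_lt_compat, HM).
  apply Rmult_le_compat_r; [left; apply Rinv_0_lt_compat, HM | apply moment_bound, hk].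
Qed.

(** The factor [sqrt (2 n + 1 + p) * k ^ n] of [psi] is moved over to [x]. Up to [moment 0], the
    scalar products become integrals of one power series in [sin ^ 2], whose coefficients decay
    geometrically even when [x] is merely bounded. *)
Lemma psi_complete (x : nat -> R) : bounded_seq x ->
  (forall m, Series (fun n => x n * psi k p m n) = 0) -> forall n, x n = 0.
Proof.
intros Hx H0 n.
destruct (bounded_seq_nonneg x Hx) as [X [HX0 HX]].
destruct linear_factor_bound as [C [HC0 HC]].
assert (Hr := sqrt_k_range).
set (b := fun n => x n * (sqrt (INR (2 * n + 1 + p)) * k ^ n)).
assert (Hb : forall i, Rabs (b i) <= X * C * sqrt k ^ i).
{ intros i; unfold b; rewrite Rabs_mult, Rmult_assoc.
  apply Rmult_le_compat; auto using Rabs_pos.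
  rewrite Rabs_pos_eq by (apply Rmult_le_pos; [apply sqrt_pos | apply pow_le; lra]).
  apply HC. }
assert (Hbn : b n = 0).
{ apply (coefficients_vanish b (X * C) (sqrt k) Hr Hb).
  intros m; assert (HM := moment_0_pos k p m hk hp).
  assert (HS := series_QInt b (hN (wc k p m) p) (X * C) 1 (sqrt k) Hr Hb (cont_wN m)
    (hN_bound k p m p)).
  rewrite <- (is_series_unique _ _ HS).
  transitivity (moment k p m 0 * Series (fun n => x n * psi k p m n)); [| rewrite H0; ring].
  rewrite <- Series_scal_l; apply Series_ext; intros i.
  rewrite (QInt_ext (fun x => hN (wc k p m) p x * sin x ^ (2 * i)) (hN (wc k p m) (2 * i + p))).
  - unfold b, psi; change (QInt (hN (wc k p m) (2 * i + p))) with (moment k p m i); field; lra.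
  - intros y; unfold hN; rewrite pow_add; ring. }
unfold b in Hbn; apply Rmult_integral in Hbn; destruct Hbn as [E | E]; trivial; exfalso.
apply Rmult_integral in E; destruct E as [E | E].
- assert (0 < sqrt (INR (2 * n + 1 + p))) by (apply sqrt_lt_R0, lt_0_INR; lia); lra.
- assert (0 < k ^ n) by (apply pow_lt; lra); lra.
Qed.

End Completeness.

(** * The two Hankel-type matrices *)

Section Hankel.

Variables (k : R) (p : nat).
Hypothesis hk : 0 < k < 1.
Hypothesis hp : p = 0%nat \/ p = 1%nat.

Let jj (n : nat) : R := INR (2 * n + 1 + p).

(** Both matrices at once: [jj m + jj n = 2 (m + n + 1 + p)], and [cbin] contains the powers of 4.
    The factor [2 / (INR p + 1)] cancels the 2 of the denominator for [p = 0]; for [p = 1] the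
    square roots do so. *)
Definition hmat (m n : nat) : R :=
  2 / (INR p + 1) * (sqrt (jj m) * (cbin p m * k ^ m)) * (sqrt (jj n) * (cbin p n * k ^ n))
  / (jj m + jj n).

Lemma jj_ge_1 (n : nat) : 1 <= jj n.
Proof. apply jj_pos. Qed.

Lemma hmat_sym (m n : nat) : hmat m n = hmat n m.
Proof. unfold hmat; rewrite (Rplus_comm (jj m)); unfold Rdiv; ring. Qed.

Lemma hmat_bound : exists B, forall m n, Rabs (hmat m n) <= B * sqrt k ^ m * sqrt k ^ n.
Proof.
destruct (linear_factor_bound k p hk hp) as [C [HC0 HC]].
assert (Hr := sqrt_k_range k hk).
assert (Hf : forall n, 0 <= sqrt (jj n) * (cbin p n * k ^ n) <= 2 * C * sqrt k ^ n).
{ intros n; assert (Hc := cbin_bound p n hp); assert (Hs := sqrt_pos (jj n)).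
  assert (Hkn : 0 < k ^ n) by (apply pow_lt; lra); split.
  - apply Rmult_le_pos; [assumption | nra].
  - apply Rle_trans with (2 * (sqrt (jj n) * k ^ n)); [| generalize (HC n); fold (jj n); lra].
    assert (0 <= sqrt (jj n) * k ^ n) by nra.
    replace (sqrt (jj n) * (cbin p n * k ^ n)) with (cbin p n * (sqrt (jj n) * k ^ n)) by ring.
    nra. }
exists (2 * (2 * C) * (2 * C)); intros m n.
assert (Hm := jj_ge_1 m); assert (Hn := jj_ge_1 n); assert (Hp := pos_INR p).
assert (F1 := Hf m); assert (F2 := Hf n).
assert (He : 0 <= 2 / (INR p + 1) <= 2).
{ assert (0 < / (INR p + 1) <= 1); [| unfold Rdiv; lra].
  split; [apply Rinv_0_lt_compat; lra |]. rewrite <- Rinv_1; apply Rinv_le_contravar; lra. }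
assert (Hd : 0 <= / (jj m + jj n) <= 1).
{ split; [left; apply Rinv_0_lt_compat; lra |]. rewrite <- Rinv_1; apply Rinv_le_contravar; lra. }
unfold hmat; set (a := sqrt (jj m) * _) in *; set (b := sqrt (jj n) * _) in *.
assert (Hmul : forall u v U V, 0 <= u <= U -> 0 <= v <= V -> 0 <= u * v <= U * V).
{ intros u v U V Hu Hv; split; [apply Rmult_le_pos | apply Rmult_le_compat]; lra. }
assert (Hall := Hmul _ _ _ _ (Hmul _ _ _ _ (Hmul _ _ _ _ He F1) F2) Hd).
change (2 / (INR p + 1) * a * b / (jj m + jj n)) with (2 / (INR p + 1) * a * b * / (jj m + jj n)).
rewrite Rabs_pos_eq by apply Hall.
replace (2 * (2 * C) * (2 * C) * sqrt k ^ m * sqrt k ^ n) with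
  (2 * (2 * C * sqrt k ^ m) * (2 * C * sqrt k ^ n) * 1) by ring.
apply Hall.
Qed.

(* [sum y_m y_n / (j_m + j_n)] is the integral over [0, 1] of [t * (sum y_n t ^ (2 n + p)) ^ 2]. *)
Lemma cauchy_form_nonneg (y : nat -> R) (N : nat) :
  0 <= sum_n (fun m => sum_n (fun n => y m * y n / (jj m + jj n)) N) N.
Proof.
set (P := fun t => sum_n (fun m => sum_n (fun n =>
  y m * y n / (jj m + jj n) * t ^ (2 * m + 1 + p + (2 * n + 1 + p))) N) N).
set (A := fun t => sum_n (fun n => y n * t ^ (2 * n + p)) N).
assert (Hterm : forall m n t, is_derive (fun t => y m * y n / (jj m + jj n) *
  t ^ (2 * m + 1 + p + (2 * n + 1 + p))) t (t * (y m * t ^ (2 * m + p)) * (y n * t ^ (2 * n + p)))).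
{ intros m n t; assert (Hm := jj_ge_1 m); assert (Hn := jj_ge_1 n).
  assert (HI : INR (2 * m + 1 + p + (2 * n + 1 + p)) = jj m + jj n) by apply plus_INR.
  replace (2 * m + 1 + p + (2 * n + 1 + p))%nat with (S (S (2 * m + p + (2 * n + p)))) in * by lia.
  evar_last; [apply is_derive_scal, (is_derive_pow (fun t => t) _ t 1), (is_derive_id t) |].
  rewrite HI; simpl pred; rewrite <- tech_pow_Rmult, pow_add; unfold one; simpl; field; lra. }
assert (HP : forall t, is_derive P t (t * A t ^ 2)).
{ intros t; unfold P; evar_last.
  - apply (is_derive_sum_n (fun m t => sum_n (fun n =>
      y m * y n / (jj m + jj n) * t ^ (2 * m + 1 + p + (2 * n + 1 + p))) N) N t
      (fun m => sum_n (fun n => t * (y m * t ^ (2 * m + p)) * (y n * t ^ (2 * n + p))) N)).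
    intros m _.
    apply (is_derive_sum_n (fun n t =>
      y m * y n / (jj m + jj n) * t ^ (2 * m + 1 + p + (2 * n + 1 + p))) N t
      (fun n => t * (y m * t ^ (2 * m + p)) * (y n * t ^ (2 * n + p)))).
    intros n _; apply Hterm.
  - transitivity (sum_n (fun m => (y m * t ^ (2 * m + p)) * (t * A t)) N).
    + apply sum_n_ext; intros m.
      transitivity (t * (y m * t ^ (2 * m + p)) * A t).
      * exact (sum_n_mult_l (t * (y m * t ^ (2 * m + p))) (fun n => y n * t ^ (2 * n + p)) N).
      * match goal with |- ?a = ?b => change (@eq R a b) end; ring.
    + transitivity (A t * (t * A t)).
      * exact (sum_n_mult_r (t * A t) (fun n => y n * t ^ (2 * n + p)) N).
      * match goal with |- ?a = ?b => change (@eq R a b) end; ring. }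
assert (P0 : P 0 = 0).
{ unfold P; transitivity (sum_n (fun _ => zero) N : R).
  - apply sum_n_ext; intros m; transitivity (sum_n (fun _ => zero) N : R).
    + apply sum_n_ext; intros n; rewrite pow_i by lia.
      match goal with |- ?a = ?b => change (@eq R a 0) end; ring.
    + rewrite sum_n_const; apply Rmult_0_r.
  - rewrite sum_n_const; apply Rmult_0_r. }
assert (P1 : P 1 = sum_n (fun m => sum_n (fun n => y m * y n / (jj m + jj n)) N) N).
{ unfold P; apply sum_n_ext; intros m; apply sum_n_ext; intros n; rewrite pow1.
  match goal with |- ?a = ?b => change (@eq R a b) end; ring. }
rewrite <- P1.
(* The integrand [t * A t ^ 2] is nonnegative on [0, 1], so the mean value theorem for its primitive
   [P] replaces the integral. *)
destruct (MVT_gen P 0 1 (fun t => t * A t ^ 2)) as [t [Ht E]].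
- intros t _; apply HP.
- intros t _; apply continuity_pt_filterlim, (ex_derive_continuous P); eexists; apply HP.
- rewrite Rmin_left, Rmax_right in Ht by lra.
  rewrite P0 in E; generalize (pow2_ge_0 (A t)); intros; nra.
Qed.

Lemma hmat_pos (x : nat -> R) (N : nat) :
  0 <= sum_n (fun m => sum_n (fun n => hmat m n * x n) N * x m) N.
Proof.
set (y := fun n => sqrt (jj n) * (cbin p n * k ^ n) * x n).
assert (Hp := pos_INR p).
assert (E : sum_n (fun m => sum_n (fun n => hmat m n * x n) N * x m) N =
  2 / (INR p + 1) * sum_n (fun m => sum_n (fun n => y m * y n / (jj m + jj n)) N) N).
{ symmetry.
  transitivity (sum_n (fun m => mult (2 / (INR p + 1)) (sum_n (fun n => y m * y n / (jj m + jj n)) N)) N).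
  - symmetry; exact (sum_n_mult_l (2 / (INR p + 1)) _ N).
  - apply sum_n_ext; intros m.
    transitivity (sum_n (fun n => mult (2 / (INR p + 1)) (y m * y n / (jj m + jj n))) N).
    + symmetry; exact (sum_n_mult_l (2 / (INR p + 1)) _ N).
    + transitivity (sum_n (fun n => mult (hmat m n * x n) (x m)) N).
      * apply sum_n_ext; intros n; unfold mult, y, hmat, Rdiv; simpl.
        match goal with |- ?a = ?b => change (@eq R a b) end; ring.
      * exact (sum_n_mult_r (x m) (fun n => hmat m n * x n) N). }
rewrite E; apply Rmult_le_pos; [| apply cauchy_form_nonneg].
left; apply Rdiv_lt_0_compat; lra.
Qed.

Definition hPsi (m n : nat) : R := psi k p m n / sqrt (INR p + 1).
(** The eigenvalue equation at index 0: row 0 against the eigenvector, divided by the entry of index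
    0. *)
Definition hnu (m : nat) : R := 2 / (INR p + 1) * (hsum k p m 0 / moment k p m 0).

Lemma sqrt_p_pos : 0 < sqrt (INR p + 1).
Proof. apply sqrt_lt_R0; generalize (pos_INR p); lra. Qed.

Lemma hPsi_geom (m : nat) : exists C, forall n, Rabs (hPsi m n) <= C * sqrt k ^ n.
Proof.
destruct (psi_geom k p hk hp m) as [C HC]; assert (Hs := sqrt_p_pos).
exists (C / sqrt (INR p + 1)); intros n; unfold hPsi, Rdiv.
rewrite Rabs_mult, (Rabs_pos_eq (/ _)) by (left; apply Rinv_0_lt_compat, Hs).
replace (C * / sqrt (INR p + 1) * sqrt k ^ n) with (C * sqrt k ^ n * / sqrt (INR p + 1)) by ring.
apply Rmult_le_compat_r; [left; apply Rinv_0_lt_compat, Hs | apply HC].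
Qed.

Lemma hPsi_0 (m : nat) : hPsi m 0 <> 0.
Proof.
assert (HM := moment_0_pos k p m hk hp); assert (Hs := sqrt_p_pos).
unfold hPsi, psi; rewrite Rdiv_diag by lra.
assert (0 < sqrt (INR (2 * 0 + 1 + p))) by (apply sqrt_lt_R0, lt_0_INR; lia).
apply Rgt_not_eq, Rdiv_lt_0_compat; [simpl pow; lra | assumption].
Qed.

Lemma hPsi_eigen (m i : nat) : mat_vec hmat (hPsi m) i = hnu m * hPsi m i.
Proof.
assert (HM := moment_0_pos k p m hk hp); assert (Hs := sqrt_p_pos).
assert (Hi := jj_ge_1 i); assert (Hp := pos_INR p).
assert (E := hsum_moment k p m hk hp i).
transitivity (2 / (INR p + 1) * sqrt (jj i) * k ^ i / moment k p m 0 / sqrt (INR p + 1)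
  * (cbin p i * hsum k p m i)).
- unfold hsum; rewrite <- Rmult_assoc, <- Series_scal_l; apply Series_ext; intros n.
  assert (Hn := jj_ge_1 n).
  unfold hmat, hPsi, psi, hweight, kmom; fold (jj n) (jj i).
  assert (Hsq : sqrt (jj n) * sqrt (jj n) = jj n) by (apply sqrt_sqrt; lra).
  rewrite <- pow_mult, Nat.mul_comm, pow_mult.
  field_simplify_eq; [| repeat split; lra].
  replace (sqrt (jj n) ^ 2) with (jj n) by (rewrite <- Hsq at 1; ring); ring.
- unfold hnu, hPsi, psi; fold (jj i).
  replace (cbin p i * hsum k p m i) with (hsum k p m 0 * moment k p m i / moment k p m 0)
    by (rewrite <- E; field; lra).
  field; lra.
Qed.

Lemma hPsi_complete (x : nat -> R) : ex_series (fun n => x n ^ 2) ->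
  (forall m, Series (fun n => x n * hPsi m n) = 0) -> forall n, x n = 0.
Proof.
intros Hx H0; assert (Hs := sqrt_p_pos).
apply (psi_complete k p hk hp).
- exists (sqrt (Series (fun n => x n ^ 2))); intros n.
  apply sqr_le_sqrt, (Series_term_le (fun n => x n ^ 2) n Hx); intros; apply pow2_ge_0.
- intros m; transitivity (sqrt (INR p + 1) * Series (fun n => x n * hPsi m n)).
  + rewrite <- Series_scal_l; apply Series_ext; intros n; unfold hPsi; field; lra.
  + rewrite H0; ring.
Qed.

(* [small m] is [q ^ (m + 1/2)] for [p = 0] and [q ^ (m + 1)] for [p = 1]. *)
Definition small (m : nat) : R := exp (- (freq k p m * Kc k)).

Lemma Kc_pos : 0 < Kc k.
Proof. apply (ellipticK_pos (kc k)), kc_range, hk. Qed.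

Lemma small_range (m : nat) : 0 < small m < 1.
Proof.
assert (Hf := freq_pos k p m hk); assert (HK := Kc_pos).
split; [apply exp_pos | rewrite <- exp_0; apply exp_increasing; nra].
Qed.

Lemma small_decreasing (m : nat) : small (S m) < small m.
Proof.
assert (HK := Kc_pos); assert (HE := ellipticK_pos k hk); assert (Hpi := PI_RGT_0).
apply exp_increasing, Ropp_lt_contravar, Rmult_lt_compat_r; [exact HK |].
unfold freq, Rdiv; apply Rmult_lt_compat_r; [apply Rinv_0_lt_compat; lra |].
apply Rmult_lt_compat_r; [exact Hpi | apply lt_INR; lia].
Qed.

Lemma exp_small (m : nat) : exp (freq k p m * Kc k) = / small m.
Proof. unfold small; rewrite exp_Ropp, Rinv_inv; reflexivity. Qed.

Lemma hnu_even (m : nat) : p = 0%nat -> hnu m = 4 / k * (small m / (1 + small m ^ 2)).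
Proof.
intros Hp; assert (HM := moment_0_pos k p m hk hp); assert (Hpi := PI_RGT_0).
assert (He := small_range m).
assert (HS := nu_series_even k p m hk Hp).
assert (HF := fourier_cn k p m hk Hp); fold (small m) in HF; rewrite exp_small in HF.
(* Row 0 contributes [(2 n + 1) / (2 n + 2)], which turns [wallis n] into [wallis (S n)], the
   integral occurring in [nu_series_even]. *)
assert (Hh : hsum k p m 0 = 2 / PI * (moment k p m 0 * kint k (hNc k (wc k p m)) 0)).
{ rewrite <- (is_series_unique _ _ HS), <- Series_scal_l.
  apply Series_ext; intros n.
  rewrite (QInt_ext (fun x => sin x ^ 2 * sin x ^ (2 * n)) (fun x => sin x ^ (2 * S n)))
    by (intros x; rewrite <- pow_add; f_equal; lia).
  change (QInt (fun x => sin x ^ (2 * S n))) with (wallis (S n)).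
  assert (HW := wallis_S n); assert (Hn := pos_INR n).
  unfold hweight; rewrite Hp, cbin_even, !plus_INR, !mult_INR; simpl INR.
  apply (Rmult_eq_reg_l (2 * INR n + 2)); [| lra].
  transitivity (2 / PI * kmom k 0 m n * ((2 * INR n + 1) * wallis n)); [field; lra |].
  rewrite <- HW; ring. }
assert (Hp' : INR p = 0) by (rewrite Hp; reflexivity).
unfold hnu; rewrite Hh, Hp'.
transitivity (4 / PI * kint k (hNc k (wc k p m)) 0); [field; split; lra |].
replace (kint k (hNc k (wc k p m)) 0) with (PI / k * (small m / (1 + small m ^ 2)))
  by (rewrite <- HF; field; split; nra).
field; repeat split; nra.
Qed.

Lemma hnu_odd (m : nat) : p = 1%nat -> hnu m = 8 / k ^ 2 * (small m / (1 + small m ^ 2)).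
Proof.
intros Hp; assert (HM := moment_0_pos k p m hk hp); assert (Hpi := PI_RGT_0).
assert (He := small_range m).
assert (HS := nu_series_odd k p m hk Hp).
assert (HF := fourier_dn k p m hk Hp); fold (small m) in HF; rewrite exp_small in HF.
assert (Hh : hsum k p m 0 = 4 / PI * (moment k p m 0 * (2 / k ^ 2 * kint k (hNd (ws k p m)) 0))).
{ rewrite <- (is_series_unique _ _ HS), <- Series_scal_l.
  apply Series_ext; intros n.
  assert (HI : QInt (fun x => (2 * sin x ^ 2 - 1) * sin x ^ 2 * sin x ^ (2 * n))
    = 2 * wallis (S (S n)) + -1 * wallis (S n)).
  { apply QInt_combination; [apply continuous_sin_pow | apply continuous_sin_pow |].
    intros x; replace (2 * S (S n))%nat with (2 + (2 + 2 * n))%nat by lia.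
    replace (2 * S n)%nat with (2 + 2 * n)%nat by lia; rewrite !pow_add; ring. }
  rewrite HI.
  assert (HW := wallis_S (S n)); rewrite S_INR in HW; assert (Hn := pos_INR n).
  unfold hweight; rewrite Hp, cbin_odd, !plus_INR, !mult_INR; simpl INR.
  apply (Rmult_eq_reg_l (2 * (INR n + 1) + 2)); [| lra].
  transitivity (4 / PI * kmom k 1 m n * (2 * ((2 * (INR n + 1) + 1) * wallis (S n))
    - (2 * (INR n + 1) + 2) * wallis (S n))); [field; lra |].
  rewrite <- HW; ring. }
assert (Hp' : INR p = 1) by (rewrite Hp; reflexivity).
unfold hnu; rewrite Hh, Hp'.
transitivity (8 / (PI * k ^ 2) * kint k (hNd (ws k p m)) 0); [field; repeat split; lra |].
replace (kint k (hNd (ws k p m)) 0) with (PI * (small m / (1 + small m ^ 2)))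
  by (rewrite <- HF; field; split; nra).
field; repeat split; nra.
Qed.

Lemma hnu_decreasing (m : nat) : hnu (S m) < hnu m.
Proof.
assert (H1 := small_range m); assert (H2 := small_range (S m)); assert (H3 := small_decreasing m).
assert (Hlt : small (S m) / (1 + small (S m) ^ 2) < small m / (1 + small m ^ 2)).
{ apply (Rmult_lt_reg_r ((1 + small (S m) ^ 2) * (1 + small m ^ 2))); [nra |].
  replace (small (S m) / (1 + small (S m) ^ 2) * ((1 + small (S m) ^ 2) * (1 + small m ^ 2)))
    with (small (S m) * (1 + small m ^ 2)) by (field; nra).
  replace (small m / (1 + small m ^ 2) * ((1 + small (S m) ^ 2) * (1 + small m ^ 2)))
    with (small m * (1 + small (S m) ^ 2)) by (field; nra).
  (* The function t / (1 + t^2) increases on (0, 1): its cross-multiplied difference factors like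
     this. *)
  assert (0 < (small m - small (S m)) * (1 - small m * small (S m))); [| nra].
  apply Rmult_lt_0_compat; nra. }
destruct hp as [Hp | Hp].
- rewrite !hnu_even by assumption; apply Rmult_lt_compat_l; [apply Rdiv_lt_0_compat; lra | exact Hlt].
- rewrite !hnu_odd by assumption; apply Rmult_lt_compat_l; [apply Rdiv_lt_0_compat; nra | exact Hlt].
Qed.

Lemma hPsi_norm (m : nat) : l2norm (fun n => RtoC (hPsi m n)) ^ 2 =
  QInt (fun x => hM k (freq k p m) (ws k p m) p x * kint k (hN (wc k p m) p) (sin x ^ 2))
  / ((INR p + 1) * moment k p m 0 ^ 2).
Proof.
assert (HM := moment_0_pos k p m hk hp); assert (Hp := pos_INR p); assert (Hs := sqrt_p_pos).
rewrite l2norm_sqr by (apply (Psi_l2 (sqrt k) (sqrt_k_range k hk)), hPsi_geom).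
rewrite <- (is_series_unique _ _ (weighted_norm k p m hk hp)).
unfold Rdiv; rewrite Rmult_comm, <- Series_scal_l; apply Series_ext; intros n.
rewrite Cmod_R, pow2_abs; unfold hPsi, psi; fold (jj n).
assert (Hj := jj_ge_1 n).
assert (Hsq : sqrt (jj n) ^ 2 = jj n) by (apply pow2_sqrt; lra).
assert (Hsp : sqrt (INR p + 1) ^ 2 = INR p + 1) by (apply pow2_sqrt; lra).
assert (Hk : (k ^ 2) ^ n = (k ^ n) ^ 2) by (rewrite <- !pow_mult, Nat.mul_comm; trivial).
transitivity (sqrt (jj n) ^ 2 * (k ^ n) ^ 2 * (moment k p m n / moment k p m 0) ^ 2
  / sqrt (INR p + 1) ^ 2); [field; lra |].
rewrite Hsq, Hsp, Hk; field; lra.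
Qed.

(** The squared norm is [ellipticK k / (2 * moment 0)], and [fourier_sn] supplies [moment 0]. *)
Lemma hPsi_norm_even (m : nat) : p = 0%nat -> l2norm (fun n => RtoC (hPsi m n)) ^ 2 =
  k * ellipticK k ^ 2 / PI ^ 2 * ((1 - small m ^ 2) / ((2 * INR m + 1) * small m)).
Proof.
intros Hp; assert (HM := moment_0_pos k p m hk hp); assert (Hpi := PI_RGT_0).
assert (He := small_range m); assert (HK := ellipticK_pos k hk); assert (Hm := pos_INR m).
assert (HF := fourier_sn k p m hk Hp); fold (small m) in HF; rewrite exp_small in HF.
rewrite hPsi_norm, norm_integral_even by assumption.
assert (HM0 : moment k p m 0 = kint k (hN (wc k p m) 0) 0)
  by (rewrite moment_0 by assumption; rewrite Hp at 2; reflexivity).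
rewrite <- HM0 in HF.
assert (Hf : freq k p m = (2 * INR m + 1) * PI / (2 * ellipticK k)).
{ unfold freq; rewrite !plus_INR, mult_INR, Hp; simpl; field; lra. }
rewrite Hf in HF.
assert (HM' : moment k p m 0 = (2 * INR m + 1) * PI ^ 2 / (2 * ellipticK k * k)
  * small m / (1 - small m ^ 2)).
{ apply (Rmult_eq_reg_r (/ small m - small m)).
  - rewrite HF; field; repeat split; nra.
  - assert (1 < / small m) by (rewrite <- Rinv_1; apply Rinv_lt_contravar; lra); lra. }
transitivity (ellipticK k / 2 / moment k p m 0); [replace (INR p) with 0 by (rewrite Hp; reflexivity); field; lra |].
rewrite HM'; field; repeat split; nra.
Qed.

(** The squared norm is [ellipticK k / (2 * freq * moment 0)], and [moment 0] is proportional to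
    [freq ^ 2] by [fourier_sn2]; hence the third power of [INR (S m)] and the fourth power of the
    period. *)
Lemma hPsi_norm_odd (m : nat) : p = 1%nat -> l2norm (fun n => RtoC (hPsi m n)) ^ 2 =
  k ^ 2 * ellipticK k ^ 4 / PI ^ 4 * ((1 - small m ^ 2) / (INR (S m) ^ 3 * small m)).
Proof.
intros Hp; assert (HM := moment_0_pos k p m hk hp); assert (Hpi := PI_RGT_0).
assert (He := small_range m); assert (HK := ellipticK_pos k hk); assert (Hm := pos_INR m).
assert (HF := fourier_sn2 k p m hk Hp); fold (small m) in HF; rewrite exp_small in HF.
rewrite hPsi_norm, norm_integral_odd by assumption.
assert (HM0 : moment k p m 0 = kint k (hN (wc k p m) 1) 0)
  by (rewrite moment_0 by assumption; rewrite Hp at 2; reflexivity).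
rewrite <- HM0 in HF.
assert (Hf : freq k p m = (INR m + 1) * PI / ellipticK k).
{ unfold freq; rewrite !plus_INR, mult_INR, Hp; simpl; field; lra. }
rewrite Hf in *.
assert (HM' : moment k p m 0 = ((INR m + 1) * PI / ellipticK k) ^ 2 * PI / (2 * k ^ 2)
  * small m / (1 - small m ^ 2)).
{ apply (Rmult_eq_reg_r (/ small m - small m)).
  - rewrite HF; field; repeat split; nra.
  - assert (1 < / small m) by (rewrite <- Rinv_1; apply Rinv_lt_contravar; lra); lra. }
transitivity (ellipticK k ^ 2 / (2 * (INR m + 1) * PI) / moment k p m 0).
- replace (INR p) with 1 by (rewrite Hp; reflexivity); field; repeat split; lra.
- rewrite HM', S_INR; field; repeat split; nra.
Qed.

Lemma hankel_operator : exists T,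
  bounded_operator T /\ represents hmat T /\ positive_operator T /\ trace_class T /\
  simple_eigenvalues T /\ eigenvalues_in_descending_order T hnu /\
  forall m, is_eigenvector T (RtoC (hnu m)) (fun n => RtoC (hPsi m n)).
Proof.
destruct hmat_bound as [B HB]; assert (Hr := sqrt_k_range k hk).
exists (mat_op hmat).
split; [apply (mat_op_bounded _ B (sqrt k) Hr HB) |].
split; [apply (mat_op_represents _ B (sqrt k) Hr HB) |].
split; [apply (mat_op_positive _ B (sqrt k) Hr HB hmat_sym hmat_pos) |].
split; [apply (mat_op_trace_class _ B (sqrt k) Hr HB hmat_sym hmat_pos) |].
split; [apply (mat_op_simple _ B (sqrt k) Hr HB hmat_sym hPsi hnu hPsi_geom hPsi_0 hPsi_eigen
  hnu_decreasing hPsi_complete) |].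
split; [apply (mat_op_eigenvalues _ B (sqrt k) Hr HB hmat_sym hPsi hnu hPsi_geom hPsi_0 hPsi_eigen
  hnu_decreasing hPsi_complete) |].
apply (Psi_eigenvector _ (sqrt k) Hr hPsi hnu hPsi_geom hPsi_0 hPsi_eigen).
Qed.

End Hankel.

(** * Return to the matrices, polynomials and powers of the nome *)

Section Identification.

Variable k : R.
Hypothesis hk : 0 < k < 1.

Lemma hmat_Hf (m n : nat) : hmat k 0 m n = Hf k m n.
Proof.
assert (Hm := pos_INR m); assert (Hn := pos_INR n).
unfold hmat, Hf, cbin, Rdiv; rewrite pow_add, !Rpow_mult_distr, !pow_inv.
replace (INR (2 * m + 1 + 0)) with (2 * INR m + 1) by (rewrite !plus_INR, mult_INR; simpl; ring).
replace (INR (2 * n + 1 + 0)) with (2 * INR n + 1) by (rewrite !plus_INR, mult_INR; simpl; ring).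
rewrite !Nat.add_0_r, sqrt_mult by lra; simpl INR.
field; repeat split; try lra; apply pow_nonzero; lra.
Qed.

Lemma hmat_Hg (m n : nat) : hmat k 1 m n = Hg k m n.
Proof.
assert (Hm := pos_INR m); assert (Hn := pos_INR n).
unfold hmat, Hg, cbin, Rdiv; rewrite pow_add, !Rpow_mult_distr, !pow_inv.
replace (INR (2 * m + 1 + 1)) with (2 * (INR m + 1)) by (rewrite !plus_INR, mult_INR; simpl; ring).
replace (INR (2 * n + 1 + 1)) with (2 * (INR n + 1)) by (rewrite !plus_INR, mult_INR; simpl; ring).
rewrite !(sqrt_mult 2), sqrt_mult by lra; simpl INR.
assert (H2 : sqrt 2 ^ 2 = 2) by (apply pow2_sqrt; lra).
field_simplify_eq; [ring [H2] | repeat split; try lra; apply pow_nonzero; lra].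
Qed.

Lemma hPsi_f (m : nat) : (fun n => RtoC (hPsi k 0 m n)) = Psi_f k m.
Proof.
apply functional_extensionality; intros n; unfold hPsi, psi, Psi_f; f_equal.
assert (HM := moment_0_pos k 0 m hk (or_introl eq_refl)).
assert (HS := SC_f_moment k 0 m hk (or_introl eq_refl) n eq_refl).
assert (HK := ellipticK_pos k hk); assert (Hn := pos_INR n).
replace (- (PI ^ 2 * (2 * INR m + 1) ^ 2 / (4 * ellipticK k ^ 2))) with (- freq k 0 m ^ 2).
2: unfold freq; rewrite !plus_INR, mult_INR; simpl INR; field; lra.
replace (INR (2 * n + 1 + 0)) with (2 * INR n + 1) by (rewrite !plus_INR, mult_INR; simpl; ring).
replace (INR 0 + 1) with 1 by (simpl; ring); rewrite sqrt_1.
replace (SC_f k n (- freq k 0 m ^ 2)) with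
  ((k ^ 2) ^ n * INR (fact (2 * n + 1)) * moment k 0 m n / moment k 0 m 0)
  by (rewrite <- HS; field; lra).
replace (2 * n + 1)%nat with (S (2 * n)) by lia.
rewrite fact_simpl, mult_INR, S_INR, mult_INR; simpl (INR 2).
assert (Hs : 0 < sqrt (2 * INR n + 1)) by (apply sqrt_lt_R0; lra).
assert (Hs2 : sqrt (2 * INR n + 1) ^ 2 = 2 * INR n + 1) by (apply pow2_sqrt; lra).
assert (Hkn : 0 < k ^ n) by (apply pow_lt; lra).
assert (Hfa := INR_fact_neq_0 (2 * n)).
assert (Hk : (k ^ 2) ^ n = (k ^ n) ^ 2) by (rewrite <- !pow_mult, Nat.mul_comm; trivial).
rewrite Hk; field_simplify_eq; [| repeat split; try lra; assumption].
rewrite Hs2; ring.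
Qed.

(** For [p = 1] the frequency is [(m + 1) * PI / ellipticK k], hence the shift of index. Division by
    [sqrt (INR p + 1)] in [hPsi] removes the [sqrt 2] contained in [sqrt (2 * (INR n + 1))]. *)
Lemma hPsi_g (m : nat) : (fun n => RtoC (hPsi k 1 m n)) = Psi_g k (S m).
Proof.
apply functional_extensionality; intros n; unfold hPsi, psi, Psi_g; f_equal.
assert (HM := moment_0_pos k 1 m hk (or_intror eq_refl)).
assert (HS := SC_g_moment k 1 m hk (or_intror eq_refl) n eq_refl).
assert (HK := ellipticK_pos k hk); assert (Hn := pos_INR n).
replace (- (PI ^ 2 * INR (S m) ^ 2 / ellipticK k ^ 2)) with (- freq k 1 m ^ 2).
2: unfold freq; rewrite !plus_INR, mult_INR, (S_INR m); simpl INR; field; lra.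
replace (INR (2 * n + 1 + 1)) with (2 * (INR n + 1)) by (rewrite !plus_INR, mult_INR; simpl; ring).
replace (INR 1 + 1) with 2 by (simpl; ring); rewrite sqrt_mult by lra.
replace (SC_g k n (- freq k 1 m ^ 2)) with
  ((k ^ 2) ^ n * INR (fact (2 * n + 2)) * moment k 1 m n / moment k 1 m 0 / 2)
  by (rewrite <- HS; field; lra).
replace (2 * n + 2)%nat with (S (2 * n + 1)) by lia.
rewrite fact_simpl, mult_INR, S_INR, plus_INR, mult_INR; simpl (INR 2); simpl (INR 1).
assert (Hs : 0 < sqrt (INR n + 1)) by (apply sqrt_lt_R0; lra).
assert (Ht : 0 < sqrt 2) by (apply sqrt_lt_R0; lra).
assert (Hs2 : sqrt (INR n + 1) ^ 2 = INR n + 1) by (apply pow2_sqrt; lra).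
assert (Hkn : 0 < k ^ n) by (apply pow_lt; lra).
assert (Hfa := INR_fact_neq_0 (2 * n + 1)).
assert (Hk : (k ^ 2) ^ n = (k ^ n) ^ 2) by (rewrite <- !pow_mult, Nat.mul_comm; trivial).
rewrite Hk; field_simplify_eq; [| repeat split; try lra; assumption].
rewrite Hs2; ring.
Qed.

Lemma exp_nat_mul (x : R) (n : nat) : exp x ^ n = exp (INR n * x).
Proof.
induction n as [|n IH]; [simpl; rewrite Rmult_0_l, exp_0; trivial |].
rewrite <- tech_pow_Rmult, IH, S_INR, <- exp_plus; f_equal; ring.
Qed.

Lemma small_f (m : nat) : Rpower (nome k) (INR m + 1 / 2) = small k 0 m.
Proof.
unfold Rpower, nome, small, freq, Kc; rewrite ln_exp; f_equal.
rewrite !plus_INR, mult_INR; simpl INR; field; apply Rgt_not_eq, ellipticK_pos, hk.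
Qed.

Lemma small_f_sqr (m : nat) : nome k ^ (2 * m + 1) = small k 0 m ^ 2.
Proof.
unfold nome, small, freq, Kc; rewrite !exp_nat_mul; f_equal.
rewrite !plus_INR, mult_INR; simpl INR; field; apply Rgt_not_eq, ellipticK_pos, hk.
Qed.

Lemma small_g (m : nat) : nome k ^ S m = small k 1 m.
Proof.
unfold nome, small, freq, Kc; rewrite !exp_nat_mul; f_equal.
rewrite !plus_INR, mult_INR, (S_INR m); simpl INR; field; apply Rgt_not_eq, ellipticK_pos, hk.
Qed.

Lemma small_g_sqr (m : nat) : nome k ^ (2 * S m) = small k 1 m ^ 2.
Proof. rewrite Nat.mul_comm, pow_mult, small_g; reflexivity. Qed.

Lemma hnu_f (m : nat) : hnu k 0 m = nu_f k m.
Proof.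
unfold nu_f; rewrite small_f, small_f_sqr.
apply hnu_even; auto.
Qed.

Lemma hnu_g (m : nat) : hnu k 1 m = nu_g k (S m).
Proof.
unfold nu_g; rewrite small_g, small_g_sqr.
apply hnu_odd; auto.
Qed.

End Identification.

Theorem theorem16 (k : R) (hk : 0 < k < 1) :
  (exists T : (nat -> C) -> (nat -> C),
     bounded_operator T /\ represents (Hf k) T /\
     positive_operator T /\ trace_class T /\ simple_eigenvalues T /\
     eigenvalues_in_descending_order T (nu_f k) /\
     forall m : nat,
       is_eigenvector T (RtoC (nu_f k m)) (Psi_f k m) /\
       l2norm (Psi_f k m) ^ 2 =
         k * ellipticK k ^ 2 / PI ^ 2
         * ((1 - nome k ^ (2 * m + 1))
            / ((2 * INR m + 1) * Rpower (nome k) (INR m + 1 / 2)))) /\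
  (exists T : (nat -> C) -> (nat -> C),
     bounded_operator T /\ represents (Hg k) T /\
     positive_operator T /\ trace_class T /\ simple_eigenvalues T /\
     eigenvalues_in_descending_order T (fun m => nu_g k (S m)) /\
     forall m : nat, (1 <= m)%nat ->
       is_eigenvector T (RtoC (nu_g k m)) (Psi_g k m) /\
       l2norm (Psi_g k m) ^ 2 =
         k ^ 2 * ellipticK k ^ 4 / PI ^ 4
         * ((1 - nome k ^ (2 * m)) / (INR m ^ 3 * nome k ^ m))).
Proof.
split.
- destruct (hankel_operator k 0 hk (or_introl eq_refl)) as
    [T [HT1 [HT2 [HT3 [HT4 [HT5 [[HT6 HT7] HT8]]]]]]].
  exists T; split; [exact HT1 |].
  split; [intros m n; rewrite HT2; f_equal; apply hmat_Hf; exact hk |].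
  split; [exact HT3 |]; split; [exact HT4 |]; split; [exact HT5 |]; split.
  + split; [intros m; rewrite <- !hnu_f by exact hk; apply HT6 |].
    intros lambda; rewrite HT7; split; intros [m Em]; exists m;
      [rewrite <- hnu_f by exact hk | rewrite hnu_f by exact hk]; exact Em.
  + intros m; rewrite <- hnu_f, <- hPsi_f by exact hk; split; [apply HT8 |].
    rewrite small_f, small_f_sqr by exact hk; apply hPsi_norm_even; auto.
- destruct (hankel_operator k 1 hk (or_intror eq_refl)) as
    [T [HT1 [HT2 [HT3 [HT4 [HT5 [[HT6 HT7] HT8]]]]]]].
  exists T; split; [exact HT1 |].
  split; [intros m n; rewrite HT2; f_equal; apply hmat_Hg; exact hk |].
  split; [exact HT3 |]; split; [exact HT4 |]; split; [exact HT5 |]; split.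
  + split; [intros m; rewrite <- !hnu_g by exact hk; apply HT6 |].
    intros lambda; rewrite HT7; split; intros [m Em]; exists m;
      [rewrite <- hnu_g by exact hk | rewrite hnu_g by exact hk]; exact Em.
  + intros [|m] Hm; [lia |].
    rewrite <- hnu_g, <- hPsi_g by exact hk; split; [apply HT8 |].
    rewrite small_g, small_g_sqr by exact hk; apply hPsi_norm_odd; auto.
Qed.
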